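(* Let $\mathbb{K}$ be an algebraically closed field of characteristic $p>2$, let $r\ge1$ with $p\nmid r$, $n\ge1$, and let $W_{r,n}=(\mathbb{Z}/r\mathbb{Z})\wr\mathfrak{S}_n$. The simple completely splittable $\mathbb{K}W_{r,n}$-modules are indexed (up to isomorphism) by the $r$-splittable shapes $\bm{\lambda}$ of size $n$. The module $D^{\bm{\lambda}}$ corresponding to such a $\bm{\lambda}$ has a basis $\{v_{\mathfrak{t}}\}$ indexed by the $p$-standard tableaux $\mathfrak{t}$ of shape $\bm{\lambda}$, on which the generators act by $$t_{j}v_{\mathfrak{t}}=\zeta_{\mathrm{p}_{j}}v_{\mathfrak{t}}\qquad(1\leq j\leq n),$$ and, for $1\le i\le n-1$, $$g_{i}v_{\mathfrak{t}}=v_{s_{i}\mathfrak{t}}\quad\text{ if }\mathrm{p}_{i}\neq \mathrm{p}_{i+1},$$ $$g_{i}v_{\mathfrak{t}}=(\mathrm{c}_{i+1}-\mathrm{c}_{i})^{-1}v_{\mathfrak{t}}+\sqrt{1-(\mathrm{c}_{i+1}-\mathrm{c}_{i})^{-2}}\;v_{s_{i}\mathfrak{t}}\quad\text{ if }\mathrm{p}_{i}=\mathrm{p}_{i+1},$$ where $\mathrm{p}_i$ is the index of the component of $\bm\lambda$ containing the box of $\mathfrak{t}$ with entry $i$, and $\mathrm{c}_i\in\mathbb{K}$ is the content of that box; a fixed choice of square roots in $\mathbb{K}$ is used, and the second term is read as $0$ when its coefficient is $0$.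
   Context: $W_{r,n}$ is generated by $t_1,\dots,t_n,g_1,\dots,g_{n-1}$ with relations $t_j^r=1$, $t_it_j=t_jt_i$, $g_it_j=t_{s_i(j)}g_i$, $g_i^2=1$, $g_ig_{i+1}g_i=g_{i+1}g_ig_{i+1}$, $g_ig_j=g_jg_i$ for $|i-j|>1$, where $s_i=(i,i+1)$; so the $g_i$ generate $\mathfrak{S}_n$. Fix a primitive $r$-th root of unity $\zeta\in\mathbb{K}$ and put $\zeta_k=\zeta^{k-1}$, $1\le k\le r$. The Jucys-Murphy elements are $\xi_k=\sum_{i=1}^{k-1}\sum_{s=0}^{r-1}t_i^st_k^{-s}(i,k)$, $1\le k\le n$. A (finite-dimensional) $\mathbb{K}W_{r,n}$-module is completely splittable if all $\xi_k$ act semisimply (diagonalizably) on it. A partition $\lambda=(\lambda_1\ge\dots\ge\lambda_k>0)$ is $p$-regular if no $p$ of its nonzero parts are equal. A $p$-regular partition $\lambda$ is a splittable shape if $\chi(\lambda)\le p$, where $\chi(\lambda)=\lambda_1-\lambda_k+k$ ($k$ being the number of nonzero parts); the empty partition is also a splittable shape. An $r$-splittable shape is an $r$-partition $\bm\lambda=(\lambda^{(1)},\dots,\lambda^{(r)})$ of $n$ (total size $n$) each of whose components is a splittable shape. A box of $\bm\lambda$ is written $((i,j),k)$: row $i$, column $j$ of $\lambda^{(k)}$; its content is $j-i$, viewed in $\mathbb{K}$. A standard $\bm\lambda$-tableau is a bijective filling of the boxes of $\bm\lambda$ by $1,\dots,n$ increasing along rows (left to right) and down columns in each component. It is called $p$-standard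 if for any two boxes $((i,j),k)$ and $((i',j'),k)$ in the same component with $i>i'$, $j<j'$ and $i-i'+j'-j+1=p$, one has $\mathfrak{t}((i',j'),k)>\mathfrak{t}((i,j),k)$, where $\mathfrak{t}((i,j),k)$ is the entry in box $((i,j),k)$. $s_i\mathfrak{t}$ is obtained from $\mathfrak{t}$ by exchanging $i$ and $i+1$. *)

(* Defs.v *)
From HB Require Import structures.
From mathcomp Require Import all_boot all_order all_fingroup all_algebra.
From mathcomp Require Import all_solvable all_field all_character.

Set Implicit Arguments.
Unset Strict Implicit.
Unset Printing Implicit Defensive.

Import GroupScope GRing.Theory.

(* The additive group of ['I_r.-1.+1] is Z/r for every r >= 1, including r = 1
   (whereas ['Z_1] would be Z/2). *)
Definition wr_base (r n : nat) : finGroupType :=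
  {dffun forall _ : 'I_n, 'I_r.-1.+1}.

Section WreathProduct.
Variables r n : nat.

Definition wr_act_fun (x : wr_base r n) (s : {perm 'I_n}) : wr_base r n :=
  [ffun i => x (s^-1 i)].

Lemma wr_act_is_action : is_action [set: {perm 'I_n}] wr_act_fun.
Proof.
split=> [s x y /ffunP exy | x s u _ _].
  by apply/ffunP=> i; have := exy (s i); rewrite !ffunE permK.
by apply/ffunP=> i; rewrite !ffunE invMg permM.
Qed.

Canonical wr_action := Action wr_act_is_action.

Lemma wr_act_is_groupAction : is_groupAction [set: wr_base r n] wr_action.
Proof.
move=> s _ /=; rewrite inE; apply/andP; split.
  by apply/subsetP=> x _; rewrite inE.
by apply/morphicP=> x y _ _; rewrite !actpermE; apply/ffunP=> i; rewrite !ffunE.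
Qed.

Canonical wr_groupAction := GroupAction wr_act_is_groupAction.

Definition wreath : finGroupType := sdprod_by wr_groupAction.

(* Indices are 0-based: [wr_t j] is t_{j+1}. *)
Definition wr_t (j : 'I_n) : wreath :=
  sdpair1 wr_groupAction [ffun i => if i == j then inZp 1 else inZp 0].

Definition wr_s (s : {perm 'I_n}) : wreath := sdpair2 wr_groupAction s.

(* The transposition (i, k); g_i is [wr_g i k] with k = i + 1. *)
Definition wr_g (i k : 'I_n) : wreath := wr_s (tperm i k).

Lemma wr_tX (j : 'I_n) m :
  wr_t j ^+ m = sdpair1 wr_groupAction
                  [ffun i => if i == j then inZp m else inZp 0].
Proof.
elim: m => [|m IHm].
  rewrite expg0 -(morph1 (sdpair1_morphism wr_groupAction)) /=; congr sdpair1.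
  by apply/ffunP=> i; rewrite !ffunE if_same; apply/val_inj.
rewrite expgS IHm -sdpair1_morphM ?inE //; congr sdpair1.
apply/ffunP=> i; rewrite !ffunE; case: eqP => _; apply/val_inj=> /=.
  by rewrite modnDm add1n.
by rewrite !mod0n.
Qed.

Lemma wr_t_expg (j : 'I_n) : 0 < r -> wr_t j ^+ r = 1.
Proof.
move=> r_gt0; rewrite wr_tX -(morph1 (sdpair1_morphism wr_groupAction)) /=.
congr sdpair1; apply/ffunP=> i; rewrite !ffunE; apply/val_inj.
by case: eqP => _ /=; rewrite ?mod0n // prednK // modnn.
Qed.

Lemma wr_tC (i j : 'I_n) : wr_t i * wr_t j = wr_t j * wr_t i.
Proof.
rewrite -!sdpair1_morphM ?inE //; congr sdpair1.
by apply/ffunP=> k; rewrite !ffunE; apply/val_inj; rewrite /= addnC.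
Qed.

Lemma wr_sM (s u : {perm 'I_n}) : wr_s (s * u) = wr_s s * wr_s u.
Proof. by rewrite /wr_s sdpair2_morphM ?inE. Qed.

Lemma wr_t_s (j : 'I_n) (s : {perm 'I_n}) :
  wr_t j * wr_s s = wr_s s * wr_t (s j).
Proof.
rewrite conjgC -sdpair_act ?inE //; congr (_ * sdpair1 _ _).
by apply/ffunP=> i; rewrite !ffunE -(inj_eq (@perm_inj _ s)) permKV.
Qed.

Lemma wr_g_t (i k j : 'I_n) :
  wr_g i k * wr_t j = wr_t (tperm i k j) * wr_g i k.
Proof. by rewrite wr_t_s tpermK. Qed.

End WreathProduct.

(* The product of [{perm 'I_n}] composes from left to right, so [wreath r n] is
   the opposite of the group written with right-to-left composition, and the
   usual left modules are the row-vector (right) modules of [mx_representation],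
   x acting by v |-> v *m rG x.  The defining relations and the elements xi_k
   are unchanged when all products are reversed. *)
Definition wr_repr (K : fieldType) (r n d : nat) :=
  mx_representation K [set: wreath r n] d.

Section JucysMurphy.
Local Open Scope ring_scope.
Variables (K : fieldType) (r n d : nat) (rG : wr_repr K r n d).

Definition jucys_murphy (k : 'I_n) : 'M[K]_d :=
  \sum_(i < n | (i < k)%N) \sum_(s < r)
     rG (wr_t r i ^+ s * wr_t r k ^- s * wr_g r i k)%g.

Definition completely_splittable : Prop :=
  forall k : 'I_n, diagonalizable (jucys_murphy k).

End JucysMurphy.

Definition is_partition (l : seq nat) : bool :=
  sorted geq l && all (fun m => 0 < m) l.

Definition p_regular (p : nat) (l : seq nat) : bool :=
  all (fun m => count_mem m l < p) l.

Definition chi (l : seq nat) : nat := head 0 l - last 0 l + size l.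

Definition splittable_shape (p : nat) (l : seq nat) : bool :=
  (l == [::]) || [&& is_partition l, p_regular p l & chi l <= p].

Definition r_splittable_shape (p r n : nat) (l : r.-tuple (seq nat)) : bool :=
  [forall k : 'I_r, splittable_shape p (tnth l k)]
  && (\sum_(k < r) sumn (tnth l k) == n).

(* ((i, j), k): row i, column j, component k, all 0-based.  Rows and columns of
   an r-partition of n are < n, so no box is lost. *)
Notation box r n := (('I_n * 'I_n * 'I_r)%type).

Definition diagram (r n : nat) (l : r.-tuple (seq nat)) : {set box r n} :=
  [set b : box r n | b.1.2 < nth 0 (tnth l b.2) b.1.1].

(* A bijective filling is recorded by its inverse: [t a] is the box of the entry
   a + 1.  A condition on the entries of two boxes is then a condition on the
   boxes of two entries. *)
Definition filling (r n : nat) : finType := {ffun 'I_n -> box r n}.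

Section Tableaux.
Variables r n : nat.
Implicit Types t : filling r n.

Definition box_row t (a : 'I_n) : nat := (t a).1.1.
Definition box_col t (a : 'I_n) : nat := (t a).1.2.
Definition box_comp t (a : 'I_n) : 'I_r := (t a).2.

Definition content (K : fieldType) t (a : 'I_n) : K :=
  ((box_col t a)%:R - (box_row t a)%:R)%R.

Definition swap_entries (i k : 'I_n) t : filling r n :=
  [ffun a => t (tperm i k a)].

Definition is_tableau (l : r.-tuple (seq nat)) t : bool :=
  injectiveb t && ([set t a | a : 'I_n] == diagram n l).

Definition is_standard t : bool :=
  [forall a : 'I_n, forall b : 'I_n, (box_comp t a == box_comp t b) ==>
     (((box_row t a == box_row t b) && (box_col t a < box_col t b) ==> (a < b))
      && ((box_col t a == box_col t b) && (box_row t a < box_row t b) ==> (a < b)))].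

Definition is_p_standard (p : nat) t : bool :=
  [forall a : 'I_n, forall b : 'I_n,
     [&& box_comp t a == box_comp t b, box_row t b < box_row t a,
         box_col t a < box_col t b
       & box_row t a - box_row t b + (box_col t b - box_col t a) + 1 == p]
     ==> (a < b)].

Definition p_standard_tableaux (p : nat) (l : r.-tuple (seq nat)) :
    {set filling r n} :=
  [set t | [&& is_tableau l t, is_standard t & is_p_standard p t]].

End Tableaux.

(* Main.v *)
(** On a completely splittable module the t_j and the xi_k are simultaneously
    diagonalizable, and a simultaneous eigenvector has a weight: a sequence of
    pairs (component, residue), the residue being the xi_k-eigenvalue over r.
    Suitably normalized intertwiners between weight spaces satisfy the braid
    relations, and square to 1, or to 0 when adjacent residues in one component
    differ by 1 or -1.  Since a word in the adjacent transpositions has a normal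
    form, a nonzero composite of intertwiners depends only on its permutation.
    Equal entries of a weight are never exchanged, so a closed path with nonzero
    composite is trivial; in a simple module this makes the intertwiners with
    square 0 vanish, and path independence yields a nonzero homomorphism from
    some D^lambda.

    Combinatorially, semisimplicity forces, within a component, both neighbours
    of a residue s to occur between two successive occurrences of s.  Reading
    entries as box additions, i.e. as increments of beta-numbers, such sequences
    are exactly those that keep the beta-numbers of each component within a
    window of length p - 1: these are the content sequences of the p-standard
    tableaux of splittable shapes.  Tableaux of a fixed shape are connected by
    admissible swaps, hence D^lambda, defined by Young's orthogonal form, is
    simple; its weights determine lambda. *)

Require Import Defs.
From mathcomp Require Import all_boot all_order all_fingroup all_algebra.
From mathcomp Require Import all_solvable all_field all_character.
From mathcomp Require Import zify ring.

Set Implicit Arguments.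
Unset Strict Implicit.
Unset Printing Implicit Defensive.

Import GRing.Theory.

(** * Words in adjacent transpositions *)

Section Words.
Local Open Scope group_scope.
Variable n : nat.
Implicit Types (s : {perm 'I_n.+1}) (w : seq nat).

(** A step with beta = 0 is not invertible, so the intertwiners give no action of the symmetric
    group, and path independence cannot be read off from a group presentation. Words are therefore
    rewritten to normal form, cancelling equal letters only along runs that stay nonzero. The
    abstract statement serves three times: for permutations, for matrices satisfying the defining
    relations (where nothing vanishes and a representation results), and for intertwiners.

    Contents are seen only modulo p. Three consecutive entries of a weight must be distinct for the
    coefficients 1/(c_{i+1} - c_i) to make sense and for the braid relation to hold. For tableaux
    this comes from p-standardness and the shape condition; for modules it comes from
    diagonalizability of the xi_k, with r and 2 invertible. A swap that would destroy p-standardness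
    has content difference 1 or -1 (the value p - 1 is -1 in K), exactly where the off-diagonal
    coefficient of Young's form vanishes; hence the form stays within the span of the p-standard
    tableaux. *)

Definition adj (i : nat) : {perm 'I_n.+1} := tperm (inord i) (inord i.+1).

Definition perm_of_word w : {perm 'I_n.+1} := \prod_(i <- w) adj i.

Definition run (X : Type) (F : nat -> X -> X) x w := foldl (fun y i => F i y) x w.

Lemma run_cat X (F : nat -> X -> X) x w1 w2 :
  run F x (w1 ++ w2) = run F (run F x w1) w2.
Proof. exact: foldl_cat. Qed.

Lemma run_rcons X (F : nat -> X -> X) x w i :
  run F x (rcons w i) = F i (run F x w).
Proof. exact: foldl_rcons. Qed.

(* N reads "nonzero": a step F i may square to the identity or kill the state. *)
Record word_system (X : Type) (F : nat -> X -> X) (P N : X -> Prop) : Prop := {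
  ws_stable : forall i x, i < n -> P x -> P (F i x);
  ws_back : forall i x, i < n -> P x -> N (F i x) -> N x;
  ws_inv : forall i x, i < n -> P x -> N (F i (F i x)) -> F i (F i x) = x;
  ws_comm : forall i j x, i.+1 < j -> j < n -> P x -> F i (F j x) = F j (F i x);
  ws_braid : forall i x, i.+1 < n -> P x ->
    F i (F i.+1 (F i x)) = F i.+1 (F i (F i.+1 x)) }.

Lemma val_inord i : i <= n -> val (inord i : 'I_n.+1) = i.
Proof. exact: inordK. Qed.

Lemma adj_out i (x : 'I_n.+1) : i < n -> val x != i -> val x != i.+1 -> adj i x = x.
Proof.
move=> lt_in ne1 ne2; rewrite /adj tpermD // -val_eqE /= !inordK 1?eq_sym //; lia.
Qed.

Lemma adjL i (x : 'I_n.+1) : i < n -> val x = i -> val (adj i x) = i.+1.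
Proof.
move=> lt_in ex; rewrite /adj; have -> : x = inord i by apply/val_inj; rewrite /= inordK // ltnS ltnW.
by rewrite tpermL /= inordK.
Qed.

Lemma adjR i (x : 'I_n.+1) : i < n -> val x = i.+1 -> val (adj i x) = i.
Proof.
move=> lt_in ex; rewrite /adj; have -> : x = inord i.+1 by apply/val_inj; rewrite /= inordK.
by rewrite tpermR /= inordK // ltnS ltnW.
Qed.

Lemma adj_val i (x : 'I_n.+1) : i < n ->
  val (adj i x) = if val x == i then i.+1 else if val x == i.+1 then i else val x.
Proof.
move=> lt_in; case: eqP => [|/eqP] e1; first exact: adjL.
by case: eqP => [|/eqP] e2; [exact: adjR | rewrite adj_out].
Qed.

Lemma adjK i : adj i * adj i = 1.
Proof. exact: tperm2. Qed.

Lemma adjV i : (adj i)^-1 = adj i.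
Proof. exact: tpermV. Qed.

Lemma adjJ i (s : {perm 'I_n.+1}) : s^-1 * adj i * s = tperm (s (inord i)) (s (inord i.+1)).
Proof. by rewrite -mulgA -[_ * (_ * s)]/(adj i ^ s) tpermJ. Qed.

Lemma adjC i j : i.+1 < j -> j < n -> adj i * adj j = adj j * adj i.
Proof.
move=> lt_ij lt_jn; have := adjJ i (adj j); rewrite !adj_out ?val_inord //; try lia.
by rewrite -/(adj i) -mulgA => {2}<-; rewrite mulKVg.
Qed.

Lemma adj_braid i : i.+1 < n -> adj i * adj i.+1 * adj i = adj i.+1 * adj i * adj i.+1.
Proof.
move=> lt_in; have := adjJ i.+1 (adj i); have := adjJ i (adj i.+1); rewrite !adjV => -> ->.
rewrite (@adj_out i.+1 (inord i)) ?val_inord; try lia.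
rewrite (@adj_out i (inord i.+2)) ?val_inord; try lia.
by rewrite /adj tpermL tpermR.
Qed.

(** The model case: rewriting lemmas on runs, instantiated here, become identities between
    permutations. *)
Lemma word_system_perm : word_system (fun i s => s * adj i) (fun=> True) (fun=> True).
Proof.
split=> // [i s _ _ _|i j s lt_ij lt_jn _|i s lt_in _]; rewrite -!mulgA ?adjK ?mulg1 //.
  by rewrite -adjC.
by rewrite !mulgA -!(mulgA s) adj_braid.
Qed.

Lemma run_perm s w : run (fun i u => u * adj i) s w = s * perm_of_word w.
Proof.
elim/last_ind: w => [|w i IHw]; first by rewrite /perm_of_word big_nil mulg1.
by rewrite run_rcons IHw /perm_of_word -cats1 big_cat big_seq1 mulgA.
Qed.

(* The word [m-1; ...; j]; its permutation moves the point m to j. *)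
Fixpoint descent (m j : nat) : seq nat :=
  if m is m'.+1 then (if j < m then m' :: descent m' j else [::]) else [::].

Lemma descent_nil m j : m <= j -> descent m j = [::].
Proof. by case: m => //= m le_mj; rewrite ifF //; lia. Qed.

Lemma descentS m j : j <= m -> descent m.+1 j = m :: descent m j.
Proof. by move=> jm /=; rewrite ltnS jm. Qed.

Lemma descent_rcons m j : j < m -> descent m j = rcons (descent m j.+1) j.
Proof.
elim: m => // m IHm lt_jm; rewrite descentS //.
have [lt|ge] := ltnP j m; first by rewrite IHm // descentS.
have e : j = m by lia.
by rewrite e !descent_nil.
Qed.

Lemma descent_lt m j : all (gtn m) (descent m j).
Proof.
elim: m => //= m IHm; case: ifP => //= _; rewrite ltnSn.
by apply: sub_all IHm => i /=; lia.
Qed.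

(* Appending a letter to a normal form: either it passes to the left of the
   descent (as the letter [i'] of [descent_step j i]) or it changes j. *)
Definition descent_step j i : seq nat * nat :=
  if i.+1 < j then ([:: i], j) else if i.+1 == j then ([::], i)
  else if i == j then ([::], j.+1) else ([:: i.-1], j).

Section System.
Variables (X : Type) (F : nat -> X -> X) (P N : X -> Prop).
Hypothesis WS : word_system F P N.

Lemma run_stable x w : all (gtn n) w -> P x -> P (run F x w).
Proof.
elim: w x => //= i w IHw x /andP[lt_in wn] Px; apply: IHw => //.
exact: (ws_stable WS).
Qed.

Lemma run_back x w : all (gtn n) w -> P x -> N (run F x w) -> N x.
Proof.
elim: w x => //= i w IHw x /andP[lt_in wn] Px Nx.
by apply: (ws_back WS lt_in Px); apply: IHw Nx => //; apply: (ws_stable WS).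
Qed.

Lemma run_commr x w i : i < n -> all (gtn n) w -> P x -> all (fun k => i.+1 < k) w ->
  F i (run F x w) = run F (F i x) w.
Proof.
move=> lt_in; elim: w x => //= k w IHw x /andP[lt_kn wn] Px /andP[ik iw].
rewrite IHw //; last exact: (ws_stable WS).
by rewrite (ws_comm WS).
Qed.

Lemma run_comml x w i : i < n -> all (gtn n) w -> P x -> all (fun k => k.+1 < i) w ->
  F i (run F x w) = run F (F i x) w.
Proof.
move=> lt_in; elim: w x => //= k w IHw x /andP[lt_kn wn] Px /andP[ik iw].
rewrite IHw //; last exact: (ws_stable WS).
by rewrite -(ws_comm WS).
Qed.

Lemma descent_split m j k : j <= k <= m -> descent m j = descent m k ++ descent k j.
Proof.
elim: m => [|m IHm] /andP[jk km].
  by have [-> ->] : k = 0 /\ j = 0 by lia.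
have [e|ne] := eqVneq k m.+1; first by rewrite e (descent_nil (leqnn _)).
by rewrite !descentS ?IHm //=; lia.
Qed.

Lemma descent_ge m j : all (leq j) (descent m j).
Proof. by elim: m => //= k IH; case: ifP => //= lt; rewrite IH; lia. Qed.

Lemma run_descent_step m j i x : i < m -> j <= m -> m <= n -> P x ->
    N (F i (run F x (descent m j))) ->
  F i (run F x (descent m j)) =
  run F x ((descent_step j i).1 ++ descent m (descent_step j i).2).
Proof.
move=> im jm mn Px; rewrite /descent_step.
have all_n k l : k <= n -> all (gtn n) (descent k l).
  by move=> kn; apply: sub_all (descent_lt k l) => q /=; lia.
case: ifP => [ij|nij]; last case: eqP => [e|ne]; last case: eqP => [e|ne'] /=.
- move=> _; rewrite /= run_commr ?all_n //; first by lia.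
  by apply: sub_all (descent_ge m j) => q /=; lia.
- by move=> _; rewrite [in RHS]descent_rcons // run_rcons /= e.
- rewrite e descent_rcons -?e // run_rcons e => /(ws_inv WS) -> //; first by lia.
  by apply: run_stable => //; apply: all_n.
(* The descent contains i, i - 1: the letter i commutes past the tail, braids
   with these two, and leaves as i - 1. *)
have [k ek] : exists k, i = k.+1 by case: (i) ne' nij ne => [|k]; [lia | exists k].
subst i => _; have jk : j <= k by lia.
rewrite (@descent_split m j k.+2); last by lia.
rewrite (@descent_split k.+2 j k); last by lia.
rewrite (descentS (leqnSn k)) (descentS (leqnn k)) (descent_nil (leqnn k)) /=.
rewrite run_cat /=; set y := run F x (descent m k.+2).
have Py : P y by apply: run_stable => //; apply: all_n.
rewrite run_comml ?all_n //; try lia; first last.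
- by apply: sub_all (descent_lt k j) => q /=; lia.
- by apply: (ws_stable WS); [lia|]; apply: (ws_stable WS); [lia|].
rewrite -(ws_braid WS) //; last by lia.
rewrite /run /= -/(run F) foldl_cat /= -/(run F (F k x) (descent m k.+2)).
rewrite -run_commr // ?all_n //; try lia.
by apply: sub_all (descent_ge m k.+2) => q /=; lia.
Qed.

End System.

Lemma descent_lt_n m j : m <= n -> all (gtn n) (descent m j).
Proof. by move=> mn; apply: sub_all (descent_lt m j) => q /=; lia. Qed.

Lemma perm_of_word_rcons w i : perm_of_word (rcons w i) = perm_of_word w * adj i.
Proof. by rewrite /perm_of_word -cats1 big_cat big_seq1. Qed.

Lemma perm_of_word_cat w1 w2 : perm_of_word (w1 ++ w2) = perm_of_word w1 * perm_of_word w2.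
Proof. by rewrite /perm_of_word big_cat. Qed.

Lemma perm_of_word_seq1 i : perm_of_word [:: i] = adj i.
Proof. by rewrite /perm_of_word big_seq1. Qed.

Lemma perm_of_word_nil : perm_of_word [::] = 1.
Proof. by rewrite /perm_of_word big_nil. Qed.

Lemma descent_step_perm m j i : i < m -> j <= m -> m <= n ->
  perm_of_word (descent m j) * adj i =
  perm_of_word ((descent_step j i).1 ++ descent m (descent_step j i).2).
Proof.
move=> im jm mn.
have /= := @run_descent_step _ _ _ _ word_system_perm m j i 1 im jm mn I I.
by rewrite !run_perm !mul1g.
Qed.

Lemma descent_step_le m j i : i < m -> j <= m -> (descent_step j i).2 <= m.
Proof. by move=> im jm; rewrite /descent_step; do ![case: ifP => ? //=]; lia. Qed.

Lemma descent_step_lt m j i : i < m -> j <= m -> all (gtn m.-1) (descent_step j i).1.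
Proof. by move=> im jm; rewrite /descent_step; do ![case: ifP => ? //=]; lia. Qed.

Lemma perm_of_word_fix m w (x : 'I_n.+1) : m <= n -> all (gtn m) w -> m < x ->
  perm_of_word w x = x.
Proof.
move=> mn; elim/last_ind: w => [|w i IHw]; first by rewrite perm_of_word_nil perm1.
rewrite all_rcons => /andP[/= im wm] mx; rewrite perm_of_word_rcons permM IHw //.
by rewrite adj_out //=; lia.
Qed.

Lemma descent_perm m j : j <= m -> m <= n ->
  val (perm_of_word (descent m j) (inord m)) = j.
Proof.
elim: m => [|m IHm] jm mn; first by rewrite perm_of_word_nil perm1 val_inord //; lia.
have [e|ne] := eqVneq j m.+1.
  by rewrite e descent_nil // perm_of_word_nil perm1 val_inord.
rewrite descentS; last by lia.
rewrite -cat1s perm_of_word_cat perm_of_word_seq1 permM.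
have -> : adj m (inord m.+1) = inord m.
  by apply/val_inj; rewrite adjR ?val_inord //; lia.
by apply: IHm; lia.
Qed.

(** Coset normal form along the chain of symmetric groups: the last descent carries [m] to its image
    under [s], so the remaining factor fixes [m] and the recursion goes one level down. *)
Fixpoint nf m s : seq nat :=
  if m is m'.+1 then
    let d := descent m (s (inord m)) in nf m' (s * (perm_of_word d)^-1) ++ d
  else [::].

Arguments nf : simpl never.

Lemma nfS m s : nf m.+1 s =
  nf m (s * (perm_of_word (descent m.+1 (s (inord m.+1))))^-1)
    ++ descent m.+1 (s (inord m.+1)).
Proof. by []. Qed.

Lemma nf_lt m s : all (gtn m) (nf m s).
Proof.
elim: m s => // m IHm s; rewrite nfS all_cat; apply/andP; split.
  by apply: sub_all (IHm _) => q /=; lia.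
exact: descent_lt m.+1 _.
Qed.

Lemma nf_cat m w j : m < n -> j <= m.+1 -> all (gtn m) w ->
  nf m.+1 (perm_of_word (w ++ descent m.+1 j)) = nf m (perm_of_word w) ++ descent m.+1 j.
Proof.
move=> mn jm wm; set d := descent m.+1 j.
have ej : val (perm_of_word (w ++ d) (inord m.+1)) = j.
  rewrite perm_of_word_cat permM (@perm_of_word_fix m w) ?val_inord //; last exact: ltnW.
  exact: descent_perm.
by rewrite nfS; rewrite /= in ej; rewrite ej -/d perm_of_word_cat mulgK.
Qed.

Lemma perm_fix_le m s (x : 'I_n.+1) : (forall y : 'I_n.+1, m < y -> s y = y) ->
  x <= m -> s x <= m.
Proof.
move=> fix_s xm; rewrite leqNgt; apply/negP => lt.
by move/fix_s: (lt) => /perm_inj e; rewrite e ltnNge xm in lt.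
Qed.

Lemma nf_perm m s : m <= n -> (forall x : 'I_n.+1, m < x -> s x = x) ->
  perm_of_word (nf m s) = s.
Proof.
elim: m s => [|m IHm] s mn fix_s.
  rewrite /nf perm_of_word_nil; apply/permP => x; rewrite perm1.
  have [x0|/fix_s //] := posnP x; apply/val_inj.
  have := @perm_fix_le 0 s x fix_s; rewrite x0 => /(_ isT).
  by rewrite leqn0 /= => /eqP ->.
rewrite nfS; set j := (s (inord m.+1) : nat); set d := descent m.+1 j.
have jm : j <= m.+1 by apply: perm_fix_le; rewrite // inordK.
have dj : perm_of_word d (inord m.+1) = s (inord m.+1).
  by apply/val_inj; apply: descent_perm.
rewrite -/d perm_of_word_cat IHm ?mulgKV //; first exact: ltnW.
move=> x mx; rewrite permM; apply: (@perm_inj _ (perm_of_word d)); rewrite permKV.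
have [e|ne] := eqVneq (val x) m.+1.
  by have -> : x = inord m.+1 by [apply/val_inj; rewrite val_inord]; rewrite dj.
have mx' : m.+1 < x by rewrite ltn_neqAle eq_sym ne.
by rewrite fix_s // (@perm_of_word_fix m.+1) // /d; apply: (descent_lt m.+1).
Qed.

Lemma nf_perm_of_word m w : m <= n -> all (gtn m) w ->
  perm_of_word (nf m (perm_of_word w)) = perm_of_word w.
Proof. by move=> mn wm; apply: nf_perm => // x; apply: perm_of_word_fix. Qed.

Section NormalForm.
Variables (X : Type) (F : nat -> X -> X) (P N : X -> Prop).
Hypothesis WS : word_system F P N.

(** Outer induction on the bound for the letters, inner induction on the word. A new letter is
    pushed through the last descent; what emerges on the left has letters below [m] and is absorbed
    by the outer induction. Nonvanishing of a run passes to its prefixes by [run_back]. *)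
Lemma run_nf_gen m w x : m <= n -> all (gtn m) w -> P x -> N (run F x w) ->
  run F x w = run F x (nf m (perm_of_word w)).
Proof.
elim: m w x => [|m IHm] w x mn.
  by case: w.
elim/last_ind: w => [|w i IHw].
  move=> _ Px Nx; have := IHm [::] x (ltnW mn) isT Px Nx.
  have := @nf_cat m [::] m.+1 mn (leqnn _) isT.
  by rewrite (descent_nil (leqnn _)) !cats0 => ->.
rewrite all_rcons => /andP[/= im wm] Px; rewrite run_rcons => Nx.
have Nw : N (run F x w).
  apply: (ws_back WS) Nx; first by lia.
  by apply: (run_stable WS) => //; apply: sub_all wm => q /=; lia.
have ew := IHw wm Px Nw; rewrite ew perm_of_word_rcons.
have ep := nf_perm_of_word mn wm.
move: ew ep; rewrite nfS; set a := nf m _.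
set j := nat_of_ord (perm_of_word w (inord m.+1)) => ew ep.
have jm : j <= m.+1.
  rewrite leqNgt; apply/negP => lt_mj.
  have := @perm_of_word_fix m.+1 w (perm_of_word w (inord m.+1)) mn wm lt_mj.
  move/perm_inj => e; move: lt_mj; rewrite /j e /= inordK //; lia.
have am : all (gtn m) a by exact: nf_lt.
have an : all (gtn n) a by apply: sub_all am => q /=; lia.
rewrite -ep perm_of_word_cat -mulgA descent_step_perm //.
set b := (descent_step j i).1; set k := (descent_step j i).2.
have bm : all (gtn m) b by apply: (descent_step_lt im jm).
have km : k <= m.+1 by apply: descent_step_le.
have abm : all (gtn m) (a ++ b) by rewrite all_cat am.
have abn : all (gtn n) (a ++ b) by apply: sub_all abm => q /=; lia.
have Pa : P (run F x a) by apply: (run_stable WS).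
have eF : F i (run F x (a ++ descent m.+1 j)) = run F x ((a ++ b) ++ descent m.+1 k).
  rewrite run_cat (run_descent_step WS) // -?run_cat -?catA //.
  by rewrite -ew.
rewrite eF -perm_of_word_cat catA nf_cat //.
rewrite !(run_cat _ _ _ (descent _ _)) -IHm //.
  exact: ltnW.
apply: (run_back WS) (_ : N (run F _ (descent m.+1 k))).
- exact: descent_lt_n.
- exact: (run_stable WS).
- by rewrite -run_cat -eF -ew.
Qed.

Lemma run_nf w x : all (gtn n) w -> P x -> N (run F x w) ->
  run F x w = run F x (nf n (perm_of_word w)).
Proof. exact: run_nf_gen. Qed.

(** Path independence. The words need not be reduced, since equal letters cancel along nonzero
    runs. *)
Lemma run_perm_of_word w1 w2 x : all (gtn n) w1 -> all (gtn n) w2 -> P x ->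
    N (run F x w1) -> N (run F x w2) -> perm_of_word w1 = perm_of_word w2 ->
  run F x w1 = run F x w2.
Proof. by move=> w1n w2n Px N1 N2 e12; rewrite run_nf // e12 -run_nf. Qed.

End NormalForm.

Lemma nf1 m : m <= n -> nf m 1 = [::].
Proof.
elim: m => // m IHm mn.
by rewrite nfS perm1 inordK // descent_nil // perm_of_word_nil invg1 mulg1 IHm // ltnW.
Qed.

(** Serves to recognize a path whose permutation is [adj k] as the single step [k]. *)
Lemma nf_adj m k : k < m -> m <= n -> nf m (adj k) = [:: k].
Proof.
elim: m k => // m IHm k km mn.
have [e|ne] := eqVneq k m.
  have := @nf_cat m [::] m mn (leqnSn _) isT.
  by rewrite descentS // descent_nil // perm_of_word_seq1 perm_of_word_nil nf1 ?(ltnW mn) // e.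
have := @nf_cat m [:: k] m.+1 mn (leqnn _).
rewrite descent_nil // cats0 perm_of_word_seq1 IHm ?(ltnW mn) //=; last by lia.
by apply; lia.
Qed.
End Words.

(** * The wreath product and its Jucys-Murphy elements *)

Section WreathGenerators.
Local Open Scope group_scope.
Variables r n : nat.
Hypothesis r_gt0 : 0 < r.

Lemma perm_word_ex (s : {perm 'I_n.+1}) :
  exists2 w, all (gtn n) w & s = perm_of_word n w.
Proof.
exists (nf n s); first exact: nf_lt.
by rewrite nf_perm // => x; rewrite ltnNge -ltnS ltn_ord.
Qed.

Lemma wr_s1 : wr_s r (1 : {perm 'I_n.+1}) = 1.
Proof. by rewrite /wr_s morph1. Qed.

Lemma wr_base_prod (a : wr_base r n.+1) :
  sdpair1 (wr_groupAction r n.+1) a = \prod_(j < n.+1) wr_t r j ^+ a j.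
Proof.
rewrite (eq_bigr (fun j => sdpair1 (wr_groupAction r n.+1)
   [ffun i => if i == j then inZp (a j) else inZp 0])); last by move=> j _; rewrite wr_tX.
rewrite -(morph_prod (sdpair1_morphism (wr_groupAction r n.+1))) /=; last by move=> *; rewrite inE.
congr sdpair1; apply/ffunP => i.
pose F (j : 'I_n.+1) : wr_base r n.+1 := [ffun k => if k == j then inZp (a j) else inZp 0].
suff mF (s : seq 'I_n.+1) : uniq s ->
    (\prod_(j <- s) F j : wr_base r n.+1) i = if i \in s then a i else 1.
  by have := mF (index_enum _) (index_enum_uniq _); rewrite mem_index_enum => <-.
elim: s => [|j s IHs] /=; first by rewrite big_nil ffunE.
case/andP=> js us; rewrite big_cons ffunE IHs // ffunE in_cons eq_sym.
case: eqP => [<-|_] /=; last by case: ifP => _; rewrite -[RHS]mul1g; congr (_ * _);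
  apply/val_inj; rewrite /= mod0n.
by rewrite (negPf js) mulg1 valZpK.
Qed.

Lemma wreath_ind (Q : wreath r n.+1 -> Prop) :
    Q 1 -> (forall x y, Q x -> Q y -> Q (x * y)) ->
    (forall j, Q (wr_t r j)) -> (forall i, i < n -> Q (wr_s r (adj n i))) ->
  forall x, Q x.
Proof.
move=> Q1 QM Qt Qs x; rewrite [x]sdpairE; apply: (QM); last first.
  rewrite wr_base_prod; apply: (big_ind Q) => // j _.
  by elim: (nat_of_ord _) => // k IH; rewrite expgS; apply: (QM).
have [w wn ->] := perm_word_ex x.1; rewrite -/(wr_s r _).
elim/last_ind: w wn => [|w i IHw]; first by rewrite perm_of_word_nil wr_s1.
rewrite all_rcons => /andP[/= i_n wn]; rewrite perm_of_word_rcons wr_sM.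
by apply: QM; [apply: IHw | apply: Qs].
Qed.

Lemma wr_conj_t (j : 'I_n.+1) (s : {perm 'I_n.+1}) : wr_t r j ^ wr_s r s = wr_t r (s j).
Proof. by rewrite conjgE wr_t_s mulKg. Qed.

Lemma wr_sV (s : {perm 'I_n.+1}) : (wr_s r s)^-1 = wr_s r s^-1.
Proof. by rewrite /wr_s morphV ?inE. Qed.

Lemma wr_conj_s (s u : {perm 'I_n.+1}) : wr_s r s ^ wr_s r u = wr_s r (s ^ u).
Proof. by rewrite !conjgE wr_sV -!wr_sM. Qed.

End WreathGenerators.

(** * Representations of the wreath product from matrices for its generators *)

Section WreathRepr.
Variables (K : fieldType) (r n d : nat).
Variables (G : nat -> 'M[K]_d) (T : wr_base r n.+1 -> 'M[K]_d).
Local Open Scope ring_scope.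

Hypothesis G_inv : forall i, (i < n)%N -> G i *m G i = 1%:M.
Hypothesis G_comm : forall i j, (i.+1 < j)%N -> (j < n)%N -> G i *m G j = G j *m G i.
Hypothesis G_braid : forall i, (i.+1 < n)%N ->
  G i *m G i.+1 *m G i = G i.+1 *m G i *m G i.+1.
Hypothesis T1 : T 1%g = 1%:M.
Hypothesis TM : forall a b, T (a * b)%g = T a *m T b.
Hypothesis TG : forall a i, (i < n)%N ->
  T a *m G i = G i *m T (wr_act_fun a (adj n i)).

Let word_mx := run (fun i (A : 'M[K]_d) => A *m G i) 1%:M.

Lemma word_system_mx :
  word_system n (fun i (A : 'M[K]_d) => A *m G i) (fun=> True) (fun=> True).
Proof.
split=> // [i A i_n _ _|i j A ij jn _|i A i_n _].
- by rewrite -mulmxA G_inv // mulmx1.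
- by rewrite -!mulmxA -G_comm.
- by rewrite -!mulmxA !(mulmxA (G _)) G_braid.
Qed.

Definition perm_mx_of_gens (s : {perm 'I_n.+1}) : 'M[K]_d := word_mx (nf n s).

Lemma run_mul A w : run (fun i (B : 'M[K]_d) => B *m G i) A w = A *m word_mx w.
Proof.
elim/last_ind: w => [|w i IHw]; first by rewrite mulmx1.
by rewrite /word_mx !run_rcons IHw -mulmxA.
Qed.

Lemma perm_mx_of_gensE w : all (gtn n) w -> word_mx w = perm_mx_of_gens (perm_of_word n w).
Proof. by move=> wn; apply: (run_nf word_system_mx). Qed.

(** The matrix of a word depends only on its permutation, so multiplicativity is concatenation of
    words. *)
Lemma perm_mx_of_gensM s u :
  perm_mx_of_gens (s * u)%g = perm_mx_of_gens s *m perm_mx_of_gens u.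
Proof.
have [w wn ->] := perm_word_ex s; have [v vn ->] := perm_word_ex u.
rewrite -perm_of_word_cat -!perm_mx_of_gensE ?all_cat ?wn //.
by rewrite {1}/word_mx run_cat run_mul.
Qed.

Lemma perm_mx_of_gens_adj i : (i < n)%N -> perm_mx_of_gens (adj n i) = G i.
Proof.
move=> i_n; rewrite -perm_of_word_seq1 -perm_mx_of_gensE /= ?i_n //.
by rewrite /word_mx /= mul1mx.
Qed.

Lemma perm_mx_of_gens1 : perm_mx_of_gens 1%g = 1%:M.
Proof. by rewrite -(perm_of_word_nil n) -perm_mx_of_gensE. Qed.

Lemma wr_act_funM (a : wr_base r n.+1) s u :
  wr_act_fun a (s * u)%g = wr_act_fun (wr_act_fun a s) u.
Proof. by apply/ffunP => i; rewrite !ffunE invMg permM. Qed.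

Lemma wr_act_fun1 (a : wr_base r n.+1) : wr_act_fun a 1%g = a.
Proof. by apply/ffunP => i; rewrite !ffunE invg1 perm1. Qed.

Lemma base_perm_mx a s :
  T a *m perm_mx_of_gens s = perm_mx_of_gens s *m T (wr_act_fun a s).
Proof.
have [w wn ->] := perm_word_ex s; elim/last_ind: w wn => [|w i IHw].
  by rewrite perm_of_word_nil perm_mx_of_gens1 wr_act_fun1 mulmx1 mul1mx.
rewrite all_rcons => /andP[/= i_n wn].
rewrite perm_of_word_rcons perm_mx_of_gensM perm_mx_of_gens_adj //.
by rewrite mulmxA IHw // -mulmxA TG // wr_act_funM mulmxA.
Qed.

Definition wreath_mx (x : wreath r n.+1) : 'M[K]_d :=
  perm_mx_of_gens (pair_of_sd x).1 *m T (pair_of_sd x).2.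

Lemma wreath_mx_repr : mx_repr [set: wreath r n.+1] wreath_mx.
Proof.
split=> [|x y _ _]; first by rewrite /wreath_mx /= T1 perm_mx_of_gens1 mulmx1.
rewrite /wreath_mx; case: x => -[s a] ?; case: y => -[u b] ? /=.
rewrite perm_mx_of_gensM TM mulmxA -!mulmxA; congr (_ *m _).
by rewrite [in RHS]mulmxA base_perm_mx !mulmxA.
Qed.

Definition wreath_repr : wr_repr K r n.+1 d := MxRepresentation wreath_mx_repr.

Lemma wreath_reprE_s i : (i < n)%N -> wreath_repr (wr_s r (adj n i)) = G i.
Proof.
move=> i_n; rewrite /= /wreath_mx /wr_s /sdpair2 val_insubd !inE /=.
by rewrite T1 mulmx1 perm_mx_of_gens_adj.
Qed.

Lemma wreath_reprE_base a : wreath_repr (sdpair1 (wr_groupAction r n.+1) a) = T a.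
Proof.
by rewrite /= /wreath_mx /sdpair1 val_insubd !inE /= perm_mx_of_gens1 mul1mx.
Qed.

End WreathRepr.

(** * Commutation relations of the Jucys-Murphy elements *)

Section JM.
Local Open Scope ring_scope.
Variables (K : fieldType) (r n d : nat) (rG : wr_repr K r n.+1 d).
Hypothesis r_gt0 : (0 < r)%N.

Let t (j : 'I_n.+1) := wr_t r j.
Let o i : 'I_n.+1 := inord i.
Let G i := rG (wr_s r (adj n i)).

Lemma wr_reprM x y : rG (x * y)%g = rG x *m rG y.
Proof. by rewrite repr_mxM ?inE. Qed.

(** On a simultaneous eigenvector of the t_j this acts as r if the components at [l] and [k] agree,
    and as 0 otherwise; see [wt_pair]. *)
Definition jm_pair (l k : 'I_n.+1) := \sum_(s < r) rG (wr_t r l ^+ s * wr_t r k ^- s)%g.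
Definition jm_term (l k : 'I_n.+1) := jm_pair l k *m rG (wr_g r l k).

Lemma jucys_murphyE k : jucys_murphy rG k = \sum_(l < n.+1 | (l < k)%N) jm_term l k.
Proof.
apply: eq_bigr => l _; rewrite /jm_term /jm_pair mulmx_suml.
by apply: eq_bigr => s _; rewrite -wr_reprM.
Qed.

Lemma adj_sq_mx i : G i *m G i = 1%:M.
Proof. by rewrite /G -wr_reprM -wr_sM adjK wr_s1 // repr_mx1. Qed.

Lemma adj_commx i j : (i.+1 < j)%N -> (j < n)%N -> G i *m G j = G j *m G i.
Proof. by move=> ij jn; rewrite /G -!wr_reprM -!wr_sM adjC. Qed.

Lemma adj_braid_mx i : (i.+1 < n)%N -> G i *m G i.+1 *m G i = G i.+1 *m G i *m G i.+1.
Proof. by move=> ij; rewrite /G -!wr_reprM -!wr_sM adj_braid. Qed.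

Lemma t_perm_mx j s : rG (t j) *m rG (wr_s r s) = rG (wr_s r s) *m rG (t (s j)).
Proof. by rewrite -!wr_reprM wr_t_s. Qed.

(** The summand is periodic in its exponent with period r, so the sum absorbs the factor t_l
    t_k^{-1}. This is what makes each t_j commute with each xi_k. *)
Lemma jm_pair_shift l k :
  \sum_(s < r) rG ((wr_t r l * (wr_t r k)^-1) ^+ s.+1)%g = jm_pair l k.
Proof.
have cm : commute (wr_t r l) (wr_t r k)^-1 by apply/commuteV/wr_tC.
have -> : jm_pair l k = \sum_(s < r) rG ((wr_t r l * (wr_t r k)^-1) ^+ s)%g.
  by apply: eq_bigr => s _; rewrite (expgMn _ cm) expgVn.
case: (r) r_gt0 cm (rG) => // r' _ cm rG'; rewrite big_ord_recr big_ord_recl /= addrC.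
by rewrite (expgMn _ cm) expgVn !wr_t_expg // invg1 mulg1 expg0.
Qed.

Lemma jm_pair_tC j l k : jm_pair l k *m rG (t j) = rG (t j) *m jm_pair l k.
Proof.
rewrite mulmx_suml mulmx_sumr; apply: eq_bigr => s _; rewrite -!wr_reprM; congr (rG _).
apply: commute_sym; apply: commuteM; first by apply: commuteX; apply: wr_tC.
by apply: commuteV; apply: commuteX; apply: wr_tC.
Qed.

Lemma jm_pair_t l k : jm_pair l k *m rG (t l) = jm_pair l k *m rG (t k).
Proof.
rewrite -[in RHS]jm_pair_shift !mulmx_suml; apply: eq_bigr => s _.
have cm : commute (wr_t r l) (wr_t r k)^-1 by apply/commuteV/wr_tC.
rewrite -!wr_reprM; congr (rG _).
rewrite expgSr (expgMn _ cm) expgVn -!mulgA; congr (_ * (_ * _))%g.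
by rewrite /t mulVg mulg1.
Qed.

Lemma jm_term_tC j l k : rG (t j) *m jm_term l k = jm_term l k *m rG (t j).
Proof.
have gt i : rG (wr_g r l k) *m rG (t i) = rG (t (tperm l k i)) *m rG (wr_g r l k).
  by rewrite -!wr_reprM wr_g_t.
rewrite /jm_term -mulmxA gt !mulmxA -jm_pair_tC; congr (_ *m _).
have [->|jl] := eqVneq j l; first by rewrite tpermL jm_pair_t.
have [->|jk] := eqVneq j k; first by rewrite tpermR jm_pair_t.
by rewrite tpermD // eq_sym.
Qed.

Lemma jm_tC j k : rG (t j) *m jucys_murphy rG k = jucys_murphy rG k *m rG (t j).
Proof.
rewrite jucys_murphyE mulmx_sumr mulmx_suml; apply: eq_bigr => l _; exact: jm_term_tC.
Qed.

Lemma jm_pairJ l k s :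
  jm_pair l k *m rG (wr_s r s) = rG (wr_s r s) *m jm_pair (s l) (s k).
Proof.
rewrite mulmx_suml mulmx_sumr; apply: eq_bigr => i _; rewrite -!wr_reprM; congr (rG _).
by rewrite conjgC conjMg conjVg !conjXg !wr_conj_t.
Qed.

Lemma jm_termJ l k s :
  jm_term l k *m rG (wr_s r s) = rG (wr_s r s) *m jm_term (s l) (s k).
Proof.
rewrite /jm_term -mulmxA -wr_reprM conjgC /wr_g wr_conj_s tpermJ.
by rewrite wr_reprM !mulmxA jm_pairJ.
Qed.

Lemma jm_permC k (s : {perm 'I_n.+1}) : s k = k -> (forall l, (s l < k) = (l < k))%N ->
  jucys_murphy rG k *m rG (wr_s r s) = rG (wr_s r s) *m jucys_murphy rG k.
Proof.
move=> sk lt_s; rewrite jucys_murphyE mulmx_suml mulmx_sumr.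
rewrite [RHS](reindex_inj (@perm_inj _ s)) /=; apply: eq_big => [l|l _]; first by rewrite lt_s.
by rewrite jm_termJ sk.
Qed.

Lemma jm_adjC k i : (i < n)%N -> k != o i -> k != o i.+1 ->
  jucys_murphy rG k *m G i = G i *m jucys_murphy rG k.
Proof.
move=> i_n ki ki1; have vi : val (o i) = i by rewrite val_inord // ltnW.
have vi1 : val (o i.+1) = i.+1 by rewrite val_inord.
have {ki} ki : val k != i by rewrite -vi.
have {ki1} ki1 : val k != i.+1 by rewrite -vi1.
apply: jm_permC => [|l]; first by rewrite adj_out.
have /= -> := adj_val l i_n; move: ki ki1 => /= ki ki1.
by case: eqP => [->|_]; [lia | case: eqP => [->|//]; lia].
Qed.

(** For k < k' every factor of xi_k commutes with xi_k': the t_j do, and the transposition (l, k)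
    fixes k' and permutes the indices below it. *)
Lemma jm_jmC k k' : jucys_murphy rG k *m jucys_murphy rG k' =
  jucys_murphy rG k' *m jucys_murphy rG k.
Proof.
wlog lt : k k' / (k < k')%N.
  move=> W; have [|lt|e] := ltngtP k k'; first exact: W.
    by rewrite (W k').
  by have -> : k = k' by apply/val_inj.
rewrite [jucys_murphy rG k]jucys_murphyE mulmx_suml [RHS]mulmx_sumr; apply: eq_bigr => l lk.
rewrite /jm_term mulmxA -[in LHS]mulmxA /wr_g -jm_permC.
- rewrite !mulmxA; congr (_ *m _); rewrite mulmx_suml [RHS]mulmx_sumr; apply: eq_bigr => s _.
  have tX j m : rG (wr_t r j ^+ m)%g *m jucys_murphy rG k' = jucys_murphy rG k' *m rG (wr_t r j ^+ m)%g.
    elim: m => [|m IHm]; first by rewrite expg0 repr_mx1 mul1mx mulmx1.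
    by rewrite expgS wr_reprM -mulmxA IHm !mulmxA jm_tC.
  have tV : rG (wr_t r k ^- s)%g = rG (wr_t r k ^+ (r - s))%g.
    congr (rG _); apply/eqP; rewrite eq_invg_mul -expgD subnKC ?wr_t_expg //.
    exact: ltnW.
  by rewrite wr_reprM tV -mulmxA tX !mulmxA tX.
- by rewrite tpermD //; apply/eqP => e; move: lt lk; rewrite e; lia.
- move=> q; case: tpermP => [->|->|//]; move: lk lt => /=; lia.
Qed.

(** The relation of the degenerate affine Hecke algebra. Conjugation by g_i turns the summands of
    xi_{i+1} with l < i into those of xi_i; the summand l = i contains g_i itself, which cancels and
    leaves [jm_pair]. *)
Lemma jm_adjr i : (i < n)%N -> G i *m jucys_murphy rG (o i.+1) =
  jucys_murphy rG (o i) *m G i + jm_pair (o i.+1) (o i).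
Proof.
move=> i_n; have vi : val (o i) = i by rewrite val_inord // ltnW.
have vi1 : val (o i.+1) = i.+1 by rewrite val_inord.
rewrite [jucys_murphy _ (o i.+1)]jucys_murphyE (bigD1 (o i)) /=; last first.
  by rewrite /= in vi vi1; rewrite vi vi1.
rewrite mulmxDr addrC; congr (_ + _).
  rewrite jucys_murphyE mulmx_suml mulmx_sumr; apply: eq_big => [l|l lt].
    rewrite -val_eqE /=; rewrite /= in vi vi1; rewrite vi vi1; lia.
  have [lt1 ne] := andP lt; rewrite jm_termJ.
  rewrite [adj n i l]adj_out //; try by rewrite /= in vi vi1; rewrite -val_eqE /= in ne;
    rewrite vi1 vi in lt1 ne * => /=; lia.
  by rewrite /adj tpermL.
have := jm_termJ (o i.+1) (o i) (adj n i).
rewrite {3 4}/adj tpermR tpermL => <-; rewrite /jm_term -mulmxA.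
by rewrite /wr_g tpermC -/(adj n i) adj_sq_mx mulmx1.
Qed.

Lemma jm_adjl i : (i < n)%N -> G i *m jucys_murphy rG (o i) =
  jucys_murphy rG (o i.+1) *m G i - jm_pair (o i) (o i.+1).
Proof.
move=> i_n; apply/eqP; rewrite eq_sym subr_eq eq_sym; apply/eqP.
rewrite -[jucys_murphy rG (o i.+1)]mul1mx -(adj_sq_mx i) -[_ *m _ *m jucys_murphy rG _]mulmxA.
rewrite jm_adjr // mulmxDr mulmxDl -!mulmxA adj_sq_mx mulmx1; congr (_ + _).
rewrite jm_pairJ mulmxA adj_sq_mx mul1mx /adj.
by rewrite tpermR tpermL.
Qed.

Lemma jm_ord0 : jucys_murphy rG ord0 = 0.
Proof. by rewrite /jucys_murphy big_pred0. Qed.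

End JM.

(** * p-standard tableaux of splittable shapes *)

Section Shapes.
Variable p : nat.
Implicit Types la : seq nat.

Lemma partition_mono la i j : is_partition la -> i <= j -> nth 0 la j <= nth 0 la i.
Proof.
case/andP => so _ ij; have [jl|jl] := ltnP j (size la); last by rewrite nth_default.
apply: (sorted_leq_nth _ _ 0 so) => //; rewrite ?inE //; last exact: leq_ltn_trans jl.
- by move=> x y z /= xy yz; apply: leq_trans xy.
- by move=> x /=.
Qed.

Lemma partition_pos la i : is_partition la -> (0 < nth 0 la i) = (i < size la).
Proof.
case/andP => _ /allP po; case: (ltnP i) => il; last by rewrite nth_default.
by apply/po/mem_nth.
Qed.

Lemma splittable_partition la : splittable_shape p la -> is_partition la.
Proof. by case/orP => [/eqP ->|/and3P[]]. Qed.

(** With p or more rows, [chi la <= p] leaves only a rectangle of exactly p equal rows, which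
    p-regularity forbids. *)
Lemma splittable_size la : 0 < p -> splittable_shape p la -> size la < p.
Proof.
move=> p0 /orP[/eqP -> //|/and3P[pa re ch]]; rewrite ltnNge; apply/negP => ps.
have hd : head 0 la = nth 0 la 0 by case: (la).
have ls : last 0 la = nth 0 la (size la).-1 by rewrite nth_last.
have le := partition_mono pa (leq0n (size la).-1).
move: ch; rewrite /chi hd ls => ch.
have e : nth 0 la 0 = nth 0 la (size la).-1 by lia.
have sp : size la = p by lia.
have /allP/(_ (nth 0 la 0)) := re; rewrite mem_nth ?sp // => /(_ isT).
suff -> : count_mem (nth 0 la 0) la = p by rewrite ltnn.
rewrite -[RHS]sp; apply/eqP; rewrite -all_count; apply/(all_nthP 0) => i il /=.
have h1 := partition_mono pa (leq0n i); have h2 : nth 0 la (size la).-1 <= nth 0 la i.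
  by apply: partition_mono; lia.
by apply/eqP; lia.
Qed.

(* The beta-numbers la_i - i of a splittable shape lie in a window of length
   p - 1, hence are distinct modulo p. *)
Lemma splittable_range la i j : splittable_shape p la -> i <= j -> j < size la ->
  nth 0 la i + j < nth 0 la j + i + p.
Proof.
case/orP => [/eqP -> //|/and3P[pa _ ch]] ij jl.
have hd : head 0 la = nth 0 la 0 by case: (la).
have ls : last 0 la = nth 0 la (size la).-1 by rewrite nth_last.
have h1 := partition_mono pa (leq0n i).
have h2 : nth 0 la (size la).-1 <= nth 0 la j by apply: partition_mono; lia.
move: ch; rewrite /chi hd ls; lia.
Qed.

End Shapes.

Lemma nth_le_sumn la i : nth 0 la i <= sumn la.
Proof.
elim: la i => [|x la IH] [|i] //=; first exact: leq_addr.
exact: leq_trans (IH i) (leq_addl _ _).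
Qed.

Lemma size_le_sumn la : all (fun m => 0 < m) la -> size la <= sumn la.
Proof. by elim: la => //= x la IH /andP[x0 /IH]; lia. Qed.

Section OneShape.
Variables (p r n : nat) (l : r.-tuple (seq nat)).
Hypothesis l_spl : r_splittable_shape p n l.

Lemma r_splittable_comp k : splittable_shape p (tnth l k).
Proof. by have /andP[/forallP] := l_spl. Qed.

Lemma r_splittable_sum : \sum_(k < r) sumn (tnth l k) = n.
Proof. by have /andP[_ /eqP] := l_spl. Qed.

Lemma shape_box_lt k i j : j < nth 0 (tnth l k) i -> (i < n) && (j < n).
Proof.
move=> ji; have pa := splittable_partition (r_splittable_comp k).
have sn : sumn (tnth l k) <= n by rewrite -r_splittable_sum (bigD1 k) //= leq_addr.
have := nth_le_sumn (tnth l k) i; have /andP[_ /size_le_sumn] := pa.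
have : i < size (tnth l k) by rewrite -(partition_pos _ pa); lia.
lia.
Qed.

End OneShape.

Lemma nat_eq_pchar (K : nzRingType) p (m q : nat) : (p \in [pchar K])%R ->
  (m%:R = q%:R :> K)%R -> exists k, m = q + k * p \/ q = m + k * p.
Proof.
move=> hp; wlog le : m q / q <= m => [W e|].
  case/orP: (leq_total q m) => [le|le]; first exact: W.
  by have [k [|] h] := W q m le (esym e); exists k; [right|left].
move=> e; exists ((m - q) %/ p); left; rewrite divnK ?subnKC //.
by rewrite (dvdn_pcharf hp) natrB // e subrr.
Qed.

Lemma ord_lt n (x y : 'I_n) : x <= y -> x != y -> x < y.
Proof. by rewrite ltn_neqAle => -> ->. Qed.

Section Tableaux.
Variables (K : fieldType) (p r n : nat).
Hypothesis pK : (p \in [pchar K])%R.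
Hypothesis p_gt2 : 2 < p.
Implicit Types (l m : r.-tuple (seq nat)) (t u : filling r n).

Local Notation T l := (p_standard_tableaux n p l).

Section OneShape.
Variable l : r.-tuple (seq nat).
Hypothesis l_spl : r_splittable_shape p n l.

Section OneTableau.
Variable t : filling r n.
Hypothesis tT : t \in T l.

Lemma tab_inj : injective t.
Proof. by move: tT; rewrite inE => /and3P[/andP[/injectiveP]]. Qed.

Lemma tab_box a : box_col t a < nth 0 (tnth l (box_comp t a)) (box_row t a).
Proof.
move: tT; rewrite inE => /and3P[/andP[_ /eqP/setP/(_ (t a))]].
by rewrite imset_f // inE => /esym.
Qed.

Lemma tab_ex k i j : j < nth 0 (tnth l k) i ->
  exists a, [/\ box_comp t a = k, box_row t a = i & box_col t a = j].
Proof.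
move=> ji; have /andP[i_n j_n] := shape_box_lt l_spl ji.
move: tT; rewrite inE => /and3P[/andP[_ /eqP/setP/(_ (Ordinal i_n, Ordinal j_n, k))]].
rewrite [in X in _ = X]inE /= ji => /imsetP[a _ e] _ _; exists a.
by rewrite /box_comp /box_row /box_col -e.
Qed.

Lemma tab_row a : box_row t a < size (tnth l (box_comp t a)).
Proof.
rewrite -(partition_pos _ (splittable_partition (r_splittable_comp l_spl _))).
exact: leq_ltn_trans (tab_box a).
Qed.

Lemma tab_row_lt a : (box_row t a).+1 < p.
Proof.
apply: leq_ltn_trans (tab_row a) (splittable_size _ (r_splittable_comp l_spl _)); lia.
Qed.

Lemma std_row a b : box_comp t a = box_comp t b -> box_row t a = box_row t b ->
  box_col t a < box_col t b -> a < b.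
Proof.
move: tT; rewrite inE => /and3P[_ /forallP/(_ a)/forallP/(_ b) + _] e1 e2 lt.
by rewrite e1 e2 !eqxx lt => /andP[].
Qed.

Lemma std_col a b : box_comp t a = box_comp t b -> box_col t a = box_col t b ->
  box_row t a < box_row t b -> a < b.
Proof.
move: tT; rewrite inE => /and3P[_ /forallP/(_ a)/forallP/(_ b) + _] e1 e2 lt.
by rewrite e1 e2 !eqxx lt => /andP[].
Qed.

Lemma std_p a b : box_comp t a = box_comp t b -> box_row t b < box_row t a ->
  box_col t a < box_col t b ->
  box_row t a - box_row t b + (box_col t b - box_col t a) + 1 = p -> a < b.
Proof.
move: tT; rewrite inE => /and3P[_ _ /forallP/(_ a)/forallP/(_ b)] + e1 lt1 lt2 e2.
by rewrite e1 e2 !eqxx lt1 lt2.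
Qed.

Lemma box_eq a b : box_comp t a = box_comp t b -> box_row t a = box_row t b ->
  box_col t a = box_col t b -> a = b.
Proof.
move=> e1 e2 e3; apply: tab_inj.
rewrite [t a]surjective_pairing [(t a).1]surjective_pairing.
rewrite [t b]surjective_pairing [(t b).1]surjective_pairing.
by congr (_, _, _) => //; apply/val_inj.
Qed.

Lemma tab_sub a i j : i <= box_row t a -> j <= box_col t a ->
  exists b, [/\ box_comp t b = box_comp t a, box_row t b = i & box_col t b = j].
Proof.
move=> ia ja; apply: tab_ex; apply: leq_ltn_trans ja _; apply: leq_trans (tab_box a) _.
exact: partition_mono (splittable_partition (r_splittable_comp l_spl _)) ia.
Qed.

Lemma tab_le a b : box_comp t a = box_comp t b -> box_row t a <= box_row t b ->
  box_col t a <= box_col t b -> a <= b.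
Proof.
(* [d] is the box in the row of [a] and the column of [b]. *)
move=> e r_ab c_ab; have [d [d1 d2 d3]] := @tab_sub b _ _ r_ab (leqnn _).
apply: (@leq_trans d).
  move: c_ab; rewrite leq_eqVlt => /orP[/eqP e3|lt].
    by rewrite (@box_eq a d) // ?d1 ?d2 ?d3.
  by apply/ltnW/std_row; rewrite ?d1 ?d2 ?d3.
move: r_ab; rewrite leq_eqVlt => /orP[/eqP e2|lt].
  by rewrite (@box_eq d b) // d2.
by apply/ltnW/std_col; rewrite ?d1 ?d2 ?d3.
Qed.

(* Moving west from b in its row reduces to a content difference of exactly
   p - 1, the case that p-standardness controls. *)
Lemma tab_far a b : box_comp t a = box_comp t b ->
  box_col t a + box_row t b + p <= box_col t b + box_row t a + 1 -> a < b.
Proof.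
move=> e h; have ra := tab_row_lt a.
have [le|lt] := leqP (box_row t a) (box_row t b).
  have : a <= b by apply: tab_le => //; lia.
  rewrite leq_eqVlt => /orP[/eqP/val_inj ab|//]; move: h; rewrite ab; lia.
pose j := box_col t a + p.-1 - (box_row t a - box_row t b).
have [d [d1 d2 d3]] := @tab_sub b (box_row t b) j (leqnn _) ltac:(rewrite /j; lia).
apply: (@leq_trans d).
  by apply: std_p; rewrite ?d1 ?d2 ?d3 //= /j; lia.
by apply: tab_le; rewrite ?d1 ?d2 ?d3 // /j; lia.
Qed.

Lemma content_eq a b : content K t a = content K t b ->
  exists k, box_col t a + box_row t b = box_col t b + box_row t a + k * p \/
            box_col t b + box_row t a = box_col t a + box_row t b + k * p.
Proof.
move=> e; apply: (nat_eq_pchar pK); rewrite !natrD; apply/eqP.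
rewrite -subr_eq0; apply/eqP; rewrite -(subrr (content K t a)) {2}e /content; ring.
Qed.

(** Two entries lie strictly between. On a common diagonal they are the east and south neighbours of
    [a]. Otherwise the integer contents differ by a positive multiple of p, [tab_far] makes that of
    [b] the larger one, and the two entries are the east neighbour of [a] and the west neighbour of
    [b]. *)
Lemma tab_same_content (a b : 'I_n) : a < b -> box_comp t a = box_comp t b ->
  content K t a = content K t b -> a.+3 <= b.
Proof.
move=> ab e /content_eq[k h].
have between (x y : 'I_n) : a < x < b -> a < y < b -> x != y -> a.+3 <= b.
  by rewrite -val_eqE /=; lia.
have ra := tab_row_lt a.
have [k0|k0] := posnP k.
  have {k k0} h : box_col t a + box_row t b = box_col t b + box_row t a by lia.
  have rab : box_row t a < box_row t b.
    rewrite ltnNge; apply/negP => le; have := @tab_le b a (esym e) le; lia.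
  have [x [x1 x2 x3]] := @tab_sub b (box_row t a) (box_col t a).+1 ltac:(lia) ltac:(lia).
  have [y [y1 y2 y3]] := @tab_sub b (box_row t a).+1 (box_col t a) ltac:(lia) ltac:(lia).
  apply: (@between x y).
  - apply/andP; split; apply: ord_lt.
    + by apply: tab_le; rewrite ?x1 ?x2 ?x3.
    + by apply/eqP => ea; move: x3; rewrite -ea; lia.
    + by apply: tab_le; rewrite ?x1 ?x2 ?x3 //; lia.
    + by apply/eqP => eb; move: x2; rewrite eb; lia.
  - apply/andP; split; apply: ord_lt.
    + by apply: tab_le; rewrite ?y1 ?y2 ?y3.
    + by apply/eqP => ea; move: y2; rewrite -ea; lia.
    + by apply: tab_le; rewrite ?y1 ?y2 ?y3 //; lia.
    + by apply/eqP => eb; move: y3; rewrite eb; lia.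
  - by apply/eqP => exy; move: x2; rewrite exy y2; lia.
have kp : p <= k * p by rewrite leq_pmull.
case: h => h.
  have := @tab_far b a (esym e); lia.
have [w [w1 w2 w3]] := @tab_sub b (box_row t b) (box_col t b).-1 ltac:(lia) ltac:(lia).
have aw : a < w by apply: tab_far; rewrite ?w1 ?w2 ?w3 //; lia.
have wb : w < b by apply: std_row; rewrite ?w1 ?w2 ?w3 //; lia.
(* If [a] ended its row, the box of [b] would violate either the bound on beta-numbers or the
   monotonicity of the row lengths. *)
have [x [x1 x2 x3]] : exists x, [/\ box_comp t x = box_comp t a,
    box_row t x = box_row t a & box_col t x = (box_col t a).+1].
  apply: tab_ex; rewrite ltnNge; apply/negP => le.
  have bb := tab_box b; rewrite -e in bb.
  have spl := r_splittable_comp l_spl (box_comp t a).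
  have [lt|ge] := ltnP (box_row t b) (box_row t a).
    have := splittable_range spl (ltnW lt) (tab_row a); lia.
  have := partition_mono (splittable_partition spl) ge; lia.
apply: (@between x w).
- apply/andP; split; first by apply: std_row; rewrite ?x1 ?x2 ?x3.
  by apply: tab_far; rewrite ?x1 ?x2 ?x3 //; lia.
- by rewrite aw.
- by apply/eqP => exw; move: w2 w3; rewrite -exw x2 x3 => w2; nia.
Qed.

(** Only the relative order of the pair (i, i+1) changes. Consecutive entries in one row or column
    occupy neighbouring boxes, with content difference 1 or -1; the p-standard condition constrains
    them only at content difference p - 1, which is -1 in K. *)
Lemma tab_swap (i i1 : 'I_n) : i1 = i.+1 :> nat ->
    (box_comp t i = box_comp t i1 ->
      (content K t i1 - content K t i != 1)%R /\ (content K t i1 - content K t i != - 1)%R) ->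
  swap_entries i i1 t \in T l.
Proof.
move=> ei adm; set t' := swap_entries i i1 t.
have et a : t' a = t (tperm i i1 a) by rewrite ffunE.
have ord a b : (tperm i i1 a < tperm i i1 b)%N -> (tperm i i1 a, tperm i i1 b) != (i, i1) -> a < b.
  rewrite xpair_eqE -!val_eqE /=.
  case: tpermP => [->|->|/eqP a1 /eqP a2]; case: tpermP => [->|->|/eqP b1 /eqP b2];
    try (move: a1 a2; rewrite -!val_eqE /= => a1 a2);
    try (move: b1 b2; rewrite -!val_eqE /= => b1 b2); lia.
have no_mid x : i < x -> x < i1 -> False by lia.
rewrite inE; apply/and3P; split.
- apply/andP; split.
    by apply/injectiveP => a b; rewrite !et => /tab_inj/perm_inj.
  move: (tT); rewrite inE => /and3P[/andP[_ /eqP <-] _ _].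
  apply/eqP/setP => x; apply/imsetP/imsetP => -[a _ ->].
    by exists (tperm i i1 a); rewrite ?et.
  by exists (tperm i i1 a); rewrite ?et ?tpermK.
- apply/forallP => a; apply/forallP => b; apply/implyP => /eqP ec.
  have ec' : box_comp t (tperm i i1 a) = box_comp t (tperm i i1 b).
    by move: ec; rewrite /box_comp !et.
  have eR x : box_row t' x = box_row t (tperm i i1 x) by rewrite /box_row et.
  have eC x : box_col t' x = box_col t (tperm i i1 x) by rewrite /box_col et.
  rewrite !eR !eC; apply/andP; split; apply/implyP => /andP[/eqP e lt].
    apply: ord; first exact: std_row.
    apply/eqP => -[ea eb]; move: ec' e lt; rewrite ea eb => ec' e lt.
    have [n1 _] := adm ec'.
    have [q|q] := eqVneq (box_col t i1) (box_col t i).+1.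
      by move/eqP: n1; apply; rewrite /content q -e -natr1; ring.
    have [x [x1 x2 x3]] := @tab_sub i1 (box_row t i) (box_col t i).+1 ltac:(lia) ltac:(lia).
    apply: (no_mid x); apply: std_row; rewrite ?x1 ?x2 ?x3 //; lia.
  apply: ord; first exact: std_col.
  apply/eqP => -[ea eb]; move: ec' e lt; rewrite ea eb => ec' e lt.
  have [_ n1] := adm ec'.
  have [q|q] := eqVneq (box_row t i1) (box_row t i).+1.
    by move/eqP: n1; apply; rewrite /content q -e -natr1; ring.
  have [x [x1 x2 x3]] := @tab_sub i1 (box_row t i).+1 (box_col t i) ltac:(lia) ltac:(lia).
  apply: (no_mid x); apply: std_col; rewrite ?x1 ?x2 ?x3 //; lia.
- apply/forallP => a; apply/forallP => b; apply/implyP => /and4P[/eqP ec lt1 lt2 /eqP ep].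
  have ec' : box_comp t (tperm i i1 a) = box_comp t (tperm i i1 b).
    by move: ec; rewrite /box_comp !et.
  have eR x : box_row t' x = box_row t (tperm i i1 x) by rewrite /box_row et.
  have eC x : box_col t' x = box_col t (tperm i i1 x) by rewrite /box_col et.
  rewrite !eR !eC in lt1 lt2 ep; apply: ord; first exact: std_p.
  apply/eqP => -[ea eb]; move: ec' ep lt1 lt2; rewrite ea eb => ec' ep lt1 lt2.
  have [_ /eqP] := adm ec'; apply; rewrite /content.
  have p0 := pcharf0 pK; rewrite -ep !natrD !natrB ?(ltnW lt1) ?(ltnW lt2) // in p0.
  by apply/eqP; rewrite -subr_eq0 -p0; apply/eqP; ring.
Qed.

Lemma tab_first (a : 'I_n) : a = 0 :> nat -> box_row t a = 0 /\ box_col t a = 0.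
Proof.
move=> a0; have [x [x1 x2 x3]] := @tab_sub a 0 0 isT isT.
have : x <= a by apply: tab_le; rewrite ?x1 ?x2 ?x3.
by rewrite a0 leqn0 => /eqP x0; have <- : x = a by apply/val_inj; rewrite /= x0 a0.
Qed.

(** Depends on the two boxes only, yet forces the order of their entries in every p-standard tableau
    of the shape when they share a component. *)
Definition box_prec (a b : 'I_n) :=
  (box_row t a <= box_row t b) && (box_col t a <= box_col t b)
  || (box_col t a + box_row t b + p <= box_col t b + box_row t a + 1).

Lemma box_prec_le a b : box_comp t a = box_comp t b -> box_prec a b -> a <= b.
Proof.
by move=> e /orP[/andP[]|] h; [apply: tab_le | apply/ltnW/tab_far].
Qed.

(** Either the integer contents differ by 1, and the boxes are comparable coordinatewise, or they
    are at least p - 1 apart, in the range of [tab_far]. *)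
Lemma box_prec_near a b : (content K t b = content K t a + 1)%R ->
  box_prec a b || box_prec b a.
Proof.
move=> e; have [k h] : exists k,
    (box_col t a + box_row t b).+1 = box_col t b + box_row t a + k * p \/
    box_col t b + box_row t a = (box_col t a + box_row t b).+1 + k * p.
  apply: (nat_eq_pchar pK); rewrite -natr1 !natrD; apply/eqP.
  rewrite -subr_eq0; apply/eqP; rewrite -(subrr (content K t b)) {1}e /content; ring.
rewrite /box_prec; have [k0|k0] := posnP k; first by nia.
have kp : p <= k * p by rewrite leq_pmull.
lia.
Qed.

End OneTableau.

Lemma tab_match t u : t \in T l -> u \in T l ->
  exists2 f : 'I_n -> 'I_n, injective f & forall a, t a = u (f a).
Proof.
move=> tT uT; have ex a : exists b, t a == u b.
  move: (tT) (uT); rewrite !inE => /and3P[/andP[_ /eqP h1] _ _] /and3P[/andP[_ /eqP h2] _ _].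
  have : t a \in [set u b | b : 'I_n] by rewrite h2 -h1 imset_f.
  by case/imsetP => b _ ->; exists b.
exists (fun a => xchoose (ex a)) => [a b e|a]; last exact/eqP/(xchooseP (ex a)).
by apply: (tab_inj tT); rewrite (eqP (xchooseP (ex a))) e -(eqP (xchooseP (ex b))).
Qed.

Lemma box_eqs t u a b : t a = u b ->
  [/\ box_comp t a = box_comp u b, box_row t a = box_row u b,
      box_col t a = box_col u b & content K t a = content K u b].
Proof. by move=> e; rewrite /content /box_comp /box_row /box_col e. Qed.

Lemma tab_order_near t u (f : 'I_n -> 'I_n) (a b : 'I_n) : t \in T l -> u \in T l ->
    (forall a, t a = u (f a)) -> injective f -> a < b -> box_comp t a = box_comp t b ->
    (content K t b - content K t a = 1)%R \/ (content K t b - content K t a = - 1)%R ->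
  f a < f b.
Proof.
move=> tT uT ef fi ab e h.
suff le : f a <= f b.
  rewrite ltn_neqAle le andbT; apply/eqP => /val_inj/fi eab; by rewrite eab ltnn in ab.
have prec_f x y : box_prec t x y -> box_prec u (f x) (f y).
  rewrite /box_prec.
  by have [_ -> -> _] := box_eqs (ef x); have [_ -> -> _] := box_eqs (ef y).
have : box_prec t a b || box_prec t b a.
  case: h => h.
    have h1 : (content K t b = content K t a + 1)%R by rewrite -h addrC subrK.
    exact: box_prec_near h1.
  have h1 : (content K t a = content K t b + 1)%R by rewrite -[1%R]opprK -h opprB addrC subrK.
  by rewrite orbC; apply: box_prec_near h1.
have ef' : box_comp u (f a) = box_comp u (f b).
  by have [<- _ _ _] := box_eqs (ef a); have [<- _ _ _] := box_eqs (ef b).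
case/orP => h'; first exact: (box_prec_le uT _ (prec_f _ _ h')).
have := box_prec_le tT (esym e) h'; lia.
Qed.

Lemma increasing_id (f : 'I_n -> 'I_n) :
  (forall i i1 : 'I_n, i1 = i.+1 :> nat -> f i < f i1) -> f =1 id.
Proof.
move=> inc a; apply/val_inj/eqP; rewrite /= eqn_leq; apply/andP; split.
  suff: forall k (b : 'I_n), b + k = n.-1 -> f b + k <= n.-1.
    move/(_ (n.-1 - a) a); have := ltn_ord a; lia.
  elim=> [|k IHk] b ebk; first by have := ltn_ord (f b); lia.
  have b1 : b.+1 < n by have := ltn_ord b; lia.
  have := inc b (Ordinal b1) erefl; have := IHk (Ordinal b1) ltac:(rewrite /=; lia); lia.
case: a => a an /=; elim: a an => // a IHa an; have an' := ltnW an.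
have := inc (Ordinal an') (Ordinal an) erefl; have := IHa an'; lia.
Qed.

(** Bubble sort of the matching [f] between the two tableaux. A descent of [f] is an admissible
    swap, because entries of one component with content difference 1 or -1 are ordered alike in all
    tableaux of the shape. *)
Lemma tab_connected (Q : filling r n -> Prop) u :
    (forall t (i i1 : 'I_n), t \in T l -> Q t -> i1 = i.+1 :> nat ->
      (box_comp t i = box_comp t i1 ->
        (content K t i1 - content K t i != 1)%R /\ (content K t i1 - content K t i != - 1)%R) ->
      Q (swap_entries i i1 t)) ->
  u \in T l -> forall t, t \in T l -> Q t -> Q u.
Proof.
move=> Qswap uT t tT; have [f fi ef] := tab_match tT uT.
(* By the rearrangement inequality this bounded sum grows with each swap at a descent. *)
pose meas (g : 'I_n -> 'I_n) := \sum_(a < n) a * g a.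
have meas_le g : meas g <= n * (n * n).
  rewrite -[X in X * (n * n)]card_ord -sum_nat_const; apply: leq_sum => a _.
  by apply: leq_mul; apply: ltnW.
have no_descent t' (g : 'I_n -> 'I_n) : injective g -> (forall a, t' a = u (g a)) ->
    ~~ [exists i : 'I_n, exists i1 : 'I_n, (i1 == i.+1 :> nat) && (g i1 < g i)] -> u = t'.
  move=> gi eg nd; have gid : g =1 id.
    apply: increasing_id => i i1 ei; move: nd; rewrite negb_exists => /forallP/(_ i).
    rewrite negb_exists => /forallP/(_ i1); rewrite ei eqxx /= -leqNgt => le.
    by apply: ord_lt => //; apply/eqP => /gi e; move: ei; rewrite e; lia.
  by apply/ffunP => a; rewrite eg gid.
move: {2}_.+1 (ltnSn (n * (n * n) - meas f)) => N.
elim: N t tT f fi ef => // N IHN t tT f fi ef ltN Qt.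
have [/existsP[i /existsP[i1 /andP[/eqP ei lt]]]|/(no_descent t f fi ef) -> //] :=
  boolP [exists i : 'I_n, exists i1 : 'I_n, (i1 == i.+1 :> nat) && (f i1 < f i)].
pose g a := f (tperm i i1 a).
have ne : i1 != i by rewrite -val_eqE /=; lia.
have lt_meas : meas f < meas g.
  rewrite /meas (bigD1 i) //= (bigD1 i1) //= [X in _ < X](bigD1 i) //= [X in _ < _ + X](bigD1 i1) //=.
  rewrite /g tpermL tpermR !addnA [X in _ < _ + X](eq_bigr (fun a : 'I_n => a * f a)).
    by rewrite ltn_add2r ei; nia.
  by move=> a /andP[? ?]; rewrite tpermD // eq_sym.
have adm : box_comp t i = box_comp t i1 ->
    (content K t i1 - content K t i != 1)%R /\ (content K t i1 - content K t i != - 1)%R.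
  move=> e; suff : ~ ((content K t i1 - content K t i = 1)%R \/ (content K t i1 - content K t i = - 1)%R).
    by move=> h; split; apply/eqP => h'; apply: h; [left | right].
  by move=> h; have := tab_order_near tT uT ef fi _ e h; rewrite ei ltnS leqnn => /(_ isT); lia.
apply: (IHN (swap_entries i i1 t) _ g).
- exact: tab_swap.
- by move=> a b /fi/perm_inj.
- by move=> a; rewrite ffunE ef.
- have := meas_le g; lia.
- exact: Qswap.
Qed.

Lemma card_diagram : #|diagram n l| = n.
Proof.
rewrite -[RHS](r_splittable_sum l_spl) -sum1_card.
rewrite (eq_bigl (fun b : box r n => b.1.2 < nth 0 (tnth l b.2) b.1.1)); last by move=> b; rewrite inE.
rewrite big_mkcond -(pair_big xpredT xpredT (fun (x : 'I_n * 'I_n) (k : 'I_r) =>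
   if x.2 < nth 0 (tnth l k) x.1 then 1 else 0)) /= exchange_big /=; apply: eq_bigr => k _.
rewrite -(pair_big xpredT xpredT (fun (i j : 'I_n) => if j < nth 0 (tnth l k) i then 1 else 0)) /=.
have pa := splittable_partition (r_splittable_comp l_spl k).
rewrite (eq_bigr (fun i : 'I_n => nth 0 (tnth l k) i)) => [|i _]; last first.
  have le : nth 0 (tnth l k) i <= n.
    have [->//|p0] := posnP (nth 0 (tnth l k) i).
    have := @shape_box_lt _ _ _ _ l_spl k i (nth 0 (tnth l k) i).-1; rewrite prednK // leqnn => /(_ isT); lia.
  by rewrite -big_mkcond -(big_ord_widen _ (fun=> 1) le) sum1_card card_ord.
rewrite sumnE (big_nth 0) big_mkord.
have sn : size (tnth l k) <= n.
  rewrite leqNgt; apply/negP => lt; have := @shape_box_lt _ _ _ _ l_spl k n 0.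
  by rewrite (partition_pos _ pa) => /(_ lt); rewrite ltnn.
by rewrite (big_ord_widen _ (fun i => nth 0 (tnth l k) i) sn)
  [LHS](bigID (fun i : 'I_n => i < size (tnth l k))) /=
  [X in _ + X]big1 ?addn0 // => i; rewrite -leqNgt => h; rewrite nth_default.
Qed.

(* Filling column by column. *)
Lemma tab_exists : 0 < n -> exists t, t \in T l.
Proof.
move=> n0; have /card_gt0P[b0 _] : 0 < #|diagram n l| by rewrite card_diagram.
pose key (b : box r n) := b.1.2 * n + b.1.1.
pose s := sort (fun x y => key x <= key y) (enum (diagram n l)).
have ss : size s = n by rewrite size_sort -cardE card_diagram.
have us : uniq s by rewrite sort_uniq enum_uniq.
have ms b : (b \in s) = (b \in diagram n l) by rewrite mem_sort mem_enum.
pose t : filling r n := [ffun a => nth b0 s (val a)].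
have t_key a b : key (t a) < key (t b) -> a < b.
  rewrite !ffunE => lt; rewrite ltnNge; apply/negP => le; move: lt; rewrite ltnNge => /negP; apply.
  apply: (sorted_leq_nth (leT := fun x y => key x <= key y)); rewrite ?inE ?ss ?ltn_ord //.
  - by move=> x y z /= h1 h2; apply: leq_trans h1 h2.
  - by apply: sort_sorted => x y; apply: leq_total.
have key_row a b : box_row t a = box_row t b -> box_col t a < box_col t b -> a < b.
  by move=> e lt; apply: t_key;
    rewrite /key -/(box_col t a) -/(box_col t b) -/(box_row t a) -/(box_row t b) e; nia.
have key_col a b : box_col t a < box_col t b -> a < b.
  move=> lt; apply: t_key;
    rewrite /key -/(box_col t a) -/(box_col t b) -/(box_row t a) -/(box_row t b).
  have : box_row t a < n by apply: ltn_ord.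
  nia.
have key_row' a b : box_col t a = box_col t b -> box_row t a < box_row t b -> a < b.
  move=> e lt; apply: t_key;
    rewrite /key -/(box_col t a) -/(box_col t b) -/(box_row t a) -/(box_row t b) e; lia.
exists t; rewrite inE; apply/and3P; split.
- apply/andP; split.
    apply/injectiveP => a b; rewrite !ffunE => /eqP; rewrite nth_uniq ?ss ?ltn_ord //.
    by move/eqP/val_inj.
  apply/eqP/setP => b; rewrite -ms; apply/imsetP/idP => [[a _ ->]|bs].
    by rewrite ffunE mem_nth // ss ltn_ord.
  have lt : index b s < n by rewrite -[X in _ < X]ss index_mem.
  by exists (Ordinal lt); rewrite // ffunE /= nth_index.
- apply/forallP => a; apply/forallP => b; apply/implyP => _.
  apply/andP; split; apply/implyP => /andP[/eqP e lt]; [exact: key_row | exact: key_row'].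
- apply/forallP => a; apply/forallP => b; apply/implyP => /and4P[_ _ lt _]; exact: key_col.
Qed.

End OneShape.

(** Induction on the entry: smaller entries occupy the same boxes. If the two candidates for the
    next box lie on one diagonal but differ, the north-western one is already filled. If their
    contents differ by a positive multiple of p, the west neighbour of the farther one is already
    filled in both tableaux, which [tab_far] forbids in the other tableau. *)
Lemma tab_unique_boxes l m t u : r_splittable_shape p n l -> r_splittable_shape p n m ->
    t \in T l -> u \in T m ->
    (forall a, box_comp t a = box_comp u a) -> (forall a, content K t a = content K u a) ->
  t = u.
Proof.
move=> ls ms tT uT ec eK; apply/ffunP => a.
suff H N (b : 'I_n) : b < N -> t b = u b by apply: (H n).
elim: N b => // N IHN {}a aN.
have IH (b : 'I_n) : b < a -> t b = u b by move=> ba; apply: IHN; lia.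
have [k h] : exists k, box_col t a + box_row u a = box_col u a + box_row t a + k * p \/
            box_col u a + box_row t a = box_col t a + box_row u a + k * p.
  apply: (nat_eq_pchar pK); rewrite !natrD; apply/eqP.
  rewrite -subr_eq0; apply/eqP; rewrite -(subrr (content K t a)) {2}eK /content; ring.
clear eK IHN aN; wlog {h} h : l m t u ls ms tT uT ec IH /
  box_col u a + box_row t a = box_col t a + box_row u a + k * p.
  move=> W; case: h => h; last exact: (W l m).
  by symmetry; apply: (W m l u t) => // b ba; rewrite IH.
have eq_boxes : box_row t a = box_row u a -> box_col t a = box_col u a -> t a = u a.
  move=> e2 e3; rewrite [t a]surjective_pairing [(t a).1]surjective_pairing.
  rewrite [u a]surjective_pairing [(u a).1]surjective_pairing.
  by congr (_, _, _); [apply/val_inj | apply/val_inj | apply: ec].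
have contra_u (x : 'I_n) : x < a -> box_comp u x = box_comp t a -> box_row u x = box_row t a ->
    box_col u x = box_col t a -> False.
  move=> xa x1 x2 x3; have [c1 c2 c3 _] := box_eqs (IH x xa).
  have e := box_eq tT (etrans c1 x1) (etrans c2 x2) (etrans c3 x3).
  by move: xa; rewrite e ltnn.
have [k0|k0] := posnP k.
  have {k k0} h : box_col u a + box_row t a = box_col t a + box_row u a by lia.
  have [e|e|e] := ltngtP (box_row t a) (box_row u a); last by apply: eq_boxes; lia.
  - have [x [x1 x2 x3]] := tab_sub ms uT (i := box_row t a) (j := box_col t a) (ltnW e) ltac:(lia).
    exfalso; apply: (contra_u x); rewrite // ?x1 ?ec //.
    apply: ord_lt; first by apply: (tab_le ms uT); rewrite ?x1 ?x2 ?x3 //; lia.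
    by apply/eqP => ex; move: x2; rewrite ex; lia.
  - have [x [x1 x2 x3]] := tab_sub ls tT (i := box_row u a) (j := box_col u a) (ltnW e) ltac:(lia).
    have xa : x < a.
      apply: ord_lt; first by apply: (tab_le ls tT); rewrite ?x1 ?x2 ?x3 //; lia.
      by apply/eqP => ex; move: x2; rewrite ex; lia.
    have [c1 c2 c3 _] := box_eqs (IH x xa).
    have eb := @box_eq _ _ uT x a; rewrite -c1 -c2 -c3 x1 ec x2 x3 in eb.
    by move: xa; rewrite eb // ltnn.
have kp : p <= k * p by rewrite leq_pmull.
have rt := tab_row_lt ls tT a.
have [w [w1 w2 w3]] := tab_sub ms uT (a := a) (i := box_row u a) (j := (box_col u a).-1) (leqnn _) ltac:(lia).
have wa : w < a by apply: (std_row uT); rewrite ?w1 ?w2 ?w3 //; lia.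
have [c1 c2 c3 _] := box_eqs (IH w wa).
have := @tab_far _ ls _ tT a w; rewrite c1 c2 c3 w1 ec w2 w3 => /(_ erefl); lia.
Qed.

Lemma shape_unique l m t : r_splittable_shape p n l -> r_splittable_shape p n m ->
  t \in T l -> t \in T m -> l = m.
Proof.
move=> ls ms; rewrite !inE => /and3P[/andP[_ /eqP e1] _ _] /and3P[/andP[_ /eqP e2] _ _].
have ed : diagram n l = diagram n m by rewrite -e1.
have le l1 l2 : r_splittable_shape p n l1 -> diagram n l1 = diagram n l2 ->
    forall k i, nth 0 (tnth l1 k) i <= nth 0 (tnth l2 k) i.
  move=> s1 e k i; have [->//|p0] := posnP (nth 0 (tnth l1 k) i).
  have lt : (nth 0 (tnth l1 k) i).-1 < nth 0 (tnth l1 k) i by rewrite prednK.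
  have /andP[i_n j_n] := shape_box_lt s1 lt.
  have /setP/(_ (Ordinal i_n, Ordinal j_n, k)) := e; rewrite !inE /= lt => /esym; lia.
apply: eq_from_tnth => k.
have en i : nth 0 (tnth l k) i = nth 0 (tnth m k) i.
  by apply/eqP; rewrite eqn_leq !le.
have pl := splittable_partition (r_splittable_comp ls k).
have pm := splittable_partition (r_splittable_comp ms k).
apply: (eq_from_nth (x0 := 0)) => [|i _]; last exact: en.
apply/eqP; rewrite eqn_leq; apply/andP; split; rewrite leqNgt; apply/negP.
- by rewrite -(partition_pos _ pl) en (partition_pos _ pm) ltnn.
- by rewrite -(partition_pos _ pm) -en (partition_pos _ pl) ltnn.
Qed.

End Tableaux.

(** * Residue sequences *)

Lemma splittable_intro p la : is_partition la -> size la < p ->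
    nth 0 la 0 + size la <= nth 0 la (size la).-1 + p ->
  splittable_shape p la.
Proof.
move=> pa sp ch; rewrite /splittable_shape pa /chi -nth0 -(nth_last 0) orbC.
apply/orP; left; apply/and3P; split=> //; last by lia.
by apply/allP => x _; apply: leq_ltn_trans sp; apply: count_size.
Qed.

Lemma sumn_incr_nth la i : sumn (incr_nth la i) = (sumn la).+1.
Proof.
elim: la i => [|x la IH] [|i] //=; last by rewrite IH addnS.
by elim: i => //= i ->.
Qed.

Lemma is_partitionP la : reflect
  ((forall i, nth 0 la i.+1 <= nth 0 la i) /\ (forall i, i < size la -> 0 < nth 0 la i))
  (is_partition la).
Proof.
apply: (iffP idP) => [pa|[h1 h2]].
  split=> i; first exact: partition_mono.
  by rewrite (partition_pos _ pa).
apply/andP; split; last by apply/(all_nthP 0).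
by apply/(sortedP 0) => i _; apply: h1.
Qed.

Section Growth.
Variables (K : fieldType) (p : nat).
Hypothesis pK : (p \in [pchar K])%R.
Hypothesis p_gt2 : 2 < p.

(** Also the content of the box that would be appended to row [i]. *)
Definition beta_nb (la : seq nat) i : K := ((nth 0 la i)%:R - i%:R)%R.

Variables (n : nat) (Q : pred nat) (c : nat -> K).

(* J1 and J2: a residue s is a beta-number modulo p of the current shape exactly
   when the last entry of residue s or s - 1 has residue s - 1. *)
Record growth m la (f : nat -> nat * nat) : Prop := {
  gr_spl : splittable_shape p la;
  gr_sum : sumn la = count Q (iota 0 m);
  gr_box : forall a, a < m -> Q a -> (f a).2 < nth 0 la (f a).1;
  gr_surj : forall i j, j < nth 0 la i -> exists a, [/\ a < m, Q a & f a = (i, j)];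
  gr_inj : forall a b, a < m -> b < m -> Q a -> Q b -> f a = f b -> a = b;
  gr_content : forall a, a < m -> Q a -> c a = ((f a).2%:R - (f a).1%:R)%R;
  gr_row : forall a b, a < m -> b < m -> Q a -> Q b ->
    (f a).1 = (f b).1 -> (f a).2 < (f b).2 -> a < b;
  gr_col : forall a b, a < m -> b < m -> Q a -> Q b ->
    (f a).2 = (f b).2 -> (f a).1 < (f b).1 -> a < b;
  gr_p : forall a b, a < m -> b < m -> Q a -> Q b ->
    (f b).1 < (f a).1 -> (f a).2 < (f b).2 ->
    (f a).1 - (f b).1 + ((f b).2 - (f a).2) + 1 = p -> a < b;
  gr_J1 : forall i, i < size la -> exists a,
    [/\ a < m, Q a, (c a + 1)%R = beta_nb la i
      & forall b, a < b < m -> Q b -> c b != beta_nb la i];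
  gr_J2 : forall s, (forall i, i < size la -> beta_nb la i != s) ->
    (forall a, a < m -> Q a -> (c a != s) && (c a + 1 != s)%R) \/
    exists a, [/\ a < m, Q a, c a = s & forall b, a < b < m -> Q b -> (c b + 1 != s)%R] }.

Lemma growth_skip m la f : ~~ Q m -> growth m la f -> growth m.+1 la f.
Proof.
move=> nQ [h1 h2 h3 h4 h5 h6 h7 h8 h9 h10 h11].
have lt a : a < m.+1 -> Q a -> a < m.
  by rewrite ltnS leq_eqVlt => /orP[/eqP ->|//]; rewrite (negPf nQ).
split=> //.
- by rewrite -[m.+1]addn1 iotaD count_cat -h2 /= add0n (negPf nQ) !addn0.
- by move=> a am Qa; apply: h3 => //; apply: lt.
- by move=> i j /h4[a [am Qa e]]; exists a; split=> //; apply: ltnW.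
- by move=> a b am bm Qa Qb; apply: h5; rewrite ?lt.
- by move=> a am Qa; apply: h6 => //; apply: lt.
- by move=> a b am bm Qa Qb; apply: h7; rewrite ?lt.
- by move=> a b am bm Qa Qb; apply: h8; rewrite ?lt.
- by move=> a b am bm Qa Qb; apply: h9; rewrite ?lt.
- move=> i /h10[a [am Qa e hb]]; exists a; split=> //; first exact: ltnW.
  by move=> b /andP[ab bm] Qb; apply: hb => //; rewrite ab lt.
- move=> s /h11[hl|[a [am Qa e hb]]]; [left=> a am Qa; apply: hl => //; exact: lt | right].
  exists a; split=> //; first exact: ltnW.
  by move=> b /andP[ab bm] Qb; apply: hb => //; rewrite ab lt.
Qed.

(** The last two hypotheses say that no earlier box lies where p-standardness would require an entry
    larger than the new one, and that no other row has beta-number [c m]; the latter preserves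
    J1. *)
Lemma growth_add m la f i : growth m la f -> Q m -> i <= size la ->
    c m = beta_nb la i ->
    splittable_shape p (incr_nth la i) ->
    (forall b, b < m -> Q b -> (f b).1 < i -> nth 0 la i < (f b).2 ->
       i - (f b).1 + ((f b).2 - nth 0 la i) + 1 <> p) ->
    (forall k, k < size la -> k != i -> beta_nb la k != c m) ->
  growth m.+1 (incr_nth la i) (fun a => if a == m then (i, nth 0 la i) else f a).
Proof.
move=> [h1 h2 h3 h4 h5 h6 h7 h8 h9 h10 h11] Qm il cm spl hp hB.
set f' := fun a => _; have f'm : f' m = (i, nth 0 la i) by rewrite /f' eqxx.
have f'a a : a < m -> f' a = f a by move=> am; rewrite /f' ltn_eqF.
have lt a : a < m.+1 -> a = m \/ a < m by lia.
have new a : a < m -> Q a -> f a <> (i, nth 0 la i).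
  by move=> am Qa e; have := h3 a am Qa; rewrite e ltnn.
have part := splittable_partition h1; have part' := splittable_partition spl.
have b_new : (beta_nb (incr_nth la i) i = c m + 1)%R.
  by rewrite cm /beta_nb nth_incr_nth eqxx natrD /=; ring.
have b_old k : k != i -> beta_nb (incr_nth la i) k = beta_nb la k.
  by move=> ki; rewrite /beta_nb nth_incr_nth eq_sym (negPf ki).
have sz k : k < size (incr_nth la i) -> k = i \/ k < size la /\ k != i.
  by rewrite size_incr_nth; case: ifP; have [->|] := eqVneq k i; [left| |left|]; lia.
have sz' k : k < size la -> k < size (incr_nth la i) by rewrite size_incr_nth; case: ifP; lia.
have szi : i < size (incr_nth la i) by rewrite size_incr_nth; case: ifP; lia.
have row_le a : a < m -> Q a -> (f a).1 = i -> (f a).2 < nth 0 la i.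
  by move=> am Qa e; rewrite -e; apply: h3.
have col_le a : a < m -> Q a -> (f a).2 = nth 0 la i -> (f a).1 < i.
  move=> am Qa e; rewrite ltnNge; apply/negP => le; have := h3 a am Qa.
  by rewrite e ltnNge; rewrite (partition_mono part le).
split=> //.
- by rewrite sumn_incr_nth -[m.+1]addn1 iotaD count_cat -h2 /= add0n Qm; lia.
- move=> a /lt[->|am] Qa; first by rewrite f'm /= nth_incr_nth eqxx.
  by rewrite f'a //; apply: leq_trans (h3 a am Qa) _; rewrite nth_incr_nth leq_addl.
- move=> k j; rewrite nth_incr_nth; case: eqP => [<-|_] /= jk.
    have [e|ne] := eqVneq j (nth 0 la i); first by exists m; rewrite f'm e.
    have /h4[a [am Qa e]] : j < nth 0 la i by lia.
    by exists a; rewrite f'a // ltnW.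
  by have /h4[a [am Qa e]] := jk; exists a; rewrite f'a // ltnW.
- move=> a b /lt[->|am] /lt[->|bm] Qa Qb //; rewrite ?f'm ?f'a //.
  + by move/esym/new; case.
  + by move/new; case.
  + exact: h5.
- move=> a /lt[->|am] Qa; first by rewrite f'm cm.
  by rewrite f'a // h6.
- move=> a b /lt[->|am] /lt[->|bm] Qa Qb //; rewrite ?f'm ?f'a ?ltnn //=; last exact: h7.
  by move=> e; have := row_le b bm Qb (esym e); lia.
- move=> a b /lt[->|am] /lt[->|bm] Qa Qb //; rewrite ?f'm ?f'a ?ltnn //=; last exact: h8.
  by move=> e; have := col_le b bm Qb (esym e); lia.
- move=> a b /lt[->|am] /lt[->|bm] Qa Qb //; rewrite ?f'm ?f'a ?ltnn //=; last exact: h9.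
  by move=> q1 q2 q3; case: (hp b bm Qb).
- move=> k /sz[->|[kl ki]].
    by exists m; split=> // b; lia.
  have [a [am Qa e hb]] := h10 k kl; exists a; rewrite b_old //; split=> //; first exact: ltnW.
  by move=> b /andP[ab /lt[->|bm]] Qb; [rewrite eq_sym hB | apply: hb; rewrite ?ab].
- move=> s hs; have sm : (c m + 1 != s)%R by rewrite -b_new hs.
  have [e|ne] := eqVneq (c m) s; first by right; exists m; split=> // b; lia.
  case: (h11 s) => [k kl|hl|[a [am Qa e hb]]].
  + have [->|ki] := eqVneq k i; first by rewrite -cm.
    by rewrite -b_old // hs // sz'.
  + by left=> a /lt[->|am] Qa; [rewrite ne sm | apply: hl].
  + right; exists a; split=> //; first exact: ltnW.
    by move=> b /andP[ab /lt[->//|bm]] Qb; apply: hb; rewrite ?ab.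
Qed.

Hypothesis between : forall i j, i < j -> j < n -> Q i -> Q j -> c i = c j ->
  (exists a, [/\ i < a < j, Q a & c a = (c i + 1)%R]) /\
  (exists a, [/\ i < a < j, Q a & (c a + 1)%R = c i]).
Hypothesis neighbour : forall j, j < n -> Q j ->
  c j = 0%R \/ exists i, [/\ i < j, Q i & c i = (c j + 1)%R \/ (c i + 1)%R = c j].

Lemma beta_nb_neq la i k : splittable_shape p la -> i < size la -> k < size la ->
  i != k -> beta_nb la i != beta_nb la k.
Proof.
move=> spl; wlog ik : i k / i < k => [W il kl ne|il kl _].
  have [lt|lt|e] := ltngtP i k; first exact: W.
    by rewrite eq_sym; apply: W => //; rewrite eq_sym.
  by rewrite e eqxx in ne.
apply/eqP => e; have [q h] : exists q, nth 0 la i + k = nth 0 la k + i + q * p \/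
     nth 0 la k + i = nth 0 la i + k + q * p.
  apply: (nat_eq_pchar pK); rewrite !natrD; apply/eqP; rewrite -subr_eq0; apply/eqP.
  by rewrite -(subrr (beta_nb la i)) {2}e /beta_nb; ring.
have h1 := splittable_range spl (ltnW ik) kl.
have h2 := partition_mono (splittable_partition spl) (ltnW ik).
have [q0|q0] := posnP q; first by nia.
have : p <= q * p by rewrite leq_pmull.
lia.
Qed.

(** The residue of the new entry dictates its place: the row with that beta-number if there is one,
    and otherwise a new row at the bottom. *)
Lemma growth_step m la f : m < n -> Q m -> growth m la f ->
  exists la' f', growth m.+1 la' f'.
Proof.
move=> mn Qm gr; have [spl _ gbox gsurj _ gcont _ _ _ J1 J2] := gr.
have part := splittable_partition spl.
have szp : size la < p by apply: splittable_size spl; lia.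
have [/hasP[i]|/hasPn none] := boolP (has (fun i => beta_nb la i == c m) (iota 0 (size la))).
  rewrite mem_iota add0n => /= il /eqP bi.
  (* By J1, after the last entry of residue [c m] no entry would have residue [c m + 1], against
     [between]. A beta-number [c m + 1] is the only obstruction to lengthening row [i]: it is what a
     preceding row of equal length, or an overflow of the window, would give. *)
  have no_succ k : k < size la -> beta_nb la k != (c m + 1)%R.
    move=> kl; apply/eqP => bk; have [e [em Qe ce he]] := J1 k kl.
    have cem : c e = c m by apply: (addIr 1%R); rewrite ce bk.
    have [[a [/andP[ea am] Qa ca]] _] := between em mn Qe Qm cem.
    by have := he a; rewrite ea am => /(_ isT Qa); rewrite ca cem bk eqxx.
  have part' : is_partition (incr_nth la i).
    have [p1 p2] := is_partitionP _ part; apply/is_partitionP; split=> k; last first.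
      by rewrite size_incr_nth il => /p2; rewrite nth_incr_nth; lia.
    rewrite !nth_incr_nth; have := p1 k; case: eqP => [e|_] /=; last by lia.
    rewrite e eqn_leq ltnn /= add0n add1n ltn_neqAle => -> ; rewrite andbT; apply/eqP => e2.
    have := no_succ k ltac:(lia); rewrite -bi e /beta_nb e2 -natr1.
    by move/eqP; apply; ring.
  have spl' : splittable_shape p (incr_nth la i).
    apply: splittable_intro => //; rewrite size_incr_nth il ?szp //.
    rewrite !nth_incr_nth; have rg := splittable_range spl (leq0n (size la).-1) ltac:(lia).
    case: eqP => [i0|_] /=; last by lia.
    case: eqP => [_|ine] /=; first by lia.
    (* Lengthening the first row overflows the window only if the last beta-number equals [c m + 1]
       modulo p. *)
    rewrite add1n add0n leqNgt; apply/negP => gt.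
    have := no_succ (size la).-1 ltac:(lia); rewrite -bi i0 /beta_nb => /eqP; case.
    have e : (nth 0 la 0 + size la = nth 0 la (size la).-1 + p)%N by lia.
    have := congr1 (fun x => x%:R : K)%R e; rewrite !natrD (pcharf0 pK) addr0 => <-.
    have -> : size la = (size la).-1.+1 by lia.
    by rewrite -natr1 /=; ring.
  eexists; eexists; apply: (growth_add gr Qm (ltnW il)) => //.
    move=> b bm Qb lt1 lt2 e; have := gbox b bm Qb.
    have := splittable_range spl (ltnW lt1) il; lia.
  by move=> k kl ki; rewrite -bi; apply: beta_nb_neq.
have noB k : k < size la -> beta_nb la k != c m.
  by move=> kl; apply: none; rewrite mem_iota.
(* In the second alternative the residue [c m - 1] does not follow an earlier occurrence of [c m],
   against [between]. *)
case: (J2 _ noB) => [noR|[e [em Qe ce he]]]; last first.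
  have [_ [a [/andP[ea am] Qa ca]]] := between em mn Qe Qm ce.
  by have := he a; rewrite ea am => /(_ isT Qa); rewrite ca ce eqxx.
(* For a nonempty shape, [noR] leaves only a neighbour of residue [c m + 1]. Its box is in the first
   column and the last row, since a box to its west or south would have residue [c m]. *)
have bsz : beta_nb la (size la) = c m.
  rewrite /beta_nb nth_default // sub0r.
  have [s0|s0] := posnP (size la).
    rewrite s0 oppr0; case: (neighbour mn Qm) => [-> //|[e [em Qe _]]].
    by have := gbox e em Qe; rewrite nth_default // s0.
  have h0 : 0 < nth 0 la 0 by rewrite (partition_pos _ part).
  have [z [zm Qz fz]] := gsurj _ _ h0.
  have cz := gcont z zm Qz; rewrite fz subrr in cz.
  case: (neighbour mn Qm) => [c0|[e [em Qe [ce|ce]]]].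
  - by have /andP[/eqP] := noR z zm Qz; rewrite cz c0.
  - have ge := gcont e em Qe; have be := gbox e em Qe; move: ge be ce.
    case: (f e) => i j /= -> ji ce.
    have j0 : j = 0.
      case: j ji ce => // j ji ce; have [x [xm Qx fx]] := gsurj i j (ltnW ji).
      have /andP[/eqP[]] := noR x xm Qx; apply: (addIr 1%R); rewrite -ce (gcont x) // fx /=.
      by rewrite -natr1; ring.
    have il : i < size la by rewrite -(partition_pos _ part); lia.
    have [ei|ni] := eqVneq i.+1 (size la).
      rewrite -ei; apply: (addIr 1%R); rewrite -ce j0 -natr1; ring.
    have il1 : 0 < nth 0 la i.+1 by rewrite (partition_pos _ part); lia.
    have [x [xm Qx fx]] := gsurj _ _ il1.
    have /andP[/eqP[]] := noR x xm Qx; apply: (addIr 1%R); rewrite -ce (gcont x) // fx /= j0.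
    by rewrite -natr1; ring.
  - by have /andP[_ /eqP[]] := noR e em Qe.
(* Otherwise the first row would contain a box of residue [c m - 1] (in case of equality) or [c m],
   both excluded by [noR]. *)
have small : 0 < size la -> nth 0 la 0 + size la < p.
  move=> s0; rewrite ltnNge; apply/negP => le.
  have cm : c m = (- (size la)%:R)%R by rewrite -bsz /beta_nb nth_default // sub0r.
  have [e|ne] := eqVneq (nth 0 la 0 + size la) p.
    have h0 : (nth 0 la 0).-1 < nth 0 la 0 by lia.
    have [x [xm Qx fx]] := gsurj _ _ h0.
    have /andP[_ /eqP[]] := noR x xm Qx; rewrite (gcont x) // fx /= subr0 natr1 prednK; last by lia.
    by rewrite cm; apply/eqP; rewrite -addr_eq0 -natrD e (pcharf0 pK).
  have h0 : p - size la < nth 0 la 0 by lia.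
  have [x [xm Qx fx]] := gsurj _ _ h0.
  have /andP[/eqP[]] := noR x xm Qx; rewrite (gcont x) // fx /= subr0 cm natrB ?(ltnW szp) //.
  by rewrite (pcharf0 pK) sub0r.
have nsz : nth 0 la (size la) = 0 by rewrite nth_default.
have h0 : 0 < size la -> 0 < nth 0 la 0 by rewrite (partition_pos _ part).
eexists; eexists; apply: (growth_add gr Qm (leqnn _)) => //.
- have [p1 p2] := is_partitionP _ part.
  apply: splittable_intro.
  + apply/is_partitionP; split=> k; rewrite ?size_incr_nth ?ltnn !nth_incr_nth.
      case: eqP => [e|_]; last by have := p1 k; lia.
      have : 0 < nth 0 la k by apply: p2; lia.
      by rewrite -e nsz; lia.
    by case: eqP => [//|ne] kl; apply: leq_trans (p2 k _) _; lia.
  + by rewrite size_incr_nth ltnn; have [s0|s0] := posnP (size la); have := small; lia.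
  + rewrite size_incr_nth ltnn /= !nth_incr_nth eqxx.
    have [s0|s0] := posnP (size la); first by move: nsz; rewrite s0; lia.
    by have := small s0; rewrite nsz; lia.
- rewrite nsz => b bm Qb lt1 lt2 e; have := gbox b bm Qb.
  have := partition_mono part (leq0n (f b).1); have := small ltac:(lia); lia.
- by move=> k kl _; apply: noB.
Qed.

Lemma growth_exists m : m <= n -> exists la f, growth m la f.
Proof.
elim: m => [|m IHm] mn.
  exists [::], (fun=> (0, 0)); split=> //=.
  - by move=> i j; rewrite nth_nil.
  - by move=> s _; left.
have [la [f gr]] := IHm (ltnW mn).
have [Qm|nQ] := boolP (Q m); first exact: growth_step gr.
by exists la, f; apply: growth_skip.
Qed.

End Growth.

(** * From residue sequences to tableaux of an r-partition *)

Section Assemble.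
Variables (K : fieldType) (p r n : nat).
Hypothesis pK : (p \in [pchar K])%R.
Hypothesis p_gt2 : 2 < p.
Variables (q : 'I_n -> 'I_r) (c : 'I_n -> K).

Hypothesis between : forall i j : 'I_n, i < j -> q i = q j -> c i = c j ->
  (exists a : 'I_n, [/\ i < a < j, q a = q i & c a = (c i + 1)%R]) /\
  (exists a : 'I_n, [/\ i < a < j, q a = q i & (c a + 1)%R = c i]).
Hypothesis neighbour : forall j : 'I_n, c j = 0%R \/
  exists i : 'I_n, [/\ i < j, q i = q j & c i = (c j + 1)%R \/ (c i + 1)%R = c j].

(** The components grow independently; [Q k] selects the entries of component [k] without
    renumbering them, so the order conditions carry over unchanged. *)
Lemma tableau_of_residues : exists l : r.-tuple (seq nat), r_splittable_shape p n l /\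
  exists2 t, t \in p_standard_tableaux n p l &
    forall a, box_comp t a = q a /\ content K t a = c a.
Proof.
pose Q k a := if insub a is Some a' then q a' == k else false.
pose c' a := if insub a is Some a' then c a' else 0%R.
have QE k (a : 'I_n) : Q k a = (q a == k) by rewrite /Q valK.
have cE (a : 'I_n) : c' a = c a by rewrite /c' valK.
have Qn k a : Q k a -> exists a' : 'I_n, a' = a :> nat /\ q a' = k.
  by rewrite /Q; case: insubP => // a' _ <- /eqP e; exists a'.
have gr k : exists x, growth p (Q k) c' n x.1 x.2.
  have [i j ij jn|j jn|la [f gr]] := @growth_exists K p pK p_gt2 n (Q k) c' _ _ n (leqnn n); last by exists (la, f).
  - move=> /Qn[i' [ei qi]] /Qn[j' [ej qj]]; move: ij; rewrite -ei -ej !cE => ij e.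
    have [[a [a1 a2 a3]] [b [b1 b2 b3]]] := between ij (etrans qi (esym qj)) e.
    by split; [exists a | exists b]; rewrite !QE ?cE ?a2 ?b2 qi.
  - move=> /Qn[j' [<- qj]]; rewrite !cE; have [->|[i [ij qi ci]]] := neighbour j'; [by left | right].
    by exists i; rewrite QE qi qj !cE.
have {gr}[g gr] := fin_all_exists gr.
pose l : r.-tuple (seq nat) := [tuple (g k).1 | k < r].
have tl k : tnth l k = (g k).1 by rewrite tnth_mktuple.
have spl : r_splittable_shape p n l.
  apply/andP; split; first by apply/forallP => k; rewrite tl; exact: gr_spl (gr k).
  apply/eqP; rewrite -[RHS]card_ord -sum1_card.
  rewrite (eq_bigr (fun k => \sum_(a < n | q a == k) 1)) => [|k _]; last first.
    rewrite tl (gr_sum (gr k)) -sum1_count -{1}[n]subn0 big_mkord.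
    by apply: eq_bigl => a; rewrite QE.
  rewrite (exchange_big_dep xpredT) //=; apply: eq_bigr => a _.
  by rewrite (eq_bigl (pred1 (q a))) ?big_pred1_eq // => k; rewrite /= eq_sym.
exists l; split=> //.
pose f a := (g (q a)).2 (val a).
have Qq (a : 'I_n) : Q (q a) a by rewrite QE.
have fb a : (f a).2 < nth 0 (tnth l (q a)) (f a).1 by rewrite tl; apply: (gr_box (gr (q a))) (Qq a).
have h1 a : (f a).1 < n by have /andP[] := shape_box_lt spl (fb a).
have h2 a : (f a).2 < n by have /andP[] := shape_box_lt spl (fb a).
pose t : filling r n := [ffun a => (Ordinal (h1 a), Ordinal (h2 a), q a)].
have tq a : box_comp t a = q a by rewrite /box_comp ffunE.
have tr a : box_row t a = (f a).1 by rewrite /box_row ffunE.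
have tc a : box_col t a = (f a).2 by rewrite /box_col ffunE.
exists t; last first.
  by move=> a; rewrite tq /content tr tc -cE (gr_content (gr (q a))).
rewrite inE; apply/and3P; split.
- apply/andP; split.
    apply/injectiveP => a b e; have [] := box_eqs K e; rewrite !tq !tr !tc => eq er ec _.
    apply/val_inj; apply: (gr_inj (gr (q a)) (ltn_ord a) (ltn_ord b) (Qq a)).
      by rewrite QE eq.
    by move: er ec; rewrite /f -eq; case: ((g _).2 _) ((g _).2 _) => ? ? [? ?] /= -> ->.
  apply/eqP/setP => -[[i j] k]; rewrite inE /=; apply/imsetP/idP => [[a _ e]|ji].
    by have := fb a; rewrite -tr -tc -tq /box_row /box_col /box_comp -e.
  rewrite tl in ji; have [a [an Qa e]] := gr_surj (gr k) ji.
  have [a' [ea qa]] := Qn _ _ Qa; exists a' => //.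
  have fa : f a' = (val i, val j) by rewrite /f qa /= ea e.
  by rewrite ffunE; congr (_, _, _) => //; apply/val_inj; rewrite /= fa.
- apply/forallP => a; apply/forallP => b; rewrite !tq !tr !tc; apply/implyP => /eqP eq.
  have Qb : Q (q a) b by rewrite QE eq.
  rewrite /f -eq; apply/andP; split; apply/implyP => /andP[/eqP e lt].
    exact: (gr_row (gr (q a)) (ltn_ord a) (ltn_ord b) (Qq a) Qb e lt).
  exact: (gr_col (gr (q a)) (ltn_ord a) (ltn_ord b) (Qq a) Qb e lt).
- apply/forallP => a; apply/forallP => b; rewrite !tq !tr !tc; apply/implyP => /and4P[/eqP eq].
  have Qb : Q (q a) b by rewrite QE eq.
  rewrite /f -eq => l1 l2 /eqP e.
  exact: (gr_p (gr (q a)) (ltn_ord a) (ltn_ord b) (Qq a) Qb l1 l2 e).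
Qed.

End Assemble.

Local Open Scope ring_scope.

(** * Weights and intertwiners *)

Section Coefficients.
Variables (K : fieldType) (r : nat) (sqroot : K -> K).
Hypothesis sqrootK : forall x : K, sqroot x ^+ 2 = x.
Implicit Types x y z : 'I_r * K.

Definition alpha x y : K := if x.1 == y.1 then (y.2 - x.2)^-1 else 0.
Definition beta x y : K := if x.1 == y.1 then sqroot (1 - (y.2 - x.2) ^- 2) else 1.
Definition separated x y := (x.1 == y.1) ==> (x.2 != y.2).

Lemma alphaC x y : alpha y x = - alpha x y.
Proof. by rewrite /alpha eq_sym; case: ifP => _; rewrite ?oppr0 // -opprB invrN. Qed.

Lemma betaC x y : beta y x = beta x y.
Proof. by rewrite /beta eq_sym -[x.2 - y.2]opprB sqrrN. Qed.

Lemma beta_sq x y : beta x y ^+ 2 = 1 - alpha x y ^+ 2.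
Proof.
rewrite /beta /alpha; case: ifP => _; last by rewrite expr0n subr0 expr1n.
by rewrite sqrootK exprVn.
Qed.

(** With differences a and b within one component this is 1/(ab) = (1/a + 1/b)/(a + b), the scalar
    identity behind the braid relation; if several components occur, both sides vanish. *)
Lemma alpha_triple x y z : separated x y -> separated y z -> separated x z ->
  alpha x y * alpha y z = alpha x z * (alpha x y + alpha y z).
Proof.
case: x y z => [px cx] [py cy] [pz cz]; rewrite /separated /alpha /=.
have [e1|n1] := eqVneq px py; have [e2|n2] := eqVneq py pz; rewrite ?e1 ?e2 ?eqxx /=.
- move=> h1 h2 h3; field.
  by rewrite !subr_eq0 ![cz == _]eq_sym [cy == cx]eq_sym h1 h2 h3.
- by rewrite (negPf n2) mulr0 mul0r.
- by rewrite -e2 (negPf n1) mul0r mul0r.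
- by rewrite mul0r addr0 mulr0.
Qed.

Lemma beta_eq0 x y : x.1 = y.1 -> beta x y = 0 -> y.2 = x.2 + 1 \/ y.2 = x.2 - 1.
Proof.
move=> e b0; have := beta_sq x y; rewrite b0 expr0n /= => /esym/eqP.
rewrite /alpha e eqxx subr_eq0 eq_sym sqrf_eq1 => /orP[] /eqP h.
  by left; rewrite -[LHS](subrK x.2) -[y.2 - _]invrK h invr1 addrC.
by right; rewrite -[LHS](subrK x.2) -[y.2 - _]invrK h invrN invr1 addrC.
Qed.

End Coefficients.

Section Weights.
Variables (K : fieldType) (r n : nat) (zeta : K) (sqroot : K -> K).
Hypothesis sqrootK : forall x : K, sqroot x ^+ 2 = x.
Hypothesis zeta_prim : r.-primitive_root zeta.
Hypothesis r_neq0 : r%:R != 0 :> K.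
Hypothesis two_neq0 : 2%:R != 0 :> K.

Local Notation V := ('I_r * K)%type.
Local Notation wt := {ffun 'I_n.+1 -> V}.
Local Notation o i := (inord i : 'I_n.+1).
Local Notation alpha := (@alpha K r).
Local Notation beta := (@beta K r sqroot).

Let r_gt0 : (0 < r)%N. Proof. exact: prim_order_gt0 zeta_prim. Qed.

Definition swap_wt i (c : wt) : wt := [ffun a => c (adj n i a)].

Lemma swap_wtL i c : (i < n)%N -> swap_wt i c (o i) = c (o i.+1).
Proof. by move=> _; rewrite ffunE /adj tpermL. Qed.

Lemma swap_wtR i c : (i < n)%N -> swap_wt i c (o i.+1) = c (o i).
Proof. by move=> _; rewrite ffunE /adj tpermR. Qed.

Lemma swap_wt_out i c k : (i < n)%N -> (k <= n)%N -> k != i -> k != i.+1 ->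
  swap_wt i c (o k) = c (o k).
Proof. by move=> i_n kn ki ki1; rewrite ffunE adj_out // val_inord. Qed.

Lemma swap_wtK i : involutive (swap_wt i).
Proof. by move=> c; apply/ffunP => a; rewrite !ffunE tpermK. Qed.

Section Module.
Variables (d : nat) (rG : wr_repr K r n.+1 d).
Let G i := rG (wr_s r (adj n i)).
Implicit Types (c : wt) (x : 'rV[K]_d).

Definition is_wt c x :=
  (forall j, x *m rG (wr_t r j) = zeta ^+ (c j).1 *: x) /\
  (forall k, x *m jucys_murphy rG k = (r%:R * (c k).2) *: x).

Lemma is_wt0 c : is_wt c 0.
Proof. by split=> j; rewrite mul0mx scaler0. Qed.

Lemma is_wtZ c a x : is_wt c x -> is_wt c (a *: x).
Proof.
by case=> h1 h2; split=> j; rewrite -scalemxAl ?h1 ?h2 !scalerA [a * _]mulrC.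
Qed.

Lemma eigen_expg y (a : K) x m : x *m rG y = a *: x -> x *m rG (y ^+ m)%g = a ^+ m *: x.
Proof.
move=> e; elim: m => [|m IHm]; first by rewrite expg0 repr_mx1 mulmx1 expr0 scale1r.
by rewrite expgSr wr_reprM mulmxA IHm -scalemxAl e scalerA exprSr.
Qed.

Lemma eigen_invg y (a : K) x : a != 0 -> x *m rG y = a *: x -> x *m rG y^-1%g = a^-1 *: x.
Proof.
move=> a0 e; apply: (can_inj (repr_mxK rG (in_setT y))).
by rewrite -mulmxA -wr_reprM mulVg repr_mx1 mulmx1 -scalemxAl e scalerA mulVf // scale1r.
Qed.

Lemma zeta_neq0 : zeta != 0.
Proof. apply/eqP => z0; have := prim_expr_order zeta_prim.
by rewrite z0 expr0n eqn0Ngt r_gt0 => /eqP; rewrite eq_sym oner_eq0. Qed.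

(** A geometric sum over the powers of an r-th root of unity, which is 1 exactly when the two
    components agree. *)
Lemma wt_pair c x l k : (forall j, x *m rG (wr_t r j) = zeta ^+ (c j).1 *: x) ->
  x *m jm_pair rG l k = (if (c l).1 == (c k).1 then r%:R else 0) *: x.
Proof.
move=> ht; rewrite mulmx_sumr; set w := zeta ^+ (c l).1 / zeta ^+ (c k).1.
rewrite (eq_bigr (fun s : 'I_r => w ^+ s *: x)) => [|s _]; last first.
  rewrite wr_reprM mulmxA (eigen_expg _ (ht l)) -scalemxAl -expgVn.
  rewrite (eigen_expg s (eigen_invg _ (ht k))) ?expf_neq0 ?zeta_neq0 // scalerA.
  by rewrite -exprMn.
rewrite -scaler_suml; congr (_ *: _).
have wr1 : w ^+ r = 1.
  by rewrite exprMn exprVn ![(_ ^+ _) ^+ r]exprAC (prim_expr_order zeta_prim) !expr1n divr1.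
have -> : ((c l).1 == (c k).1) = (w == 1).
  rewrite /w -(divff (expf_neq0 (c k).1 zeta_neq0)) (inj_eq (mulIf _)) ?invr_eq0 ?expf_neq0 ?zeta_neq0 //.
  rewrite (eq_prim_root_expr zeta_prim) !modn_small //.
case: eqP => [->|w1].
  by rewrite (eq_bigr (fun=> 1)) ?sumr_const ?card_ord // => s _; rewrite expr1n.
have := subrX1 w r; rewrite wr1 subrr => /esym/eqP; rewrite mulf_eq0 subr_eq0.
by case/orP => /eqP.
Qed.

Lemma G_sq i : G i *m G i = 1%:M.
Proof. exact: adj_sq_mx. Qed.

Lemma jm_adjl_wt c x i : (i < n)%N -> is_wt c x ->
  x *m G i *m jucys_murphy rG (o i) =
  (r%:R * (c (o i.+1)).2) *: (x *m G i)
    - (if (c (o i)).1 == (c (o i.+1)).1 then r%:R else 0) *: x.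
Proof.
move=> i_n wx; rewrite -mulmxA jm_adjl // mulmxBr mulmxA (proj2 wx) -scalemxAl.
by rewrite (wt_pair _ _ (proj1 wx)).
Qed.

Lemma jm_adjr_wt c x i : (i < n)%N -> is_wt c x ->
  x *m G i *m jucys_murphy rG (o i.+1) =
  (r%:R * (c (o i)).2) *: (x *m G i)
    + (if (c (o i)).1 == (c (o i.+1)).1 then r%:R else 0) *: x.
Proof.
move=> i_n wx; rewrite -mulmxA jm_adjr // mulmxDr mulmxA (proj2 wx) -scalemxAl.
by rewrite (wt_pair _ _ (proj1 wx)) eq_sym.
Qed.

(** The correction by [alpha] cancels the extra summand in the commutation of g_i with xi_i and
    xi_{i+1}. *)
Lemma wt_swap c x i : (i < n)%N -> separated (c (o i)) (c (o i.+1)) -> is_wt c x ->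
  is_wt (swap_wt i c) (x *m G i - alpha (c (o i)) (c (o i.+1)) *: x).
Proof.
move=> i_n sep wx; have [ht hjm] := wx; split=> [j|k].
  rewrite mulmxBl -mulmxA /G.
  have := t_perm_mx rG (adj n i j) (adj n i); rewrite tpermK => <-.
  rewrite mulmxA ht -!scalemxAl ht scalerBr ffunE; congr (_ - _).
  rewrite /alpha; case: eqP => [e|_]; last by rewrite !scale0r scaler0.
  rewrite !scalerA mulrC; congr (_ * _ *: _); congr (_ ^+ _).
  by rewrite /adj; case: tpermP => [->|->|]; rewrite ?e.
rewrite mulmxBl -scalemxAl hjm.
have [->|ki] := eqVneq k (o i).
  rewrite swap_wtL // (jm_adjl_wt _ wx) // /alpha; move: sep; rewrite /separated.
  case: eqP => /= [_ ne|_ _]; last by rewrite !scale0r !subr0.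
  rewrite scalerBr !scalerA -addrA -opprD -scalerDl; congr (_ - _ *: _).
  by field; rewrite subr_eq0 eq_sym.
have [->|ki1] := eqVneq k (o i.+1).
  rewrite swap_wtR // (jm_adjr_wt _ wx) // /alpha; move: sep; rewrite /separated.
  case: eqP => /= [_ ne|_ _]; last by rewrite !scale0r !subr0 addr0.
  rewrite scalerBr !scalerA -addrA -scalerBl -scaleNr; congr (_ + _ *: _).
  by field; rewrite subr_eq0 eq_sym.
rewrite ffunE adj_out //; last 2 first.
- by apply: contra ki => /eqP e; apply/eqP/val_inj; rewrite val_inord // ltnW.
- by apply: contra ki1 => /eqP e; apply/eqP/val_inj; rewrite val_inord.
rewrite -mulmxA -jm_adjC // mulmxA hjm -scalemxAl scalerBr !scalerA.
by rewrite [alpha _ _ * _]mulrC.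
Qed.

(** One index type for the t_j and the xi_k lets the separation of weights treat both kinds of
    operator alike. *)
Definition wt_op (k : 'I_n.+1 + 'I_n.+1) : 'M[K]_d :=
  match k with inl j => rG (wr_t r j) | inr j => jucys_murphy rG j end.

Definition wt_val c (k : 'I_n.+1 + 'I_n.+1) : K :=
  match k with inl j => zeta ^+ (c j).1 | inr j => r%:R * (c j).2 end.

Lemma wt_opP c x : is_wt c x <-> forall k, x *m wt_op k = wt_val c k *: x.
Proof.
split=> [[h1 h2] [j|j]|h]; [exact: h1 | exact: h2 |].
by split=> j; [apply: (h (inl j)) | apply: (h (inr j))].
Qed.

Lemma wt_val_inj c c' : (forall k, wt_val c k = wt_val c' k) -> c = c'.
Proof.
move=> h; apply/ffunP => j; rewrite [c j]surjective_pairing [c' j]surjective_pairing.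
congr (_, _); last by apply: (mulfI r_neq0); apply: (h (inr j)).
have /eqP := h (inl j); rewrite /= (eq_prim_root_expr zeta_prim) !modn_small //.
by move/eqP/val_inj.
Qed.

Lemma jm_module (U : 'M[K]_d) k : mxmodule rG U -> (U *m jucys_murphy rG k <= U)%MS.
Proof.
move=> /mxmoduleP mU; rewrite mulmx_sumr; apply: summx_sub => i _.
by rewrite mulmx_sumr; apply: summx_sub => s _; apply: mU; rewrite inE.
Qed.

Lemma wt_op_module (U : 'M[K]_d) k : mxmodule rG U -> (U *m wt_op k <= U)%MS.
Proof.
by case: k => j mU; [apply: (mxmoduleP mU); rewrite inE | apply: jm_module].
Qed.

(** A nonzero summand of foreign weight is removed by applying [wt_op k] minus its eigenvalue there,
    for some [k] that separates this weight from [c0]; the wanted part is only multiplied by a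
    nonzero scalar. *)
Lemma wt_component (U : 'M[K]_d) (I : finType) (c_ : I -> wt) (x_ : I -> 'rV[K]_d) c0 :
    mxmodule rG U -> (forall a, is_wt (c_ a) (x_ a)) -> ((\sum_a x_ a)%R <= U)%MS ->
  ((\sum_(a | c_ a == c0) x_ a)%R <= U)%MS.
Proof.
move=> mU; move: {2}#|_| (leqnn #|[pred a | (c_ a != c0) && (x_ a != 0)]|) => N.
elim: N x_ => [|N IHN] x_ leN wx sU.
  rewrite (bigID (fun a => c_ a == c0)) /= [X in _ + X]big1 ?addr0 // in sU => a ca.
  move: leN; rewrite leqn0 => /eqP/card0_eq/(_ a); rewrite !inE ca /=.
  by move/negbFE/eqP.
have [a1|none] := pickP [pred a | (c_ a != c0) && (x_ a != 0)]; last first.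
  by apply: IHN => //; rewrite eq_card0.
rewrite inE => /andP[ca1 xa1].
have [k nk] : exists k, wt_val (c_ a1) k != wt_val c0 k.
  apply/existsP; rewrite -negb_forall; apply: contra ca1 => /forallP h.
  by apply/eqP/wt_val_inj => k; apply/eqP/h.
pose y_ a : 'rV[K]_d := (wt_val (c_ a) k - wt_val (c_ a1) k) *: x_ a.
have wy a : is_wt (c_ a) (y_ a) by apply: is_wtZ.
have eyx a : y_ a = x_ a *m (wt_op k - (wt_val (c_ a1) k)%:M).
  by rewrite mulmxBr (proj1 (wt_opP _ _) (wx a)) mul_mx_scalar -scalerBl.
have sy : ((\sum_a y_ a)%R <= U)%MS.
  under eq_bigr do rewrite eyx; rewrite -mulmx_suml.
  apply: submx_trans (submxMr _ sU) _; rewrite mulmxBr mul_mx_scalar.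
  by rewrite addmx_sub ?wt_op_module // eqmx_opp scalemx_sub.
have /(IHN y_) : (#|[pred a | (c_ a != c0) && (y_ a != 0%R)]| <= N)%N.
  rewrite -ltnS; apply: leq_trans leN; apply: proper_card; apply/properP; split.
    apply/subsetP => a; rewrite !inE => /andP[-> /=]; apply: contra_neq => xa.
    by rewrite /y_ xa scaler0.
  by exists a1; rewrite !inE ?ca1 //= /y_ subrr scale0r eqxx.
move/(_ wy sy); rewrite (eq_bigr (fun a => (wt_val c0 k - wt_val (c_ a1) k) *: x_ a)).
  rewrite -scaler_sumr; apply: submx_trans; rewrite -{1}[\sum_(_ | _) _]scale1r.
  rewrite -[1](@mulVf _ (wt_val c0 k - wt_val (c_ a1) k)); last by rewrite subr_eq0 eq_sym.
  by rewrite -scalerA scalemx_sub.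
by move=> a /eqP ca; rewrite /y_ ca.
Qed.

Lemma wt_extract (I : finType) (c_ : I -> wt) (x_ : I -> 'rV[K]_d) c x :
    is_wt c x -> x != 0 -> (forall a, is_wt (c_ a) (x_ a)) -> x = \sum_a x_ a ->
  exists a, c_ a = c /\ x_ a != 0.
Proof.
move=> wx x0 wx_ ex.
have [a /andP[/eqP ca xa]|none] := pickP (fun a => (c_ a == c) && (x_ a != 0)).
  by exists a.
(* Adjoining [- x] to the family makes the total 0, so that [wt_component] applies to the zero
   module. *)
pose c' (a : unit + I) := if a is inr a then c_ a else c.
pose x' (a : unit + I) := if a is inr a then x_ a else - x.
have : ((\sum_(a | c' a == c) x' a)%R <= (0 : 'M[K]_d))%MS.
  apply: wt_component; first exact: mxmodule0.
    by case=> [[]|a] //=; rewrite -scaleN1r; apply: is_wtZ.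
  by rewrite big_sumType /= big_const card_unit /= addr0 -ex addNr sub0mx.
rewrite big_sumType /= [X in _ + X]big1 => [|a ca]; last first.
  by apply/eqP/negbFE; have := none a; rewrite ca.
rewrite addr0 (eq_bigl xpredT) => [|[]]; last by rewrite eqxx.
by rewrite big_const card_unit /= addr0 submx0 oppr_eq0 (negPf x0).
Qed.

Hypothesis CS : completely_splittable rG.

Lemma diagonalizable_sq (A : 'M[K]_d) a x : diagonalizable A ->
  x *m (A - a%:M) *m (A - a%:M) = 0 -> x *m (A - a%:M) = 0.
Proof.
case=> P Pu /diagonalizable_forPex[D /(simmxRL Pu) eD].
have eA : A = invmx P *m diag_mx D *m P by rewrite eD !mulmxA mulVmx // mul1mx mulmxKV.
have eAa : A - a%:M = invmx P *m diag_mx (D - const_mx a) *m P.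
  rewrite raddfB /= diag_const_mx mulmxBr mulmxBl -eA; congr (_ - _).
  by rewrite mul_mx_scalar -scalemxAl mulVmx // scalemx1.
rewrite eAa !mulmxA mulmxK //; set y := x *m invmx P; set E := D - _.
move/(congr1 (mulmx^~ (invmx P))); rewrite mulmxK // mul0mx => e.
suff -> : y *m diag_mx E = 0 by rewrite mul0mx.
apply/rowP => j; have /rowP/(_ j) := e; rewrite !mul_mx_diag !mxE.
by move/eqP; rewrite mulf_eq0 => /orP[/eqP //|/eqP ->]; rewrite mulr0.
Qed.

(** If the two entries were equal, xi_i minus its eigenvalue would send [x *m G i] to
    [- (r%:R *: x)] and then to 0: a nontrivial Jordan block. *)
Lemma wt_adj_ne c x i : (i < n)%N -> is_wt c x -> x != 0 ->
  separated (c (o i)) (c (o i.+1)).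
Proof.
move=> i_n wx; rewrite /separated; apply: contraNT; rewrite negb_imply negbK => /andP[p12 /eqP c12].
have e1 := jm_adjl_wt i_n wx; rewrite p12 -c12 in e1.
set a := r%:R * (c (o i)).2 in e1.
have ex : x *m (jucys_murphy rG (o i) - a%:M) = 0.
  by rewrite mulmxBr (proj2 wx) mul_mx_scalar subrr.
have e2 : x *m G i *m (jucys_murphy rG (o i) - a%:M) = - (r%:R *: x).
  by rewrite mulmxBr e1 mul_mx_scalar addrAC subrr sub0r.
have /(diagonalizable_sq (CS (o i))) : x *m G i *m (jucys_murphy rG (o i) - a%:M)
    *m (jucys_murphy rG (o i) - a%:M) = 0.
  by rewrite e2 mulNmx -scalemxAl ex scaler0 oppr0.
by rewrite e2 => /eqP; rewrite oppr_eq0 scaler_eq0 (negPf r_neq0).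
Qed.

(* A weight with equal entries at i and i+2 would give a weight with equal
   adjacent entries unless both swaps kill x, in which case the braid relation
   reads e = -e for a sign e. *)
Lemma wt_skip_ne c x i : (i.+1 < n)%N -> is_wt c x -> x != 0 ->
  separated (c (o i)) (c (o i.+2)).
Proof.
move=> i_n wx x0; have i_n' := ltnW i_n.
have s1 := wt_adj_ne i_n' wx x0; have s2 := wt_adj_ne i_n wx x0.
rewrite /separated; apply: contraT; rewrite negb_imply negbK => /andP[/eqP p13 /eqP c13].
have e13 : c (o i) = c (o i.+2) by rewrite [LHS]surjective_pairing p13 c13 -surjective_pairing.
have y1 : x *m G i - alpha (c (o i)) (c (o i.+1)) *: x = 0.
  apply/eqP; apply: contraT => /(wt_adj_ne i_n (wt_swap i_n' s1 wx)).
  rewrite swap_wtR // swap_wt_out //; try lia.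
  by rewrite e13 /separated !eqxx.
have y2 : x *m G i.+1 - alpha (c (o i.+1)) (c (o i.+2)) *: x = 0.
  apply/eqP; apply: contraT => /(wt_adj_ne i_n' (wt_swap i_n s2 wx)).
  rewrite swap_wtL // swap_wt_out //; try lia.
  by rewrite e13 /separated !eqxx.
move: y1 y2; rewrite -e13 [alpha (c (o i.+1)) _]alphaC; set a := alpha _ _ => /eqP.
rewrite subr_eq0 => /eqP y1; rewrite scaleNr opprK => /eqP; rewrite addr_eq0 -scaleNr => /eqP y2.
have a2 : a ^+ 2 = 1.
  have : x *m G i *m G i = x by rewrite -mulmxA G_sq mulmx1.
  rewrite y1 -scalemxAl y1 scalerA => /eqP; rewrite -subr_eq0 -{2}[x]scale1r -scalerBl.
  by rewrite scaler_eq0 (negPf x0) orbF subr_eq0 => /eqP.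
have := congr1 (mulmx x) (adj_braid_mx rG i_n); rewrite -/(G i) -/(G i.+1) !mulmxA.
rewrite !(y1, y2, =^~ scalemxAl, scalerA) => /eqP; rewrite -subr_eq0 -scalerBl scaler_eq0 (negPf x0) orbF.
have -> : a * - a * a - - a * a * - a = - a * a ^+ 2 *+ 2 by ring.
rewrite a2 mulr1 -mulr_natr mulf_eq0 (negPf two_neq0) orbF oppr_eq0 => /eqP a0.
by move/eqP: a2; rewrite a0 expr0n /= eq_sym oner_eq0.
Qed.

(** Dividing by [beta] makes the step square to 1; where [beta] vanishes the raw step squares to 0,
    and 1 merely avoids a division by zero. *)
Definition scale_of (u v : V) := if beta u v == 0 then 1 else beta u v.

Lemma scale_of_neq0 u v : scale_of u v != 0.
Proof. by rewrite /scale_of; case: ifP => [_|/negbT //]; apply: oner_neq0. Qed.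

Lemma scale_ofC u v : scale_of v u = scale_of u v.
Proof. by rewrite /scale_of betaC. Qed.

Definition raw_step (g : 'M[K]_d) (u v : V) x := x *m g - alpha u v *: x.

Lemma raw_stepZ g u v a x : raw_step g u v (a *: x) = a *: raw_step g u v x.
Proof. by rewrite /raw_step -scalemxAl scalerA [_ * a]mulrC -scalerA -scalerBr. Qed.

Definition step_vec (g : 'M[K]_d) (u v : V) x := (scale_of u v)^-1 *: raw_step g u v x.

Lemma step_vec3 g1 g2 g3 u1 v1 u2 v2 u3 v3 x :
  step_vec g1 u1 v1 (step_vec g2 u2 v2 (step_vec g3 u3 v3 x)) =
  ((scale_of u1 v1)^-1 * (scale_of u2 v2)^-1 * (scale_of u3 v3)^-1) *:
    raw_step g1 u1 v1 (raw_step g2 u2 v2 (raw_step g3 u3 v3 x)).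
Proof. by rewrite /step_vec !raw_stepZ !scalerA mulrA. Qed.

Lemma step_vec0 g u v : step_vec g u v 0 = 0.
Proof. by rewrite /step_vec /raw_step mul0mx scaler0 subrr scaler0. Qed.

Definition wt_step i (s : wt * 'rV[K]_d) : wt * 'rV[K]_d :=
  (swap_wt i s.1, step_vec (G i) (s.1 (o i)) (s.1 (o i.+1)) s.2).

Lemma step_vec_sq i u v x :
  step_vec (G i) v u (step_vec (G i) u v x) = (if beta u v == 0 then 0 else x).
Proof.
rewrite /step_vec raw_stepZ scalerA scale_ofC /raw_step [alpha v u]alphaC.
have -> : (x *m G i - alpha u v *: x) *m G i = x - alpha u v *: (x *m G i).
  by rewrite mulmxBl -mulmxA G_sq mulmx1 -scalemxAl.
move: (x *m G i) => y; set a := alpha u v.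
have -> : x - a *: y - - a *: (y - a *: x) = (1 - a ^+ 2) *: x.
  by apply/rowP => j; rewrite !mxE; ring.
rewrite -(beta_sq sqrootK) // scalerA /scale_of; case: eqP => [->|/eqP b0].
  by rewrite expr0n mulr0 scale0r.
by rewrite -expr2 exprVn mulVf ?scale1r // expf_neq0.
Qed.

Lemma step_vec_comm i j u v u' v' x : (i.+1 < j)%N -> (j < n)%N ->
  step_vec (G i) u v (step_vec (G j) u' v' x) = step_vec (G j) u' v' (step_vec (G i) u v x).
Proof.
move=> ij jn; rewrite /step_vec !raw_stepZ !scalerA [(scale_of u v)^-1 * _]mulrC.
congr (_ *: _); rewrite /raw_step.
rewrite !mulmxBl -!scalemxAl -[x *m G j *m _]mulmxA -[x *m G i *m _]mulmxA.
rewrite (adj_commx rG ij jn).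
move: (x *m _) => y1; move: (x *m _) => y2; move: (x *m _) => y3.
by apply/rowP => k; rewrite !mxE; ring.
Qed.

Lemma step_vec_braid i u v w x : (i.+1 < n)%N ->
    separated u v -> separated v w -> separated u w ->
  step_vec (G i) v w (step_vec (G i.+1) u w (step_vec (G i) u v x)) =
  step_vec (G i.+1) u v (step_vec (G i) u w (step_vec (G i.+1) v w x)).
Proof.
move=> i_n uv vw uw; have e3 := alpha_triple uv vw uw.
rewrite !step_vec3 [_^-1 * _ * (scale_of v w)^-1]mulrC mulrA.
congr (_ *: _); first by rewrite -!mulrA [(scale_of u v)^-1 * _]mulrC.
rewrite /raw_step; move: e3; set a := alpha u v; set b := alpha u w; set c := alpha v w => e3.
rewrite !mulmxBl -!scalemxAl !mulmxBl -!scalemxAl.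
have -> : x *m G i *m G i.+1 *m G i = x *m G i.+1 *m G i *m G i.+1.
  have := congr1 (mulmx x) (adj_braid_mx rG i_n).
  by rewrite -/(G i) -/(G i.+1) !mulmxA.
rewrite -[x *m G i *m G i]mulmxA -[x *m G i.+1 *m G i.+1]mulmxA !G_sq !mulmx1.
move: (x *m _ *m _ *m _) => y1; move: (x *m _ *m _) => y2; move: (x *m _ *m _) => y3.
move: (x *m _) => y4; move: (x *m _) => y5.
apply/rowP => k; rewrite !mxE; apply/eqP; rewrite -subr_eq0.
set q := (X in X == 0).
(* After expansion everything cancels except this multiple of the identity [alpha_triple]. *)
have -> : q = (b * (a + c) - a * c) * (y4 0 k - y5 0 k) by rewrite /q; ring.
by rewrite -e3 subrr mul0r.
Qed.

Definition wt_state (s : wt * 'rV[K]_d) := is_wt s.1 s.2.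

Lemma wt_stepP i s : (i < n)%N -> wt_state s -> wt_state (wt_step i s).
Proof.
case: s => c x i_n wx; have [x0|x0] := eqVneq x 0.
  by rewrite /wt_state /= x0 step_vec0; apply: is_wt0.
by apply/is_wtZ/wt_swap => //; apply: wt_adj_ne x0.
Qed.

Lemma wt_step_system : word_system n wt_step wt_state (fun s => s.2 != 0).
Proof.
split=> [|i [c x] i_n _ /=|i [c x] i_n wx /=|i j [c x] ij jn wx|i [c x] i_n wx].
- exact: wt_stepP.
- by apply: contra_neq => ->; rewrite step_vec0.
- rewrite swap_wtL // swap_wtR // step_vec_sq /wt_step /= => nz.
  rewrite swap_wtK swap_wtL // swap_wtR // step_vec_sq; move: nz.
  by case: ifP; rewrite ?eqxx.
- rewrite /wt_step /= !(@swap_wt_out i, @swap_wt_out j); try lia.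
  rewrite step_vec_comm //; congr (_, _).
  by apply/ffunP => a; rewrite !ffunE -!permM adjC.
- rewrite /wt_step /=.
  rewrite !(swap_wtL, swap_wtR, @swap_wt_out i, @swap_wt_out i.+1); try lia.
  (* The zero vector is a state for every weight, so its weight need not be separated and the braid
     identity has to be checked directly. *)
  have [x0|x0] := eqVneq x 0.
    rewrite x0 !step_vec0; congr (_, _).
    by apply/ffunP => a; rewrite !ffunE -!permM ?mulgA adj_braid.
  rewrite step_vec_braid //.
  + by congr (_, _); apply/ffunP => a; rewrite !ffunE -!permM ?mulgA adj_braid.
  + by apply: (wt_adj_ne _ wx x0); lia.
  + by apply: (wt_adj_ne _ wx x0); lia.
  + by apply: (wt_skip_ne _ wx x0); lia.
Qed.

End Module.
End Weights.

Lemma mul_neq0_l (K : fieldType) (x y : K) : x * y != 0 -> x != 0.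
Proof. by apply: contra_neq => ->; rewrite mul0r. Qed.

Lemma mul_neq0_r (K : fieldType) (x y : K) : x * y != 0 -> y != 0.
Proof. by apply: contra_neq => ->; rewrite mulr0. Qed.

(** The actions on [v1], [v2], [v12], [v21] that could involve a filling which is not p-standard are
    assumed only after multiplication by the coefficient with which that vector is reached; where
    the filling leaves the set, the coefficient is 0 and the equation is trivial. *)
Lemma young_braid (K : fieldType) d (G1 G2 : 'M[K]_d) (v0 v1 v2 v12 v21 v121 : 'rV[K]_d) (a b c x y m : K) :
    a * c = b * (a + c) -> x ^+ 2 = 1 - a ^+ 2 -> y ^+ 2 = 1 - c ^+ 2 ->
    v0 *m G1 = a *: v0 + x *: v1 -> v0 *m G2 = c *: v0 + y *: v2 ->
    x *: (v1 *m G1) = x *: (- a *: v1 + x *: v0) -> x *: (v1 *m G2) = x *: (b *: v1 + m *: v12) ->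
    y *: (v2 *m G1) = y *: (b *: v2 + m *: v21) -> y *: (v2 *m G2) = y *: (- c *: v2 + y *: v0) ->
    (x * m) *: (v12 *m G1) = (x * m) *: (c *: v12 + y *: v121) ->
    (y * m) *: (v21 *m G2) = (y * m) *: (a *: v21 + x *: v121) ->
  v0 *m G1 *m G2 *m G1 = v0 *m G2 *m G1 *m G2.
Proof.
move=> e3 ex ey A0 B0 A1 B1 A2 B2 A12 B21.
have L : v0 *m G1 *m G2 = a *: (c *: v0 + y *: v2) + x *: (b *: v1 + m *: v12).
  by rewrite A0 mulmxDl -!scalemxAl B0 B1.
have R : v0 *m G2 *m G1 = c *: (a *: v0 + x *: v1) + y *: (b *: v2 + m *: v21).
  by rewrite B0 mulmxDl -!scalemxAl A0 A2.
rewrite L R !mulmxDl -!scalemxAl !mulmxDl -!scalemxAl A0 B0 A2 B1.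
move: A1 B2 A12 B21 {A0 B0 B1 A2 L R}.
move: (v1 *m G1) (v2 *m G2) (v12 *m G1) (v21 *m G2) => w1 w4 w5 w6 h1 h4 h5 h6.
apply/rowP => j; move/rowP/(_ j): h1; move/rowP/(_ j): h4; move/rowP/(_ j): h5; move/rowP/(_ j): h6.
rewrite !mxE; move: (v0 0 j) (v1 0 j) (v2 0 j) (v12 0 j) (v21 0 j) (v121 0 j) (w1 0 j) (w4 0 j) (w5 0 j) (w6 0 j).
move=> {v0 v1 v2 v12 v21 v121 w1 w4 w5 w6} v0 v1 v2 v12 v21 v121 w1 w4 w5 w6 h6 h5 h4 h1.
apply/eqP; rewrite -subr_eq0; apply/eqP.
set z := (X in X = _).
(* An explicit linear combination of the hypotheses, each written as left side minus right side. *)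
have -> : z = b * v0 * (x ^+ 2 - (1 - a ^+ 2)) - b * v0 * (y ^+ 2 - (1 - c ^+ 2))
   + (a * c - b * (a + c)) * ((a - c) * v0 + x * v1 - y * v2)
   + b * (x * w1 - x * (- a * v1 + x * v0)) - b * (y * w4 - y * (- c * v2 + y * v0))
   + (x * m * w5 - x * m * (c * v12 + y * v121)) - (y * m * w6 - y * m * (a * v21 + x * v121)).
  by rewrite /z; ring.
by rewrite h1 h4 h5 h6 ex ey e3 !subrr; ring.
Qed.

(** * Young's orthogonal form in characteristic p *)

Section SplittableModule.
Variables (K : fieldType) (p r n : nat) (sqroot : K -> K).
Hypothesis pK : p \in [pchar K].
Hypothesis p_gt2 : (2 < p)%N.
Hypothesis sqrootK : forall x : K, sqroot x ^+ 2 = x.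

Local Notation wt := {ffun 'I_n.+1 -> 'I_r * K}.
Local Notation o i := (inord i : 'I_n.+1).
Local Notation beta := (@beta K r sqroot).

Definition swap_at i (t : filling r n.+1) := swap_entries (o i) (o i.+1) t.

Definition tab_wt (t : filling r n.+1) : wt := [ffun a => (box_comp t a, content K t a)].

Lemma tab_wt_swap i t : tab_wt (swap_at i t) = swap_wt i (tab_wt t).
Proof. by apply/ffunP => a; rewrite !ffunE /box_comp /content /box_col /box_row !ffunE. Qed.

Lemma swap_atK i t : swap_at i (swap_at i t) = t.
Proof. by apply/ffunP => a; rewrite !ffunE tpermK. Qed.

Definition tab_alpha i t := alpha (tab_wt t (o i)) (tab_wt t (o i.+1)).
Definition tab_beta i t := beta (tab_wt t (o i)) (tab_wt t (o i.+1)).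

Variable l : r.-tuple (seq nat).
Hypothesis l_spl : r_splittable_shape p n.+1 l.

Local Notation T := (p_standard_tableaux n.+1 p l).
Implicit Types t : filling r n.+1.

Lemma tab_separated t (a b : 'I_n.+1) : t \in T -> (a < b < a.+3)%N ->
  separated (tab_wt t a) (tab_wt t b).
Proof.
move=> tT ab; rewrite /separated !ffunE /=; apply/implyP => /eqP ec; apply/eqP => eK.
have := tab_same_content pK p_gt2 l_spl tT _ ec eK; lia.
Qed.

Lemma tab_wt_sep t i : t \in T -> (i < n)%N ->
  separated (tab_wt t (o i)) (tab_wt t (o i.+1)).
Proof. by move=> tT i_n; apply: tab_separated => //; rewrite !inordK; lia. Qed.

Lemma tab_wt_sep2 t i : t \in T -> (i.+1 < n)%N ->
  separated (tab_wt t (o i)) (tab_wt t (o i.+2)).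
Proof. by move=> tT i_n; apply: tab_separated => //; rewrite !inordK; lia. Qed.

Lemma tab_swap_in t i : t \in T -> (i < n)%N -> tab_beta i t != 0 -> swap_at i t \in T.
Proof.
move=> tT i_n b0; apply: (tab_swap pK p_gt2 l_spl tT); first by rewrite !inordK; lia.
move=> ec; split; apply: contra b0 => /eqP e.
all: have := beta_sq sqrootK (tab_wt t (o i)) (tab_wt t (o i.+1)).
all: rewrite -/(tab_beta i t) {1}/alpha !ffunE /= ec eqxx e ?invrN ?sqrrN invr1 expr1n subrr => /eqP.
all: by rewrite sqrf_eq0.
Qed.

Lemma tab_beta_eq0 t i : box_comp t (o i) = box_comp t (o i.+1) -> tab_beta i t = 0 ->
  content K t (o i.+1) - content K t (o i) = 1 \/
  content K t (o i.+1) - content K t (o i) = - 1.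
Proof.
move=> ec /beta_eq0; rewrite !ffunE /= => /(_ sqrootK ec) [] ->; [left|right]; ring.
Qed.

(** Defined for every filling and zero off [T], so that the orthogonal form can be written without
    case distinctions. *)
Definition tab_vec t : 'rV[K]_#|T| := \row_j (enum_val j == t)%:R.

Lemma tab_vec_out t : t \notin T -> tab_vec t = 0.
Proof.
move=> tT; apply/rowP => j; rewrite !mxE; case: eqP => // e.
by rewrite -e enum_valP in tT.
Qed.

Lemma tab_vec_enum (a : 'I_#|T|) : tab_vec (enum_val a) = delta_mx 0 a.
Proof. by apply/rowP => j; rewrite !mxE eqxx /= (inj_eq enum_val_inj). Qed.

Lemma tab_enum t : t \in T -> exists a : 'I_#|T|, enum_val a = t.
Proof. by move=> tT; exists (enum_rank_in tT t); rewrite enum_rankK_in. Qed.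

Lemma tab_vec_neq0 t : t \in T -> tab_vec t != 0.
Proof.
case/tab_enum => a <-; rewrite tab_vec_enum; apply/eqP => /rowP/(_ a)/eqP.
by rewrite !mxE !eqxx oner_eq0.
Qed.

Lemma tab_vec_ext q (A B : 'M[K]_(#|T|, q)) :
  (forall t, t \in T -> tab_vec t *m A = tab_vec t *m B) -> A = B.
Proof.
move=> h; apply/row_matrixP => a; rewrite !rowE -tab_vec_enum; apply: h.
exact: enum_valP.
Qed.

Definition gen_mx i : 'M[K]_#|T| :=
  \matrix_(a, b) (tab_alpha i (enum_val a) *: tab_vec (enum_val a)
                  + tab_beta i (enum_val a) *: tab_vec (swap_at i (enum_val a))) 0 b.

Lemma gen_mxE t i : t \in T ->
  tab_vec t *m gen_mx i = tab_alpha i t *: tab_vec t + tab_beta i t *: tab_vec (swap_at i t).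
Proof.
case/tab_enum => a <-; rewrite tab_vec_enum -rowE.
by apply/rowP => b; rewrite mxE mxE tab_vec_enum.
Qed.

Lemma gen_mxZ (k : K) t i : (k != 0 -> t \in T) ->
  k *: (tab_vec t *m gen_mx i) = k *: (tab_alpha i t *: tab_vec t + tab_beta i t *: tab_vec (swap_at i t)).
Proof.
by have [->|k0] := eqVneq k 0; [rewrite !scale0r | move=> /(_ isT)/gen_mxE ->].
Qed.

Lemma tab_alpha_swap i t : (i < n)%N -> tab_alpha i (swap_at i t) = - tab_alpha i t.
Proof. by move=> i_n; rewrite /tab_alpha tab_wt_swap swap_wtL // swap_wtR // alphaC. Qed.

Lemma tab_beta_swap i t : (i < n)%N -> tab_beta i (swap_at i t) = tab_beta i t.
Proof. by move=> i_n; rewrite /tab_beta tab_wt_swap swap_wtL // swap_wtR // betaC. Qed.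

Lemma gen_mx_sq i : (i < n)%N -> gen_mx i *m gen_mx i = 1%:M.
Proof.
move=> i_n; apply: tab_vec_ext => t tT; rewrite mulmx1 mulmxA gen_mxE // mulmxDl -!scalemxAl.
rewrite gen_mxE // [tab_beta i t *: (_ *m _)]gen_mxZ; last exact: tab_swap_in.
rewrite tab_alpha_swap // tab_beta_swap // swap_atK.
transitivity ((tab_alpha i t ^+ 2 + tab_beta i t ^+ 2) *: tab_vec t).
  move: (tab_vec _) (tab_vec _) => x y; apply/rowP => j; rewrite !mxE; ring.
by rewrite /tab_beta beta_sq // addrC subrK scale1r.
Qed.

Lemma tab_wt_far i j t : (i.+1 < j)%N -> (j < n)%N ->
  [/\ tab_alpha i (swap_at j t) = tab_alpha i t, tab_beta i (swap_at j t) = tab_beta i t,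
      tab_alpha j (swap_at i t) = tab_alpha j t & tab_beta j (swap_at i t) = tab_beta j t].
Proof.
move=> ij jn; rewrite /tab_alpha /tab_beta !tab_wt_swap.
by rewrite !(@swap_wt_out K r n i, @swap_wt_out K r n j); try lia.
Qed.

Lemma swap_atC i j t : (i.+1 < j)%N -> (j < n)%N ->
  swap_at i (swap_at j t) = swap_at j (swap_at i t).
Proof. by move=> ij jn; apply/ffunP => a; rewrite !ffunE -!permM -/(adj n i) -/(adj n j) adjC. Qed.

Lemma gen_mx_comm i j : (i.+1 < j)%N -> (j < n)%N ->
  gen_mx i *m gen_mx j = gen_mx j *m gen_mx i.
Proof.
move=> ij jn; have i_n : (i < n)%N by lia.
apply: tab_vec_ext => t tT; rewrite !mulmxA !(gen_mxE _ tT) !mulmxDl -!scalemxAl !(gen_mxE _ tT).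
rewrite (@gen_mxZ (tab_beta i t) (swap_at i t)); last exact: tab_swap_in.
rewrite (@gen_mxZ (tab_beta j t) (swap_at j t)); last exact: tab_swap_in.
have [-> -> -> ->] := tab_wt_far t ij jn; rewrite (swap_atC t ij jn).
move: (tab_vec _) (tab_vec _) (tab_vec _) (tab_vec _) => x y z w.
by apply/rowP => k; rewrite !mxE; ring.
Qed.

Lemma swap_at_braid i t : (i.+1 < n)%N ->
  swap_at i (swap_at i.+1 (swap_at i t)) = swap_at i.+1 (swap_at i (swap_at i.+1 t)).
Proof.
move=> i_n; apply/ffunP => a; rewrite !ffunE -!permM -/(adj n i) -/(adj n i.+1) ?mulgA.
by rewrite adj_braid.
Qed.

Lemma gen_mx_braid i : (i.+1 < n)%N ->
  gen_mx i *m gen_mx i.+1 *m gen_mx i = gen_mx i.+1 *m gen_mx i *m gen_mx i.+1.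
Proof.
move=> i_n; have i_n' : (i < n)%N by lia.
apply: tab_vec_ext => t tT; rewrite !mulmxA.
set u := tab_wt t (o i); set v := tab_wt t (o i.+1); set w := tab_wt t (o i.+2).
have e3 : alpha u v * alpha v w = alpha u w * (alpha u v + alpha v w).
  by apply: alpha_triple; [apply: tab_wt_sep | apply: tab_wt_sep | apply: tab_wt_sep2].
have al1 : tab_alpha i t = alpha u v by [].
have al2 : tab_alpha i.+1 t = alpha v w by [].
have be1 : tab_beta i t = beta u v by [].
have be2 : tab_beta i.+1 t = beta v w by [].
have sw := (tab_alpha_swap, tab_beta_swap, @tab_wt_swap).
have out := (@swap_wtL K r n, @swap_wtR K r n, @swap_wt_out K r n i, @swap_wt_out K r n i.+1).
have al12 : tab_alpha i.+1 (swap_at i t) = alpha u w.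
  by rewrite /tab_alpha tab_wt_swap !out //; lia.
have be12 : tab_beta i.+1 (swap_at i t) = beta u w.
  by rewrite /tab_beta tab_wt_swap !out //; lia.
have al21 : tab_alpha i (swap_at i.+1 t) = alpha u w.
  by rewrite /tab_alpha tab_wt_swap !out //; lia.
have be21 : tab_beta i (swap_at i.+1 t) = beta u w.
  by rewrite /tab_beta tab_wt_swap !out //; lia.
have al121 : tab_alpha i (swap_at i.+1 (swap_at i t)) = alpha v w.
  by rewrite /tab_alpha !tab_wt_swap !out //; lia.
have be121 : tab_beta i (swap_at i.+1 (swap_at i t)) = beta v w.
  by rewrite /tab_beta !tab_wt_swap !out //; lia.
have al212 : tab_alpha i.+1 (swap_at i (swap_at i.+1 t)) = alpha u v.
  by rewrite /tab_alpha !tab_wt_swap !out //; lia.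
have be212 : tab_beta i.+1 (swap_at i (swap_at i.+1 t)) = beta u v.
  by rewrite /tab_beta !tab_wt_swap !out //; lia.
have T1 : tab_beta i t != 0 -> swap_at i t \in T by apply: tab_swap_in.
have T2 : tab_beta i.+1 t != 0 -> swap_at i.+1 t \in T by apply: tab_swap_in.
have T12 : tab_beta i t * beta u w != 0 -> swap_at i.+1 (swap_at i t) \in T.
  by move=> h; apply: tab_swap_in (T1 (mul_neq0_l h)) _ _; rewrite ?be12 ?(mul_neq0_r h).
have T21 : tab_beta i.+1 t * beta u w != 0 -> swap_at i (swap_at i.+1 t) \in T.
  by move=> h; apply: tab_swap_in (T2 (mul_neq0_l h)) _ _; rewrite ?be21 ?(mul_neq0_r h).
rewrite be1 in T1 T12; rewrite be2 in T2 T21.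
apply: (@young_braid _ _ (gen_mx i) (gen_mx i.+1) (tab_vec t) (tab_vec (swap_at i t))
  (tab_vec (swap_at i.+1 t)) (tab_vec (swap_at i.+1 (swap_at i t)))
  (tab_vec (swap_at i (swap_at i.+1 t)))
  (tab_vec (swap_at i (swap_at i.+1 (swap_at i t)))) _ _ _ (beta u v) (beta v w) (beta u w) e3).
- exact: beta_sq.
- exact: beta_sq.
- exact: gen_mxE.
- exact: gen_mxE.
- by rewrite gen_mxZ // tab_alpha_swap // tab_beta_swap // swap_atK.
- by rewrite gen_mxZ // al12 be12.
- by rewrite gen_mxZ // al21 be21.
- by rewrite gen_mxZ // tab_alpha_swap // tab_beta_swap // swap_atK.
- by rewrite gen_mxZ // al121 be121.
- by rewrite gen_mxZ // al212 be212 swap_at_braid.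
Qed.

Variable zeta : K.
Hypothesis zeta_prim : r.-primitive_root zeta.
Hypothesis r_neq0 : r%:R != 0 :> K.
Local Notation is_wt := (@is_wt K r n zeta).

Let r_gt0 : (0 < r)%N. Proof. exact: prim_order_gt0 zeta_prim. Qed.

Definition base_val (x : wr_base r n.+1) t : K :=
  \prod_(j < n.+1) (zeta ^+ box_comp t j) ^+ (x j).

Definition base_mx (x : wr_base r n.+1) : 'M[K]_#|T| :=
  diag_mx (\row_a base_val x (enum_val a)).

Lemma base_mxE x t : t \in T -> tab_vec t *m base_mx x = base_val x t *: tab_vec t.
Proof.
case/tab_enum => a <-; apply/rowP => b; rewrite mul_mx_diag !mxE mulrC.
by case: eqP => [->//|_]; rewrite !mulr0.
Qed.

Lemma zeta_expX (c : 'I_r) : (zeta ^+ c) ^+ r = 1.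
Proof. by rewrite exprAC (prim_expr_order zeta_prim) expr1n. Qed.

Lemma zeta_exp_mod (c : 'I_r) m : (zeta ^+ c) ^+ (m %% r.-1.+1) = (zeta ^+ c) ^+ m.
Proof. by rewrite prednK // expr_mod // zeta_expX. Qed.

Lemma base_val1 t : base_val 1%g t = 1.
Proof. by rewrite /base_val big1 // => j _; rewrite ffunE. Qed.

Lemma base_valM x y t : base_val (x * y)%g t = base_val x t * base_val y t.
Proof.
rewrite /base_val -big_split; apply: eq_bigr => j _; rewrite ffunE /=.
by rewrite zeta_exp_mod exprD.
Qed.

Lemma base_mx1 : base_mx 1%g = 1%:M.
Proof. by apply: tab_vec_ext => t tT; rewrite base_mxE // base_val1 scale1r mulmx1. Qed.

Lemma base_mxM x y : base_mx (x * y)%g = base_mx x *m base_mx y.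
Proof.
apply: tab_vec_ext => t tT; rewrite mulmxA !base_mxE // -scalemxAl base_mxE //.
by rewrite scalerA base_valM.
Qed.

Lemma base_vtab_alpha_swap x i t :
  base_val (wr_act_fun x (adj n i)) (swap_at i t) = base_val x t.
Proof.
rewrite /base_val (reindex_inj (@perm_inj _ (adj n i))) /=; apply: eq_bigr => j _.
by rewrite ffunE permK /box_comp ffunE tpermK.
Qed.

Lemma base_val_act x i t : box_comp t (o i) = box_comp t (o i.+1) ->
  base_val (wr_act_fun x (adj n i)) t = base_val x t.
Proof.
move=> e; rewrite -[RHS](base_vtab_alpha_swap x i); apply: eq_bigr => j _; congr ((_ ^+ _) ^+ _).
rewrite /box_comp in e; rewrite /swap_at /box_comp ffunE.
by case: tpermP => [->|->|//]; rewrite e.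
Qed.

Lemma base_gen_mx x i : (i < n)%N ->
  base_mx x *m gen_mx i = gen_mx i *m base_mx (wr_act_fun x (adj n i)).
Proof.
move=> i_n; apply: tab_vec_ext => t tT.
rewrite !mulmxA base_mxE // -scalemxAl (gen_mxE _ tT) mulmxDl -!scalemxAl base_mxE //.
have -> : tab_beta i t *: (tab_vec (swap_at i t) *m base_mx (wr_act_fun x (adj n i))) =
    tab_beta i t *: (base_val x t *: tab_vec (swap_at i t)).
  have [->|b0] := eqVneq (tab_beta i t) 0; first by rewrite !scale0r.
  by rewrite base_mxE ?base_vtab_alpha_swap //; apply: tab_swap_in.
rewrite scalerDr !scalerA [base_val x t * tab_beta i t]mulrC; congr (_ + _).
have [e|ne] := eqVneq (box_comp t (o i)) (box_comp t (o i.+1)).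
  by rewrite base_val_act // mulrC.
by rewrite /tab_alpha /alpha !ffunE /= (negPf ne) mulr0 mul0r.
Qed.

Definition spl_repr : wr_repr K r n.+1 #|T| :=
  wreath_repr gen_mx_sq gen_mx_comm gen_mx_braid base_mx1 base_mxM base_gen_mx.

Lemma spl_repr_g i t : (i < n)%N -> t \in T ->
  tab_vec t *m spl_repr (wr_s r (adj n i)) = tab_alpha i t *: tab_vec t + tab_beta i t *: tab_vec (swap_at i t).
Proof. by move=> i_n tT; rewrite wreath_reprE_s // gen_mxE. Qed.

Lemma spl_repr_t j t : t \in T ->
  tab_vec t *m spl_repr (wr_t r j) = zeta ^+ box_comp t j *: tab_vec t.
Proof.
move=> tT; rewrite wreath_reprE_base base_mxE //; congr (_ *: _).
rewrite /base_val (bigD1 j) //= big1 => [|k kj]; rewrite ffunE ?eqxx.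
  by rewrite mulr1 /= zeta_exp_mod expr1.
by rewrite (negPf kj) /= mod0n expr0.
Qed.

(** Induction on k for all tableaux at once, through xi_{k+1} = g_k (xi_k g_k + [jm_pair]): the
    hypothesis is needed for [t] and for its swap. The base case holds because the entry 1 sits in a
    corner box, of content 0. *)
Lemma tab_vec_wt t : is_wt spl_repr (tab_wt t) (tab_vec t).
Proof.
have [tT|/tab_vec_out ->] := boolP (t \in T); last exact: is_wt0.
split=> [j|k]; first by rewrite ffunE /= spl_repr_t.
have -> : k = o k by apply/val_inj; rewrite /= inordK.
move: (nat_of_ord k) (ltn_ord k) => {}k kn; elim: k kn t tT => [|k IHk] kn t tT.
  have -> : o 0 = ord0 by apply/val_inj; rewrite /= inordK.
  have [r0 c0] := tab_first l_spl tT (a := ord0) erefl.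
  by rewrite jm_ord0 mulmx0 ffunE /content r0 c0 subrr mulr0 scale0r.
have k_n : (k < n)%N by lia.
set g := spl_repr (wr_s r (adj n k)).
have gg : g *m g = 1%:M by apply: adj_sq_mx.
have adjr : g *m jucys_murphy spl_repr (o k.+1) =
  jucys_murphy spl_repr (o k) *m g + jm_pair spl_repr (o k.+1) (o k) by exact: jm_adjr.
have vg : tab_vec t *m g = tab_alpha k t *: tab_vec t + tab_beta k t *: tab_vec (swap_at k t).
  exact: spl_repr_g.
clearbody g.
have -> : tab_vec t *m jucys_murphy spl_repr (o k.+1) = tab_vec t *m g *m (g *m jucys_murphy spl_repr (o k.+1)).
  by rewrite mulmxA -[_ *m g *m g]mulmxA gg mulmx1.
rewrite adjr mulmxDr mulmxA.
set dl := if box_comp t (o k) == box_comp t (o k.+1) then r%:R else 0 : K.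
have pair_t : tab_vec t *m jm_pair spl_repr (o k.+1) (o k) = dl *: tab_vec t.
  rewrite (wt_pair zeta_prim (c := tab_wt t)) => [|j]; last by rewrite ffunE spl_repr_t.
  by rewrite !ffunE /= eq_sym.
have pair_t' : tab_beta k t *: (tab_vec (swap_at k t) *m jm_pair spl_repr (o k.+1) (o k)) =
    tab_beta k t *: (dl *: tab_vec (swap_at k t)).
  have [->|b0] := eqVneq (tab_beta k t) 0; first by rewrite !scale0r.
  rewrite (wt_pair zeta_prim (c := tab_wt (swap_at k t))) => [|j]; last first.
    by rewrite ffunE spl_repr_t //; apply: tab_swap_in.
  by rewrite tab_wt_swap swap_wtL // swap_wtR // !ffunE.
have jm_t : tab_vec t *m jucys_murphy spl_repr (o k) = (r%:R * content K t (o k)) *: tab_vec t.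
  by rewrite IHk ?ffunE //; lia.
have jm_t' : tab_beta k t *: (tab_vec (swap_at k t) *m jucys_murphy spl_repr (o k)) =
    tab_beta k t *: ((r%:R * content K t (o k.+1)) *: tab_vec (swap_at k t)).
  have [->|b0] := eqVneq (tab_beta k t) 0; first by rewrite !scale0r.
  rewrite IHk; [|lia|exact: tab_swap_in].
  by rewrite tab_wt_swap swap_wtL // ffunE.
have -> : tab_vec t *m g *m jm_pair spl_repr (o k.+1) (o k) = dl *: (tab_vec t *m g).
  by rewrite vg mulmxDl -!scalemxAl pair_t pair_t' scalerDr !scalerA ![dl * _]mulrC.
have ad : tab_alpha k t * (content K t (o k.+1) - content K t (o k)) * r%:R = dl.
  have := tab_wt_sep tT k_n; rewrite /tab_alpha /alpha /dl /separated !ffunE /=.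
  case: eqP => [_ /= ne|_ _]; last by rewrite !mul0r.
  by rewrite mulVf ?mul1r // subr_eq0 eq_sym.
have -> : tab_vec t *m g *m jucys_murphy spl_repr (o k) =
   (r%:R * content K t (o k.+1)) *: (tab_vec t *m g) - dl *: tab_vec t.
  rewrite vg mulmxDl -!scalemxAl jm_t jm_t' -ad.
  move: (tab_vec t) (tab_vec _) => x y; apply/rowP => j; rewrite !mxE; ring.
rewrite mulmxBl -!scalemxAl -[_ *m g *m g]mulmxA gg mulmx1 subrK.
by rewrite !ffunE.
Qed.

Lemma spl_repr_cs : completely_splittable spl_repr.
Proof.
move=> k; suff -> : jucys_murphy spl_repr k =
    diag_mx (\row_a (r%:R * content K (enum_val a) k)) by apply: diagonalizable_diag.
apply: tab_vec_ext => t tT; rewrite (proj2 (tab_vec_wt t)) ffunE /=.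
case/tab_enum: tT => a <-; apply/rowP => b; rewrite mul_mx_diag !mxE mulrC.
by case: eqP => [->//|_]; rewrite !mul0r.
Qed.

Lemma row_tab_vec (u : 'rV[K]_#|T|) : u = \sum_a u 0 a *: tab_vec (enum_val a).
Proof. by rewrite {1}[u]row_sum_delta; apply: eq_bigr => a _; rewrite tab_vec_enum. Qed.

Lemma tab_wt_inj t u : t \in T -> u \in T -> tab_wt t = tab_wt u -> t = u.
Proof.
move=> tT uT /ffunP e; apply: (tab_unique_boxes pK p_gt2 l_spl l_spl tT uT) => a.
  by have := e a; rewrite !ffunE => -[].
by have := e a; rewrite !ffunE => -[].
Qed.

(** Distinct tableaux have distinct weights, so a submodule contains every basis vector occurring in
    one of its elements. An admissible swap has nonzero [beta], so the generator then yields the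
    swapped basis vector. *)
Lemma spl_repr_irr : mx_irreducible spl_repr.
Proof.
apply/mx_irrP; split.
  have [t tT] := tab_exists pK p_gt2 l_spl (ltn0Sn n).
  by apply/card_gt0P; exists t.
move=> U mU U0; have [i Ui] : exists i, row i U != 0.
  apply/existsP; rewrite -negb_forall; apply: contra U0 => /forallP h.
  by apply/eqP/row_matrixP => i; rewrite row0; apply/eqP/h.
set u := row i U in Ui; have uU : (u <= U)%MS by apply: row_sub.
have [a ua] : exists a, u 0 a != 0.
  apply/existsP; rewrite -negb_forall; apply: contra Ui => /forallP h.
  by apply/eqP/rowP => a; rewrite [RHS]mxE; apply/eqP/h.
have t0T : enum_val a \in T by apply: enum_valP.
have t0U : (tab_vec (enum_val a) <= U)%MS.
  have := wt_component zeta_prim r_neq0 (c_ := fun b : 'I_#|T| => tab_wt (enum_val b))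
    (x_ := fun b => u 0 b *: tab_vec (enum_val b)) (tab_wt (enum_val a)) mU.
  rewrite -row_tab_vec => /(_ (fun b => is_wtZ _ (tab_vec_wt _)) uU).
  rewrite (big_pred1 a) => [|b].
    by rewrite eqmx_scale.
  apply/eqP/eqP => [|-> //] e; apply: enum_val_inj.
  by apply: tab_wt_inj => //; apply: enum_valP.
have allU t : t \in T -> (tab_vec t <= U)%MS.
  move=> tT; apply: (tab_connected pK p_gt2 l_spl (Q := fun t => (tab_vec t <= U)%MS) _ tT t0T t0U).
  move=> {a ua t0T t0U} s j j1 {t}tT tU ej adm.
  have j_n : (j < n)%N by have := ltn_ord j1; rewrite ej ltnS.
  have e1 : j = o j by apply/val_inj; rewrite /= inordK.
  have e2 : j1 = o j.+1 by apply/val_inj; rewrite /= inordK.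
  have -> : swap_entries j j1 s = swap_at j s by rewrite e2 {1}e1.
  have b0 : tab_beta j s != 0.
    apply/eqP => b0; have [ec|ne] := eqVneq (box_comp s j) (box_comp s j1); last first.
      by move/eqP: b0; rewrite /tab_beta /beta !ffunE /= -e1 -e2 (negPf ne) oner_eq0.
    have [n1 n2] := adm ec; rewrite e1 e2 in ec n1 n2.
    by case: (tab_beta_eq0 ec b0) => h; rewrite h eqxx in n1 n2.
  rewrite -(eqmx_scale _ b0).
  have -> : tab_beta j s *: tab_vec (swap_at j s) =
      tab_vec s *m spl_repr (wr_s r (adj n j)) - tab_alpha j s *: tab_vec s.
    by rewrite spl_repr_g // addrAC subrr add0r.
  rewrite addmx_sub // ?eqmx_opp ?scalemx_sub //.
  by apply: submx_trans (submxMr _ tU) _; apply: (mxmoduleP mU); rewrite inE.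
rewrite -sub1mx; apply/row_subP => b; rewrite rowE mulmx1 -tab_vec_enum.
by apply: allU; apply: enum_valP.
Qed.

End SplittableModule.

(** * Completely splittable simple modules *)

(** On each fibre of [c] the permutation is an increasing bijection of a finite chain. *)
Lemma monotone_fibres_id (m : nat) (V : eqType) (c : 'I_m -> V) (s : {perm 'I_m}) :
    (forall a, c (s a) = c a) ->
    (forall a b : 'I_m, (a < b)%N -> c a = c b -> (s a < s b)%N) -> s = 1%g.
Proof.
move=> cs mono; apply/permP => a; rewrite perm1.
suff H N (b : 'I_m) : (b < N)%N -> s b = b by apply: (H m).
elim: N b => // N IHN {}a aN; apply/eqP; apply: contraT => sa.
have lt : (a < s a)%N.
  have [//|lt|/val_inj e] := ltngtP a (s a); last by rewrite -e eqxx in sa.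
  have /perm_inj e := IHN (s a) ltac:(lia); by rewrite e ltnn in lt.
pose b := s^-1%g a; have sb : s b = a by rewrite permKV.
have cb : c b = c a by rewrite -sb cs.
have [ba|ab|/val_inj e] := ltngtP b a.
- by have := IHN b ltac:(lia); rewrite sb => e; move: ba; rewrite -e ltnn.
- by have := mono a b ab (esym cb); rewrite sb; lia.
- by move: sa; rewrite -{1}e sb eqxx.
Qed.

Lemma adj_lt (i a b : nat) : (a < b)%N -> ~ (a = i /\ b = i.+1) ->
  ((if a == i then i.+1 else if a == i.+1 then i else a) <
   (if b == i then i.+1 else if b == i.+1 then i else b))%N.
Proof. by do ![case: eqP => ?]; lia. Qed.

Section Exhaustion.
Variables (K : fieldType) (p r n : nat) (zeta : K) (sqroot : K -> K).
Hypothesis pK : p \in [pchar K].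
Hypothesis p_gt2 : (2 < p)%N.
Hypothesis sqrootK : forall x : K, sqroot x ^+ 2 = x.
Hypothesis zeta_prim : r.-primitive_root zeta.
Hypothesis r_neq0 : r%:R != 0 :> K.

Let two_neq0 : 2%:R != 0 :> K.
Proof. by rewrite -(dvdn_pcharf pK); apply/negP => /dvdn_leq; lia. Qed.

Let r_gt0 : (0 < r)%N. Proof. exact: prim_order_gt0 zeta_prim. Qed.

Local Notation wt := {ffun 'I_n.+1 -> 'I_r * K}.
Local Notation o i := (inord i : 'I_n.+1).
Local Notation beta := (@beta K r sqroot).

Variables (d : nat) (rG : wr_repr K r n.+1 d).
Hypothesis CS : completely_splittable rG.

Let G i := rG (wr_s r (adj n i)).
Local Notation is_wt := (@is_wt K r n zeta d rG).
Local Notation step := (@wt_step K r n sqroot d rG).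
Let WS := wt_step_system sqrootK zeta_prim r_neq0 two_neq0 CS.
Implicit Types (c : wt) (x : 'rV[K]_d).

Lemma beta_comp (u v : 'I_r * K) : beta u v = 0 ->
  u.1 = v.1 /\ (v.2 = u.2 + 1 \/ v.2 = u.2 - 1).
Proof.
move=> b0; have [e|ne] := eqVneq u.1 v.1; first by split=> //; apply: beta_eq0 b0.
by move/eqP: b0; rewrite /beta (negPf ne) oner_eq0.
Qed.

Definition occurs c := exists2 x, x != 0 & is_wt c x.

Lemma occurs_swap c i : (i < n)%N -> beta (c (o i)) (c (o i.+1)) != 0 -> occurs c ->
  occurs (swap_wt i c).
Proof.
move=> i_n b0 [x x0 wx]; exists (step i (c, x)).2; last exact: (ws_stable WS i_n (x := (c, x)) wx).
apply: contra_neq x0 => s0; have := step_vec_sq sqrootK rG i (c (o i)) (c (o i.+1)) x.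
by rewrite (negPf b0) -[step_vec _ _ (c (o i)) _ _]/(step i (c, x)).2 s0 step_vec0.
Qed.

Lemma occurs_adj c i : (i < n)%N -> occurs c -> separated (c (o i)) (c (o i.+1)).
Proof. by move=> i_n [x x0 wx]; apply: (wt_adj_ne zeta_prim r_neq0 CS i_n wx x0). Qed.

Lemma occurs_skip c i : (i.+1 < n)%N -> occurs c -> separated (c (o i)) (c (o i.+2)).
Proof. by move=> i_n [x x0 wx]; apply: (wt_skip_ne zeta_prim r_neq0 two_neq0 CS i_n wx x0). Qed.

Lemma occurs_first c : occurs c -> (c (o 0)).2 = 0.
Proof.
case=> x x0 wx; have -> : o 0 = ord0 by apply/val_inj; rewrite /= inordK.
have := proj2 wx ord0; rewrite jm_ord0 mulmx0 => /esym/eqP.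
by rewrite scaler_eq0 (negPf x0) orbF mulf_eq0 (negPf r_neq0) => /eqP.
Qed.

(** Induction on the distance. If an end of the interval can be swapped inwards with nonzero [beta],
    the interval shrinks. Otherwise both inner neighbours of the ends have residues differing by 1
    or -1 from the common one. *)
Lemma occurs_between N i j c : (j - i <= N)%N -> (i < j <= n)%N -> occurs c ->
    c (o i) = c (o j) ->
  (exists a, (i < a < j)%N /\ c (o a) = ((c (o i)).1, (c (o i)).2 + 1)) /\
  (exists a, (i < a < j)%N /\ c (o a) = ((c (o i)).1, (c (o i)).2 - 1)).
Proof.
elim: N i j c => [|N IHN] i j c; first by lia.
move=> leN /andP[ij jn] oc e.
have [e1|n1] := eqVneq j i.+1.
  by have := occurs_adj (i := i) ltac:(lia) oc; rewrite -e1 -e /separated !eqxx.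
have [e2|n2] := eqVneq j i.+2.
  by have := occurs_skip (i := i) ltac:(lia) oc; rewrite -e2 -e /separated !eqxx.
have i_n : (i < n)%N by lia.
have [j' ej] : exists j', j = j'.+1 by case: (j) ij => // j' _; exists j'.
have [b1|b1] := eqVneq (beta (c (o i)) (c (o i.+1))) 0; last first.
  have [||||[a [ha ea]] [a' [ha' ea']]] := IHN i.+1 j (swap_wt i c).
  - by lia.
  - by lia.
  - exact: occurs_swap.
  - by rewrite swap_wtR // e swap_wt_out //; lia.
  - rewrite swap_wtR // in ea ea'; rewrite !swap_wt_out in ea ea'; try lia.
    by split; [exists a | exists a']; split=> //; lia.
have [b2|b2] := eqVneq (beta (c (o j')) (c (o j'.+1))) 0; last first.
  have [||||[a [ha ea]] [a' [ha' ea']]] := IHN i j' (swap_wt j' c).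
  - by lia.
  - by lia.
  - by apply: occurs_swap => //; lia.
  - by rewrite swap_wtL -?ej // swap_wt_out //; lia.
  - rewrite !swap_wt_out in ea ea'; try lia.
    by split; [exists a | exists a']; split=> //; lia.
have [p1 h1] := beta_comp b1; have [p2 h2] := beta_comp b2; rewrite -ej -e in p2 h2.
have y : c (o i.+1) = ((c (o i)).1, (c (o i.+1)).2) by rewrite p1 -surjective_pairing.
have z : c (o j') = ((c (o i)).1, (c (o j')).2) by rewrite -p2 -surjective_pairing.
(* If the inner neighbours have equal residues, induction between them produces another occurrence
   of the original entry, and then induction applies to that shorter interval. If they differ, they
   are the two neighbours sought. *)
have [yz|yz] := eqVneq (c (o i.+1)).2 (c (o j')).2.
  have [a [ha ea]] : exists a, (i < a < j)%N /\ c (o a) = c (o i).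
    have [||||[a [ha ea]] [a' [ha' ea']]] := IHN i.+1 j' c; try lia; try done.
      by rewrite y z yz.
    case: h1 => h1; [exists a' | exists a]; split; try lia.
      by rewrite ea' -p1 h1 addrK -surjective_pairing.
    by rewrite ea -p1 h1 subrK -surjective_pairing.
  have [||||[b [hb eb]] [b' [hb' eb']]] := IHN i a c; try lia; try done.
  by split; [exists b | exists b']; split=> //; lia.
have z2 : (c (o j')).2 = (c (o i)).2 - 1 \/ (c (o j')).2 = (c (o i)).2 + 1.
  by case: h2 => ->; [left; rewrite addrK | right; rewrite subrK].
case: h1 => h1; case: z2 => h3; try by rewrite h1 h3 eqxx in yz.
- by split; [exists i.+1; rewrite y h1 | exists j'; rewrite z h3]; split=> //; lia.
- by split; [exists j'; rewrite z h3 | exists i.+1; rewrite y h1]; split=> //; lia.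
Qed.

(** Moved towards the front, the entry either arrives at index 0, where the residue is 0, or is
    stopped by an entry with vanishing [beta]. *)
Lemma occurs_neighbour j c : (j <= n)%N -> occurs c -> (c (o j)).2 = 0 \/
  exists i, [/\ (i < j)%N, (c (o i)).1 = (c (o j)).1
    & (c (o i)).2 = (c (o j)).2 + 1 \/ (c (o i)).2 + 1 = (c (o j)).2].
Proof.
elim: j c => [|j IHj] c jn oc; first by left; apply: occurs_first.
have [b0|b0] := eqVneq (beta (c (o j)) (c (o j.+1))) 0.
  have [p1 h] := beta_comp b0; right; exists j; split=> //.
  by case: h => ->; [right | left; rewrite subrK].
have := IHj (swap_wt j c) (ltnW jn) (occurs_swap jn b0 oc).
rewrite swap_wtL // => -[->|[i [ij]]]; first by left.
rewrite !swap_wt_out //; try lia.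
by move=> h1 h2; right; exists i; split=> //; lia.
Qed.

Lemma occurs_tableau c : occurs c -> exists l : r.-tuple (seq nat),
  r_splittable_shape p n.+1 l /\
  exists2 t, t \in p_standard_tableaux n.+1 p l & tab_wt K t = c.
Proof.
move=> oc; have oo (a : 'I_n.+1) : o a = a by apply/val_inj; rewrite /= inordK.
have [i j ij eq ec|j|l [spl [t tT h]]] :=
  @tableau_of_residues K p r n.+1 pK p_gt2 (fun a => (c a).1) (fun a => (c a).2).
- have e : c i = c j by rewrite [LHS]surjective_pairing eq ec -surjective_pairing.
  have := @occurs_between _ i j c (leqnn _) ltac:(have := ltn_ord j; lia) oc.
  rewrite !oo => /(_ e)[[a [ha ea]] [b [hb eb]]].
  have jn := ltn_ord j.
  split; [exists (o a) | exists (o b)]; rewrite inordK ?ea ?eb; try lia; split=> //=.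
  by rewrite subrK.
- have := @occurs_neighbour j c ltac:(have := ltn_ord j; lia) oc; rewrite !oo => -[->|[i [ij h1 h2]]].
    by left.
  by right; exists (o i); rewrite inordK //; have := ltn_ord j; lia.
- exists l; split=> //; exists t => //; apply/ffunP => a; rewrite ffunE.
  by have [-> ->] := h a; rewrite -surjective_pairing.
Qed.

(** The polynomial X^r - 1 annihilates the matrix and has the distinct roots zeta^i; dimension 0 is
    treated apart, as the minimal polynomial criterion is applied in positive dimension. *)
Lemma t_mx_diag j : diagonalizable (rG (wr_t r j)).
Proof.
case: d rG => [|d'] rG'.
  exists 1%:M; rewrite ?unitmx1 //; apply/diagonalizable_forPex; exists 0.
  by apply/simmxP; rewrite ?unitmx1 //; apply/matrixP => -[].
apply/diagonalizableP; exists [seq zeta ^+ i | i <- index_iota 0 r].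
  rewrite map_inj_in_uniq ?iota_uniq // => i k; rewrite !mem_index_iota /= => ir kr /eqP.
  by rewrite (eq_prim_root_expr zeta_prim) !modn_small // => /eqP.
rewrite big_map (factor_Xn_sub_1 zeta_prim); apply/mxminpoly_minP.
rewrite rmorphB rmorphXn /= horner_mx_X horner_mx_C -repr_mxX ?inE //.
by rewrite wr_t_expg ?(prim_order_gt0 zeta_prim) // repr_mx1 subrr.
Qed.

Lemma occurs_ex : (0 < d)%N -> exists c, occurs c.
Proof.
move=> d0; pose As := [seq wt_op rG k | k : 'I_n.+1 + 'I_n.+1].
have [P Pu /allP PA] : exists2 P : 'M[K]_d, P \in unitmx & all [pred A | similar_diag P A] As.
  apply/codiagonalizableP; split.
    move=> _ _ /mapP[k _ ->] /mapP[k' _ ->]; rewrite /comm_mx.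
    case: k k' => j [j'|j'] /=; first by rewrite -!wr_reprM wr_tC.
    - exact: jm_tC.
    - by rewrite jm_tC.
    - exact: jm_jmC.
  by move=> _ /mapP[[j|j] _ ->] /=; [apply: t_mx_diag | apply: CS].
pose x := row (Ordinal d0) P.
have x0 : x != 0.
  apply/eqP => x0; have := row_free_unit P; rewrite Pu => /row_freeP[Q PQ].
  have := congr1 (row (Ordinal d0)) PQ; rewrite row_mul -/x x0 mul0mx => /rowP/(_ (Ordinal d0))/eqP.
  by rewrite !mxE !eqxx eq_sym oner_eq0.
have ev k : exists a, x *m wt_op rG k = a *: x.
  have /PA/= : wt_op rG k \in As by apply: map_f; rewrite mem_enum.
  case/diagonalizable_forPex => D /(simmxP Pu) e; exists (D 0 (Ordinal d0)).
  by rewrite -row_mul e; apply/rowP => i; rewrite mxE mul_diag_mx !mxE.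
have evt j : {q : 'I_r | x *m rG (wr_t r j) == zeta ^+ q *: x}.
  apply: sigW; have [a ea] := ev (inl j); rewrite /= in ea.
  have ar : a ^+ r = 1.
    have := eigen_expg r ea; rewrite wr_t_expg // repr_mx1 mulmx1 => /eqP.
    rewrite -subr_eq0 -{1}[x]scale1r -scalerBl scaler_eq0 (negPf x0) orbF subr_eq0.
    by move/eqP.
  by have [q eq] := prim_rootP zeta_prim ar; exists q; rewrite ea eq.
have evj k : {b : K | x *m jucys_murphy rG k == (r%:R * b) *: x}.
  apply: sigW; have [a ea] := ev (inr k); exists (a / r%:R).
  by rewrite /= in ea; rewrite ea mulrC divfK.
exists [ffun k => (sval (evt k), sval (evj k))], x => //.
by split=> k; rewrite ffunE /=; apply/eqP; [case: (evt k) | case: (evj k)].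
Qed.

Lemma run_wt c x w : (run step (c, x) w).1 = [ffun a => c ((perm_of_word n w)^-1%g a)].
Proof.
elim/last_ind: w => [|w i IHw]; first by apply/ffunP => a; rewrite ffunE perm_of_word_nil invg1 perm1.
rewrite run_rcons /= IHw; apply/ffunP => a.
by rewrite !ffunE perm_of_word_rcons invMg permM adjV.
Qed.

(* Steps between equal adjacent entries are impossible, so a nonzero path never
   exchanges two equal entries of the weight. *)
Lemma run_monotone c x w : is_wt c x -> all (gtn n) w -> (run step (c, x) w).2 != 0 ->
  forall a b : 'I_n.+1, (a < b)%N -> c a = c b ->
    (perm_of_word n w a < perm_of_word n w b)%N.
Proof.
move=> wx; elim/last_ind: w => [|w i IHw] wn nz a b ab eab.
  by rewrite perm_of_word_nil !perm1.
move: wn nz; rewrite all_rcons run_rcons => /andP[/= i_n wn] nz.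
have Pw : wt_state zeta rG (run step (c, x) w) by apply: (run_stable WS wn).
have nzw : (run step (c, x) w).2 != 0 by apply: (ws_back WS i_n Pw nz).
have lt := IHw wn nzw a b ab eab.
have sep := wt_adj_ne zeta_prim r_neq0 CS i_n Pw nzw.
rewrite perm_of_word_rcons !permM.
have v1 := adj_val (perm_of_word n w a) i_n; have v2 := adj_val (perm_of_word n w b) i_n.
rewrite /= in v1 v2; rewrite v1 v2.
have ne : ~ (perm_of_word n w a = i :> nat /\ perm_of_word n w b = i.+1 :> nat).
  case=> h1 h2; move: sep; rewrite run_wt !ffunE.
  have -> : o i = perm_of_word n w a by apply/val_inj; rewrite /= inordK // -?h1.
  have -> : o i.+1 = perm_of_word n w b by apply/val_inj; rewrite /= inordK // -?h2.
  by rewrite !permK eab /separated !eqxx.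
exact: adj_lt.
Qed.

Lemma closed_path c x w : is_wt c x -> all (gtn n) w -> (run step (c, x) w).2 != 0 ->
  (run step (c, x) w).1 = c -> perm_of_word n w = 1%g.
Proof.
move=> wx wn nz ec; apply: (monotone_fibres_id (c := c)) => [a|a b ab eab]; last first.
  exact: (run_monotone wx wn nz ab eab).
by rewrite -{1}ec run_wt ffunE permK.
Qed.

Lemma step_eq i c x : x *m G i =
  alpha (c (o i)) (c (o i.+1)) *: x + scale_of sqroot (c (o i)) (c (o i.+1)) *: (step i (c, x)).2.
Proof.
rewrite /= /step_vec scalerA divff ?scale_of_neq0 // scale1r /raw_step addrC subrK.
by [].
Qed.

(** The span of all runs from [s]: by path independence the finitely many normal forms suffice. *)
Definition orbit_mx (s : wt * 'rV[K]_d) : 'M[K]_d :=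
  (\sum_(u : {perm 'I_n.+1}) <<(run step s (nf n u)).2>>)%MS.

Lemma orbit_mem s w : is_wt s.1 s.2 -> all (gtn n) w -> ((run step s w).2 <= orbit_mx s)%MS.
Proof.
move=> ws wn; have [->|nz] := eqVneq (run step s w).2 0; first exact: sub0mx.
rewrite (run_nf WS wn ws nz); apply: (sumsmx_sup (perm_of_word n w)) => //.
by rewrite genmxE.
Qed.

Lemma orbit_module s : is_wt s.1 s.2 -> mxmodule rG (orbit_mx s).
Proof.
move=> ws; suff H (g : wreath r n.+1) : (orbit_mx s *m rG g <= orbit_mx s)%MS.
  by apply/mxmoduleP => g _.
apply: (@wreath_ind r n (fun g => (orbit_mx s *m rG g <= orbit_mx s)%MS) _ _ _ _ g).
- by rewrite repr_mx1 mulmx1.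
- move=> y z hy hz; rewrite wr_reprM mulmxA.
  exact: submx_trans (submxMr _ hy) hz.
- move=> j; rewrite sumsmxMr; apply/sumsmx_subP => u _.
  rewrite (eqmxMr _ (genmxE _)).
  have wu : wt_state zeta rG (run step s (nf n u)) by apply: (run_stable WS) => //; apply: nf_lt.
  by rewrite (proj1 wu) scalemx_sub //; apply: orbit_mem => //; apply: nf_lt.
- move=> i i_n; rewrite sumsmxMr; apply/sumsmx_subP => u _.
  rewrite (eqmxMr _ (genmxE _)) -/(G i).
  have := step_eq i (run step s (nf n u)).1 (run step s (nf n u)).2.
  rewrite -surjective_pairing -run_rcons => ->.
  have un : all (gtn n) (nf n u) by apply: nf_lt.
  rewrite addmx_sub // scalemx_sub //; apply: orbit_mem => //.
  by rewrite all_rcons /= i_n.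
Qed.

Hypothesis irr : mx_irreducible rG.

(* If beta = 0, the step squares to 0; were its value y nonzero, irreducibility
   would give a path from y back to x, and the closed path so obtained has
   trivial permutation, so it is the same step again, applied to y. *)
Lemma step_beta0 i c x : (i < n)%N -> is_wt c x -> beta (c (o i)) (c (o i.+1)) = 0 ->
  (step i (c, x)).2 = 0.
Proof.
move=> i_n wx b0; apply/eqP; apply: contraT => y0.
have wy : wt_state zeta rG (step i (c, x)) := ws_stable WS i_n (x := (c, x)) wx.
have x0 : x != 0 := ws_back WS i_n (x := (c, x)) wx y0.
set s := step i (c, x) in y0 wy *.
have full : row_full (orbit_mx s).
  have /mx_irrP[_ h] := irr; apply: h; first exact: orbit_module.
  apply: contra y0 => /eqP z; rewrite -submx0 -z.
  exact: (orbit_mem (w := [::])).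
(* This writes [x] as a sum of weight vectors at the ends of paths from the stepped vector; by
   [wt_extract] one nonzero summand has the weight of [x]. *)
have [u_ ex] := sub_sumsmxP (submx_full x full).
have z_ u : exists a, u_ u *m <<(run step s (nf n u)).2>>%MS = a *: (run step s (nf n u)).2.
  by apply/sub_rVP; apply: submx_trans (submxMl _ _) _; rewrite genmxE.
have wu (u : {perm 'I_n.+1}) :
    is_wt (run step s (nf n u)).1 (u_ u *m <<(run step s (nf n u)).2>>%MS).
  have [a ->] := z_ u; apply: is_wtZ.
  by apply: (run_stable WS) => //; apply: nf_lt.
have [u [eu nzu]] := wt_extract zeta_prim r_neq0 wx x0 wu ex.
have nz : (run step s (nf n u)).2 != 0.
  by have [a e] := z_ u; move: nzu; rewrite e; apply: contra_neq => ->; rewrite scaler0.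
have /(closed_path wx) : all (gtn n) (i :: nf n u) by rewrite /= i_n; apply: nf_lt.
have nfu : perm_of_word n (nf n u) = u.
  by apply: nf_perm => // a; rewrite ltnNge -ltnS ltn_ord.
move/(_ nz eu); rewrite -cat1s perm_of_word_cat perm_of_word_seq1 nfu => /eqP.
rewrite -eq_invg_mul adjV => /eqP eu'.
move: nz; rewrite -eu' nf_adj // /s /= swap_wtL // swap_wtR //.
by rewrite (step_vec_sq sqrootK) b0 eqxx /= eqxx.
Qed.

(** * The nonzero homomorphism from a Young module *)

Section Intertwiner.
Variables (l : r.-tuple (seq nat)) (l_spl : r_splittable_shape p n.+1 l).
Local Notation T := (p_standard_tableaux n.+1 p l).
Local Notation D := (spl_repr pK p_gt2 sqrootK l_spl zeta_prim).
Local Notation vec := (@tab_vec K p r n l).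
Variables (t0 : filling r n.+1) (x0 : 'rV[K]_d).
Hypotheses (t0T : t0 \in T) (x0_neq0 : x0 != 0) (x0_wt : is_wt (tab_wt K t0) x0).

Definition path_to (t : filling r n.+1) w := [/\ all (gtn n) w, (run step (tab_wt K t0, x0) w).2 != 0
  & forall a, t a = t0 ((perm_of_word n w)^-1%g a)].

Lemma path_to_wt t w : path_to t w -> (run step (tab_wt K t0, x0) w).1 = tab_wt K t.
Proof.
case=> _ _ e; rewrite run_wt; apply/ffunP => a; rewrite !ffunE.
by rewrite /box_comp /content /box_col /box_row !e.
Qed.

Lemma path_to_swap t w i : (i < n)%N -> tab_beta sqroot i t != 0 -> path_to t w ->
  path_to (swap_at i t) (rcons w i).
Proof.
move=> i_n b0 pt; have ew := path_to_wt pt; have [wn nz e] := pt; split.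
- by rewrite all_rcons /= i_n.
- rewrite run_rcons; apply: contra_neq nz => s0.
  set s := run step _ _ in ew s0 *.
  have := step_vec_sq sqrootK rG i (s.1 (o i)) (s.1 (o i.+1)) s.2.
  by rewrite -[step_vec _ _ (s.1 (o i)) _ _]/(step i s).2 s0 step_vec0 ew -/(tab_beta sqroot i t) (negPf b0).
- by move=> a; rewrite ffunE e perm_of_word_rcons invMg permM adjV.
Qed.

Lemma path_to_exists t : t \in T -> exists w, path_to t w.
Proof.
move=> tT; apply: (tab_connected pK p_gt2 l_spl (Q := fun t => exists w, path_to t w) _ tT t0T).
  move=> {t} s j j1 _ [w pw] ej adm {tT}.
  have j_n : (j < n)%N by have := ltn_ord j1; rewrite ej ltnS.
  have e1 : j = o j by apply/val_inj; rewrite /= inordK.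
  have e2 : j1 = o j.+1 by apply/val_inj; rewrite /= inordK // -ej.
  have -> : swap_entries j j1 s = swap_at j s by rewrite e2 {1}e1.
  exists (rcons w j); apply: path_to_swap => //; apply/eqP => b0.
  have [ec _] := beta_comp b0; rewrite !ffunE /= -e1 -e2 in ec.
  have [n1 n2] := adm ec; rewrite e1 e2 in ec n1 n2.
  by case: (tab_beta_eq0 sqrootK ec b0) => h; rewrite h eqxx in n1 n2.
by exists [::]; split=> // a; rewrite perm_of_word_nil invg1 perm1.
Qed.

(** Entries of [t0] occupy distinct boxes, so [t] determines the permutation of the word, and path
    independence applies. *)
Lemma path_to_unique t w w' : path_to t w -> path_to t w' ->
  run step (tab_wt K t0, x0) w = run step (tab_wt K t0, x0) w'.
Proof.
move=> [wn nz e] [wn' nz' e']; apply: (run_perm_of_word WS) => //.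
apply: invg_inj; apply/permP => a; apply: (tab_inj t0T).
by rewrite -e -e'.
Qed.

(** The basis vector of [t] is sent to the end of any path from [t0] to [t], which is well defined
    by [path_to_unique]. *)
Lemma spl_intertwiner : exists2 B : 'M[K]_(#|T|, d), B != 0 &
  forall g, D g *m B = B *m rG g.
Proof.
have /fin_all_exists[w_ pw] (a : 'I_#|T|) : exists w, path_to (enum_val a) w.
  exact/path_to_exists/enum_valP.
pose B : 'M[K]_(#|T|, d) := \matrix_a (run step (tab_wt K t0, x0) (w_ a)).2.
have Brow t w : t \in T -> path_to t w -> vec t *m B = (run step (tab_wt K t0, x0) w).2.
  case/tab_enum => a <- pt; rewrite tab_vec_enum -rowE rowK.
  by rewrite (path_to_unique (pw a) pt).
exists B.
  have p0 : path_to t0 [::] by split=> // a; rewrite perm_of_word_nil invg1 perm1.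
  apply/eqP => B0; have := Brow _ _ t0T p0; rewrite B0 mulmx0 /= => e0.
  by move: x0_neq0; rewrite -e0 eqxx.
apply: (@wreath_ind r n (fun g => D g *m B = B *m rG g)).
- by rewrite !repr_mx1 mul1mx mulmx1.
- by move=> g h hg hh; rewrite !wr_reprM -mulmxA hh mulmxA hg mulmxA.
- move=> j; apply: tab_vec_ext => t tT; rewrite (mulmxA _ B) (mulmxA _ (D _)) spl_repr_t // -scalemxAl.
  have [w pt] := path_to_exists tT; rewrite (Brow t w) //.
  have [wn _ _] := pt.
  have /proj1/(_ j) := run_stable WS wn (x := (tab_wt K t0, x0)) x0_wt.
  by rewrite (path_to_wt pt) ffunE => ->.
- move=> i i_n; apply: tab_vec_ext => t tT; rewrite (mulmxA _ B) (mulmxA _ (D _)) spl_repr_g // mulmxDl -!scalemxAl.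
  have [w pt] := path_to_exists tT; have [wn _ _] := pt; rewrite (Brow t w) //.
  set s := run step (tab_wt K t0, x0) w.
  have es : s.1 = tab_wt K t := path_to_wt pt.
  have := step_eq i s.1 s.2; rewrite -surjective_pairing /G => ->.
  rewrite es -/(tab_alpha K i t); congr (_ + _).
  (* Where [beta] vanishes, Young's form has no off-diagonal term, and [step_beta0] says the same of
     the given module. *)
  rewrite /scale_of -/(tab_beta sqroot i t); case: eqP => [b0|/eqP b0].
    have ws : is_wt s.1 s.2 by apply: (run_stable WS wn (x := (tab_wt K t0, x0))).
    have := step_beta0 i_n ws; rewrite es -/(tab_beta sqroot i t) => /(_ b0).
    by rewrite b0 scale0r -es -surjective_pairing => ->; rewrite scaler0.
  have pt' := path_to_swap i_n b0 pt.
  rewrite (Brow (swap_at i t) (rcons w i)) // ?run_rcons //.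
  exact: (tab_swap_in pK p_gt2 sqrootK l_spl).
Qed.

End Intertwiner.

Lemma mx_rsim_of_intertwiner d1 d2 (r1 : wr_repr K r n.+1 d1) (r2 : wr_repr K r n.+1 d2)
    (B : 'M[K]_(d1, d2)) : mx_irreducible r1 -> mx_irreducible r2 -> B != 0 ->
  (forall g, r1 g *m B = B *m r2 g) -> mx_rsim r1 r2.
Proof.
move=> /mx_irrP[_ irr1] /mx_irrP[_ irr2] B0 hB.
have Bfree : row_free B.
  rewrite -kermx_eq0; apply: contraT => k0.
  have /irr1/(_ k0) : mxmodule r1 (kermx B).
    apply/mxmoduleP => g _; apply/sub_kermxP; rewrite -mulmxA hB mulmxA.
    by rewrite (sub_kermxP (submx_refl _)) mul0mx.
  rewrite -sub1mx => /sub_kermxP; rewrite mul1mx => e.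
  by rewrite e eqxx in B0.
have Bfull : row_full B.
  have /irr2 : mxmodule r2 <<B>>%MS.
    apply/mxmoduleP => g _; rewrite (eqmxMr _ (genmxE _)) genmxE -hB; exact: submxMl.
  rewrite -mxrank_eq0 genmxE mxrank_eq0 => /(_ B0).
  by rewrite /row_full genmxE.
apply: (MxReprSim (B := B)) => //.
by have /eqP := Bfree; have /eqP := Bfull; move=> -> ->.
Qed.

Lemma irr_cs_classification :
  exists (l : r.-tuple (seq nat)) (l_spl : r_splittable_shape p n.+1 l),
    mx_rsim rG (spl_repr pK p_gt2 sqrootK l_spl zeta_prim).
Proof.
have /mx_irrP[d0 _] := irr; have [c oc] := occurs_ex d0.
have [l [spl [t tT et]]] := occurs_tableau oc.
have [x x0 wx] := oc; rewrite -et in wx.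
exists l, spl; apply: mx_rsim_sym.
have [B B0 hB] := spl_intertwiner spl tT x0 wx.
exact: mx_rsim_of_intertwiner (spl_repr_irr _ _ _ _ _ _) irr B0 hB.
Qed.

End Exhaustion.

(** An isomorphism preserves weights, so the weight of a tableau of shape [l] is also that of a
    tableau of shape [m]; the two tableaux coincide, and a tableau determines its shape. *)
Lemma spl_repr_rsim_eq (K : fieldType) (p r n : nat) (zeta : K) (sqroot : K -> K)
    (pK : p \in [pchar K]) (p_gt2 : (2 < p)%N) (sqrootK : forall x : K, sqroot x ^+ 2 = x)
    (zeta_prim : r.-primitive_root zeta) (r_neq0 : r%:R != 0 :> K)
    (l m : r.-tuple (seq nat)) (ls : r_splittable_shape p n.+1 l) (ms : r_splittable_shape p n.+1 m) :
  mx_rsim (spl_repr pK p_gt2 sqrootK ls zeta_prim)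
          (spl_repr pK p_gt2 sqrootK ms zeta_prim) -> l = m.
Proof.
case=> B _ Bfree hB; have [t tT] := tab_exists pK p_gt2 ls (ltn0Sn n).
pose y := tab_vec K p l t *m B.
have y0 : y != 0.
  apply: contra (tab_vec_neq0 K tT) => /eqP e.
  by rewrite -[tab_vec K p l t](mulmxKp Bfree) -/y e mul0mx.
have wy : is_wt zeta (spl_repr pK p_gt2 sqrootK ms zeta_prim) (tab_wt K t) y.
  have [h1 h2] := tab_vec_wt pK p_gt2 sqrootK ls zeta_prim r_neq0 t.
  split=> j; first by rewrite /y -mulmxA -hB ?inE // mulmxA h1 -scalemxAl.
  rewrite /y -mulmxA.
  have -> : B *m jucys_murphy (spl_repr pK p_gt2 sqrootK ms zeta_prim) j =
      jucys_murphy (spl_repr pK p_gt2 sqrootK ls zeta_prim) j *m B.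
    rewrite mulmx_sumr mulmx_suml; apply: eq_bigr => i _.
    by rewrite mulmx_sumr mulmx_suml; apply: eq_bigr => s _; rewrite -hB ?inE.
  by rewrite mulmxA h2 -scalemxAl.
have [a [ea _]] := wt_extract zeta_prim r_neq0
  (c_ := fun b : 'I_#|p_standard_tableaux n.+1 p m| => tab_wt K (enum_val b))
  (x_ := fun b => y 0 b *: tab_vec K p m (enum_val b)) wy y0
  (fun b => is_wtZ (y 0 b) (tab_vec_wt pK p_gt2 sqrootK ms zeta_prim r_neq0 _)) (row_tab_vec y).
have uT := enum_valP a; set u := enum_val a in ea uT.
have etu : t = u.
  by apply: (tab_unique_boxes pK p_gt2 ls ms tT uT) => b; move/ffunP/(_ b): ea; rewrite !ffunE => -[].
by apply: (shape_unique pK p_gt2 ls ms tT); rewrite etu.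
Qed.

Theorem theorem5p14 (K : closedFieldType) (p r n : nat)
    (hpK : p \in [pchar K]) (hp : (2 < p)%N)
    (hr : (1 <= r)%N) (hpr : ~~ (p %| r)%N) (hn : (1 <= n)%N)
    (zeta : K) (hzeta : r.-primitive_root zeta)
    (sqroot : K -> K) (hsqroot : forall x : K, sqroot x ^+ 2 = x) :
  exists (dim : {l : r.-tuple (seq nat) | r_splittable_shape p n l} -> nat)
         (D : forall l : {l : r.-tuple (seq nat) | r_splittable_shape p n l},
                wr_repr K r n (dim l)),
    [/\ forall l, mx_irreducible (D l) /\ completely_splittable (D l),
        forall l m, mx_rsim (D l) (D m) -> l = m,
        forall (d : nat) (rG : wr_repr K r n d),
          mx_irreducible rG -> completely_splittable rG ->
          exists l, mx_rsim rG (D l)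
      & forall l, exists v : filling r n -> 'rV[K]_(dim l),
          basis_of fullv
            [seq v t | t <- enum (p_standard_tableaux n p (val l))]
          /\ forall t, t \in p_standard_tableaux n p (val l) ->
            (forall j : 'I_n,
               v t *m D l (wr_t r j) = zeta ^+ box_comp t j *: v t)
            /\ forall i i1 : 'I_n, i1 = i.+1 :> nat ->
              let t' := swap_entries i i1 t in
              let c := content K t i1 - content K t i in
              let b := sqroot (1 - c ^- 2) in
              (box_comp t i != box_comp t i1 ->
                 t' \in p_standard_tableaux n p (val l)
                 /\ v t *m D l (wr_g r i i1) = v t')
              /\ (box_comp t i = box_comp t i1 ->
                 [/\ c != 0,
                     b != 0 -> t' \in p_standard_tableaux n p (val l)
                   & v t *m D l (wr_g r i i1) = c^-1 *: v t + b *: v t'])].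
Proof.
case: n hn => // n _ {hr}.
have r_neq0 : r%:R != 0 :> K by rewrite -(dvdn_pcharf hpK).
pose D (l : {l : r.-tuple (seq nat) | r_splittable_shape p n.+1 l}) :=
  spl_repr hpK hp hsqroot (proj2_sig l) hzeta.
exists (fun l => #|p_standard_tableaux n.+1 p (sval l)|), D; split.
- by move=> l; split; [apply: spl_repr_irr | apply: spl_repr_cs].
- by move=> l m /(spl_repr_rsim_eq r_neq0) e; exact: val_inj.
- move=> d rG irr cs.
  have [l [spl h]] := irr_cs_classification hpK hp hsqroot hzeta r_neq0 cs irr.
  by exists (exist _ l spl); exact: h.
move=> l; exists (tab_vec K p (sval l)); split.
  rewrite basisEdim size_map -cardE dimvf /dim /= mul1n leqnn andbT.
  apply/subvP => u _; rewrite [u]row_tab_vec memv_suml // => a _.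
  by rewrite memvZ // memv_span // map_f // mem_enum enum_valP.
move=> t tT; split=> [j|i i1 ei]; first exact: spl_repr_t.
have i_n : (i < n)%N by have := ltn_ord i1; rewrite ei ltnS.
have e1 : i = inord i by apply/val_inj; rewrite /= inordK.
have e2 : i1 = inord i.+1 by apply/val_inj; rewrite /= inordK // -ei.
have eg : wr_g r i i1 = wr_s r (adj n i) by rewrite e2 {1}e1.
have es : swap_entries i i1 t = swap_at i t by rewrite e2 {1}e1.
have act := spl_repr_g hpK hp hsqroot (proj2_sig l) hzeta i_n tT.
have sw := tab_swap_in hpK hp hsqroot (proj2_sig l) tT i_n.
have sep := tab_wt_sep hpK hp (proj2_sig l) tT i_n.
move=> t' c b; rewrite eg /t' es; split=> [ne|ec].
  have b1 : tab_beta sqroot i t = 1 by rewrite /tab_beta /beta !ffunE /= -e1 -e2 (negPf ne).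
  have a0 : tab_alpha K i t = 0 by rewrite /tab_alpha /alpha !ffunE /= -e1 -e2 (negPf ne).
  by split; [apply: sw; rewrite b1 oner_neq0 | rewrite act a0 b1 scale0r add0r scale1r].
have eb : tab_beta sqroot i t = b by rewrite /tab_beta /beta !ffunE /= -e1 -e2 ec eqxx.
have ea : tab_alpha K i t = c^-1 by rewrite /tab_alpha /alpha !ffunE /= -e1 -e2 ec eqxx.
split; last by rewrite act ea eb.
  by move: sep; rewrite /separated !ffunE /= -e1 -e2 ec eqxx /= subr_eq0 eq_sym.
by rewrite -eb; apply: sw.
Qed.
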